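(* Let $\{P_\theta:\theta\in\Theta\}$ be a family of distributions on $[0,1]^2$ as described in the context (in particular with $P_0$-densities $1+\theta q_\theta$, $q_\theta\to q\ne0$ in $L^2$), let $\beta\in(0,1)$, and let $A,A'\in\{B,C,D,E,F,DE\}$. Then for all $\epsilon\in(0,\epsilon^* )$ and all $\theta\in\Theta\setminus\{0\}$ with $|\theta|<\min(\theta_\epsilon^*,\theta_B,\theta_F,\theta_{DE})$, $$\frac{c_{A',+,\epsilon}(\theta)}{c_{A,-,\epsilon}(\theta)}\le\liminf_{\alpha\downarrow0}\frac{N_{T^A}(\alpha,\beta,\theta)}{N_{T^{A'}}(\alpha,\beta,\theta)}\le\limsup_{\alpha\downarrow0}\frac{N_{T^A}(\alpha,\beta,\theta)}{N_{T^{A'}}(\alpha,\beta,\theta)}\le\frac{c_{A',-,\epsilon}(\theta)}{c_{A,+,\epsilon}(\theta)}.$$ Moreover, the local exact Bahadur efficiency of $T^{A'}$ with respect to $T^A$ exists and is given by $$\mathrm{eff}^{\rm B}_{T^{A'},T^A}=\frac{\kappa(K(A'),q)}{\kappa(K(A),q)},\qquad \kappa(K(A),q):=\frac1{\lambda_{A,1}}\langle K(A)q,q\rangle,$$ that is, both $\liminf_{\alpha\downarrow0}N_{T^A}(\alpha,\beta,\theta)/N_{T^{A'}}(\alpha,\beta,\theta)$ and $\limsup_{\alpha\downarrow0}N_{T^A}(\alpha,\beta,\theta)/N_{T^{A'}}(\alpha,\beta,\theta)$ converge to this value as $\theta\to0$.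
   Context: **Pattern statistics.** $\mathbb S_n$ is the set of permutations of $[n]$ in one-line notation. For $\sigma\in\mathbb S_k$, $\pi\in\mathbb S_n$, $t(\sigma,\pi)=\binom nk^{-1}\#\{\{m_1<\dots<m_k\}\subset[n]:\pi_{m_i}<\pi_{m_j}\Leftrightarrow\sigma_i<\sigma_j\ \forall i<j\}$; $L_A(\pi)=\sum_{\sigma\in A}t(\sigma,\pi)$ for $A\subset\mathbb S_4$. For points $Z_i=(X_i,Y_i)$ without ties, $\Pi_n=R_n\circ Q_n^{-1}$ with rank vectors $Q_{n,i}=\#\{j\le n:X_j\le X_i\}$, $R_{n,i}=\#\{j\le n:Y_j\le Y_i\}$. Sets: $B=\{1234,1243,2134,2143,3412,3421,4312,4321\}$, $C=\{1234,1432,2143,2341,3214,3412,4123,4321\}$, $D=\{1324,1342,2413,2431,3124,3142,4213,4231\}$, $E=\{1324,1423,2314,2413,3142,3241,4132,4231\}$, $F=B\cup C$. $T_n^A=L_A(\Pi_n)-\#A/24$ for $A\in\{B,C,F\}$, $T_n^A=\#A/24-L_A(\Pi_n)$ for $A\in\{D,E\}$, $T_n^{DE}=T_n^D+T_n^E$ ($n\ge4$). $T_n^A$ is the $U$-statistic with the symmetric kernel $h^A(z_1,\dots,z_4)=T_4^A(z_1,\dots,z_4)$ on $([0,1]^2)^4$ (if the arguments have ties, all pattern indicators are set to 0). **Family.** $\Theta\subset\mathbb R$ is an open interval containing $0$; the $P_\theta$ are pairwise distinct probability measures on $[0,1]^2$ whose distribution functions are bivariate copulas; $P_0$ is the uniform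 distribution. $P_\theta$ has $P_0$-density $1+\theta q_\theta$ with $q_\theta,q\in\mathbb H_2:=L^2([0,1]^2,P_0)$, $q\ne0$, $\|q_\theta-q\|\to0$ as $\theta\to0$. Under $P_\theta$ the $Z_1,Z_2,\dots$ are i.i.d. with distribution $P_\theta$. $b_A(\theta):=E_\theta h^A(Z_1,\dots,Z_4)$; one has $b_A(\theta)=6\theta^2\langle K(A)q,q\rangle+o(\theta^2)$, and $b_A(\theta)>0$ for small $|\theta|>0$. **Sample sizes.** $L_{T^A,n}:=P_0(T_n^A\ge t)|_{t=T_n^A}$ is the attained level; for $0<\alpha<\beta<1$, $\theta\ne0$, $N_{T^A}(\alpha,\beta,\theta):=\inf\{m\ge4:P_\theta(L_{T^A,n}\le\alpha)\ge\beta\text{ for all }n\ge m\}$. (The tests are consistent, so this is finite.) **Operators.** $h_2^A(z_1,z_2)=E_0h^A(z_1,z_2,Z_3,Z_4)$; $K(A)$ is the integral operator $f\mapsto\int h_2^A(\cdot,z)f(z)\,P_0(dz)$ on $\mathbb H_2$, which is positive; $\lambda_{A,1}$ is its largest eigenvalue. It is simple for $A\in\{B,F,DE\}$ and of multiplicity $m_A\ge2$ for $A\in\{C,D,E\}$. **Large-deviation functions** (they exist by a theorem of Nikitin and Ponikarov, 2001). For $A\in\{B,F,DE\}$: $\delta_A>0$ and an analytic $d_A$ on $(-\delta_A,\delta_A)$, $d_A(s)=\frac{s^2}{6\lambda_{A,1}}+\sum_{j\ge3}d_{A,j}s^j$, are such that $\lim_n-\frac1n\log P_0(T_n^A\ge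 t+t_n)=\frac12d_A(t^{1/2})>0$ for all $t\in(0,\delta_A^2)$ and real $t_n\to0$; $\theta_A>0$ is such that $0<b_A(\theta)<\delta_A^2$ for $\theta\in\Theta$, $0<|\theta|<\theta_A$; $c_{A,+,\epsilon}(\theta):=c_{A,-,\epsilon}(\theta):=d_A(b_A(\theta)^{1/2})$. For $A\in\{C,D,E\}$: let $s_A$ be the largest eigenvalue of $K(A)$ different from $\lambda_{A,1}$, $\epsilon^*:=\min\{\lambda_{A,1}-s_A:A\in\{C,D,E\}\}$, $\varphi_{A,1},\dots,\varphi_{A,m_A}$ bounded orthonormal eigenfunctions for $\lambda_{A,1}$, $V_n^A=n^{-4}\sum_{(i_1,\dots,i_4)\in[n]^4}h^A(Z_{i_1},\dots,Z_{i_4})$, and for $\epsilon\in(0,\epsilon^* )$ $$V^A_{+,\epsilon,n}=V_n^A+6\epsilon\Bigl(\tfrac1n\sum_{j=1}^n\varphi_{A,1}(Z_j)\Bigr)^2,\qquad V^A_{-,\epsilon,n}=V_n^A-6\epsilon\sum_{\ell=2}^{m_A}\Bigl(\tfrac1n\sum_{j=1}^n\varphi_{A,\ell}(Z_j)\Bigr)^2,$$ $\lambda_{A,+,1,\epsilon}=\lambda_{A,1}+\epsilon$, $\lambda_{A,-,1,\epsilon}=\lambda_{A,1}$. There are $\delta_{A,\epsilon}>0$ and analytic $d_{A,\pm,\epsilon}$ on $(-\delta_{A,\epsilon},\delta_{A,\epsilon})$ with power series $\frac{s^2}{6\lambda_{A,\pm,1,\epsilon}}+\sum_{j\ge3}(\cdot)s^j$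 such that $\lim_n-\frac1n\log P_0(V^A_{\pm,\epsilon,n}\ge t+t_n)=\frac12d_{A,\pm,\epsilon}(t^{1/2})$ for all $t\in(0,\delta_{A,\epsilon}^2)$, $t_n\to0$. Put $\tau_{A,-,\epsilon}=\min(1,\delta_{A,\epsilon}^2,(3\|h^A\|_\infty)^{1/2})$, $\tau_{A,+,\epsilon}=\min((3\|h^A\|_\infty)^{1/2},-\frac12+(\delta_{A,\epsilon}^2+\frac14)^{1/2})$, $\tau_{A,\epsilon}=\min(\tau_{A,-,\epsilon},\tau_{A,+,\epsilon})$; $\theta_{A,\epsilon}>0$ is such that $0<b_A(\theta)<\tau_{A,\epsilon}$ for $\theta\in\Theta$, $0<|\theta|<\theta_{A,\epsilon}$; $\theta^*_\epsilon=\min(\theta_{C,\epsilon},\theta_{D,\epsilon},\theta_{E,\epsilon})$; and $$c_{A,+,\epsilon}(\theta)=d_{A,+,\epsilon}\bigl(\{b_A(\theta)(1-b_A(\theta))\}^{1/2}\bigr),\qquad c_{A,-,\epsilon}(\theta)=d_{A,-,\epsilon}\bigl(\{b_A(\theta)(1+b_A(\theta))\}^{1/2}\bigr).$$ *)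

(* Defs.v *)
From HB Require Import structures.
From mathcomp Require Import all_boot all_order all_algebra all_fingroup.
From mathcomp Require Import finmap.
From mathcomp Require Import all_classical all_reals all_analysis.

Set Implicit Arguments.
Unset Strict Implicit.
Unset Printing Implicit Defensive.

Import Order.TTheory GRing.Theory Num.Theory.
Import numFieldNormedType.Exports.

Local Open Scope classical_set_scope.
Local Open Scope ring_scope.

Definition one_line n (s : 'S_n) : seq nat := [seq (s i : nat).+1 | i <- enum 'I_n].

Definition patterns (w : seq (seq nat)) : {set 'S_4} :=
  [set s : 'S_4 | one_line s \in w]%SET.

Definition patternsB : {set 'S_4} := patterns
  [:: [:: 1; 2; 3; 4]; [:: 1; 2; 4; 3]; [:: 2; 1; 3; 4]; [:: 2; 1; 4; 3];
      [:: 3; 4; 1; 2]; [:: 3; 4; 2; 1]; [:: 4; 3; 1; 2]; [:: 4; 3; 2; 1]]%N.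

Definition patternsC : {set 'S_4} := patterns
  [:: [:: 1; 2; 3; 4]; [:: 1; 4; 3; 2]; [:: 2; 1; 4; 3]; [:: 2; 3; 4; 1];
      [:: 3; 2; 1; 4]; [:: 3; 4; 1; 2]; [:: 4; 1; 2; 3]; [:: 4; 3; 2; 1]]%N.

Definition patternsD : {set 'S_4} := patterns
  [:: [:: 1; 3; 2; 4]; [:: 1; 3; 4; 2]; [:: 2; 4; 1; 3]; [:: 2; 4; 3; 1];
      [:: 3; 1; 2; 4]; [:: 3; 1; 4; 2]; [:: 4; 2; 1; 3]; [:: 4; 2; 3; 1]]%N.

Definition patternsE : {set 'S_4} := patterns
  [:: [:: 1; 3; 2; 4]; [:: 1; 4; 2; 3]; [:: 2; 3; 1; 4]; [:: 2; 4; 1; 3];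
      [:: 3; 1; 4; 2]; [:: 3; 2; 4; 1]; [:: 4; 1; 3; 2]; [:: 4; 2; 3; 1]]%N.

Definition patternsF : {set 'S_4} := (patternsB :|: patternsC)%SET.

Section PatternStatistics.
Context {R : realType}.

(* A k-subset m_1 < ... < m_k is encoded by its increasing enumeration. *)
Definition occurrence k n (s : 'S_k) (p : 'S_n) (m : {ffun 'I_k -> 'I_n}) : bool :=
  [forall i : 'I_k, forall j : 'I_k, (i < j)%N ==>
     ((m i < m j)%N && ((p (m i) < p (m j))%N == (s i < s j)%N))].

Definition pattern_density k n (s : 'S_k) (p : 'S_n) : R :=
  #|[pred m | occurrence s p m]|%:R / 'C(n, k)%:R.

Definition pattern_sum (A : {set 'S_4}) n (p : 'S_n) : R :=
  \sum_(s in A) pattern_density s p.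

Lemma rank_subproof n (x : 'I_n -> R) (i : 'I_n) :
  (#|[pred j | (x j <= x i)%R]|.-1 < n)%N.
Proof.
case: n x i => [|n] x i; first by case: i.
by rewrite ltnS -subn1 leq_subLR add1n -[X in (_ <= X)%N]card_ord max_card.
Qed.

(* Ranks are shifted by one so as to lie in {0, ..., n-1}. *)
Definition rank n (x : 'I_n -> R) (i : 'I_n) : 'I_n := Ordinal (rank_subproof x i).

(* [Some] of the rank vector if [x] has no ties, [None] otherwise. *)
Definition rank_perm n (x : 'I_n -> R) : option 'S_n := insub [ffun i => rank x i].

(* Products of permutations compose from left to right, so that Q^-1 * S is
   the permutation V o Q^-1. *)
Definition sample_perm n (z : 'I_n -> R * R) : option 'S_n :=
  if (rank_perm (fun i => (z i).1), rank_perm (fun i => (z i).2)) is (Some Q, Some V)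
  then Some (Q^-1 * V)%g else None.

(* All pattern indicators are 0 if there are ties. *)
Definition sample_pattern_sum (A : {set 'S_4}) n (z : 'I_n -> R * R) : R :=
  oapp (@pattern_sum A n) 0 (sample_perm z).

Inductive stat := statB | statC | statD | statE | statF | statDE.

(* The statistics whose kernel operator has a simple largest eigenvalue. *)
Definition simple_stat (A : stat) : bool :=
  match A with statB | statF | statDE => true | statC | statD | statE => false end.

Definition excess (A : {set 'S_4}) n (z : 'I_n -> R * R) : R :=
  sample_pattern_sum A z - #|A|%:R / 24.

Definition deficit (A : {set 'S_4}) n (z : 'I_n -> R * R) : R :=
  #|A|%:R / 24 - sample_pattern_sum A z.

Definition T_stat (A : stat) n (z : 'I_n -> R * R) : R :=
  match A with
  | statB => excess patternsB z
  | statC => excess patternsC z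
  | statD => deficit patternsD z
  | statE => deficit patternsE z
  | statF => excess patternsF z
  | statDE => deficit patternsD z + deficit patternsE z
  end.

Definition kernel4 (A : stat) : ('I_4 -> R * R) -> R := @T_stat A 4.

Definition unit_square : set (R * R) := `[0, 1] `*` `[0, 1].

Definition kernel_sup (A : stat) : R :=
  sup [set `|kernel4 A z| | z in [set z : 'I_4 -> R * R | forall i, unit_square (z i)]].

End PatternStatistics.

Section Operators.
Context {R : realType} (mu : {measure set (R * R) -> \bar R}).
Implicit Types (f g : R * R -> R) (k : R * R -> R * R -> R).

Definition L2 f : Prop := f \in Lfun mu 2%:E.

Definition L2_zero f : Prop := ae_eq mu setT f (cst 0).

Definition dotp f g : R := \int[mu]_z (f z * g z).

Definition integral_operator k f (x : R * R) : R := \int[mu]_z (k x z * f z).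

Definition eigenfunction k (l : R) f : Prop :=
  [/\ L2 f, ~ L2_zero f & ae_eq mu setT (integral_operator k f) (fun x => l * f x)].

Definition eigenvalue_of k : set R := [set l | exists f, eigenfunction k l f].

Definition is_largest (S : set R) (l : R) : Prop := S l /\ ubound S l.

(* phi_1, ..., phi_m is an orthonormal basis, consisting of bounded functions,
   of the eigenspace of l; in particular m is the multiplicity of l. *)
Definition bounded_eigenbasis k (l : R) (m : nat) (phi : nat -> R * R -> R) : Prop :=
  [/\ forall i, (1 <= i <= m)%N -> eigenfunction k l (phi i),
      forall i, (1 <= i <= m)%N ->
        exists M : R, forall z, unit_square z -> `|phi i z| <= M,
      forall i j, (1 <= i <= m)%N -> (1 <= j <= m)%N ->
        dotp (phi i) (phi j) = (i == j)%:R
    & forall f, eigenfunction k l f ->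
        ae_eq mu setT f (fun z => \sum_(1 <= i < m.+1) dotp f (phi i) * phi i z)].

(* The kernel z1, z2 |-> E h(z1, z2, Z3, Z4) with Z3, Z4 independent of law mu. *)
Definition kernel2 (A : stat) (z1 z2 : R * R) : R :=
  \int[mu]_z3 (\int[mu]_z4 kernel4 A (tnth [tuple z1; z2; z3; z4])).

Definition K_op (A : stat) f : R * R -> R := integral_operator (kernel2 A) f.

Definition kappa (A : stat) (l : R) (q : R * R -> R) : R := l^-1 * dotp (K_op A q) q.

End Operators.

Section Model.
Context {R : realType}.

Definition cdf2 (P : set (R * R) -> \bar R) (u v : R) : R :=
  fine (P (`]-oo, u] `*` `]-oo, v])).

Definition is_copula (C : R -> R -> R) : Prop :=
  [/\ forall u : R, 0 <= u <= 1 -> C u 0 = 0 /\ C 0 u = 0,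
      forall u : R, 0 <= u <= 1 -> C u 1 = u /\ C 1 u = u
    & forall u u' v v' : R, 0 <= u -> u <= u' -> u' <= 1 -> 0 <= v -> v <= v' -> v' <= 1 ->
        0 <= C u' v' - C u' v - C u v' + C u v].

Record copula_family (Theta : set R) (P : R -> probability (R * R)%type R)
    (qq : R -> R * R -> R) (q : R * R -> R) : Prop := {
  Theta_open : open Theta ;
  Theta_interval : is_interval Theta ;
  Theta_0 : Theta 0 ;
  P_square : forall t, Theta t -> P t unit_square = 1%E ;
  P_copula : forall t, Theta t -> is_copula (cdf2 (P t)) ;
  P_distinct : forall t t', Theta t -> Theta t' -> t != t' ->
    exists A, measurable A /\ P t A <> P t' A ;
  P0_uniform : forall A, measurable A ->
    P 0 A = (lebesgue_measure \x lebesgue_measure)%E (A `&` unit_square) ;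
  qq_L2 : forall t, Theta t -> L2 (P 0) (qq t) ;
  q_L2 : L2 (P 0) q ;
  q_neq0 : ~ L2_zero (P 0) q ;
  P_density : forall t, Theta t -> forall A, measurable A ->
    P t A = (\int[P 0%R]_(z in A) (1 + t * qq t z)%R%:E)%E ;
  qq_cvg : ('N[P 0%R]_2%:E[EFin \o (fun z => qq t z - q z)%R])%E @[t --> (0 : R)^'] --> 0%E }.

Definition mutually_independent d (Omega : measurableType d) (Pr : probability Omega R)
    (Z : nat -> Omega -> R * R) : Prop :=
  forall (J : {fset nat}) (A : nat -> set (R * R)), (forall i, measurable (A i)) ->
    Pr (\bigcap_(i in [set` J]) Z i @^-1` A i) =
    (\prod_(i <- J) Pr (Z i @^-1` A i))%E.

(* [Z i], for i = 0, 1, ..., are the observations Z_1, Z_2, ... *)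
Record iid_observations d (Omega : measurableType d) (Theta : set R)
    (P : R -> probability (R * R)%type R) (Pr : R -> probability Omega R)
    (Z : nat -> Omega -> R * R) : Prop := {
  Z_measurable : forall i, measurable_fun setT (Z i) ;
  Z_independent : forall t, Theta t -> mutually_independent (Pr t) Z ;
  Z_law : forall t, Theta t -> forall i A, measurable A -> Pr t (Z i @^-1` A) = P t A }.

End Model.

Section Tests.
Context {R : realType} d (Omega : measurableType d).
Variables (Pr : R -> probability Omega R) (Z : nat -> Omega -> R * R).

Definition sample n (w : Omega) : 'I_n -> R * R := fun i => Z i w.
Arguments sample : clear implicits.

Definition T_n (A : stat) n (w : Omega) : R := T_stat A (sample n w).

Definition b_fun (A : stat) (t : R) : R := \int[Pr t]_w kernel4 A (sample 4 w).

Definition V_n (A : stat) n (w : Omega) : R :=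
  n%:R ^- 4 * \sum_(i : {ffun 'I_4 -> 'I_n}) kernel4 A (fun k => sample n w (i k)).

Definition Vplus_n (phi : nat -> R * R -> R) (A : stat) (e : R) n (w : Omega) : R :=
  V_n A n w + 6 * e * (n%:R^-1 * \sum_(j < n) phi 1%N (sample n w j)) ^+ 2.

Definition Vminus_n (m : nat) (phi : nat -> R * R -> R) (A : stat) (e : R) n
    (w : Omega) : R :=
  V_n A n w - 6 * e *
    \sum_(2 <= l < m.+1) (n%:R^-1 * \sum_(j < n) phi l (sample n w j)) ^+ 2.

Definition attained_level (A : stat) n (w : Omega) : \bar R :=
  Pr 0 [set w' | T_n A n w <= T_n A n w'].

Definition sample_size (A : stat) (alpha beta t : R) : \bar R :=
  ereal_inf [set (m%:R)%:E | m in [set m : nat | (4 <= m)%N /\ forall n, (m <= n)%N ->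
    (beta%:E <= Pr t [set w | (attained_level A n w <= alpha%:E)%E])%E]].

Definition size_ratio_liminf (A A' : stat) (beta t : R) : \bar R :=
  limf_einf (fun alpha => sample_size A alpha beta t / sample_size A' alpha beta t)%E
    (0 : R)^'+.

Definition size_ratio_limsup (A A' : stat) (beta t : R) : \bar R :=
  limf_esup (fun alpha => sample_size A alpha beta t / sample_size A' alpha beta t)%E
    (0 : R)^'+.

(* The local exact Bahadur efficiency of T^A' with respect to T^A exists and
   equals [e]. *)
Definition local_bahadur_efficiency (A' A : stat) (beta e : R) : Prop :=
  size_ratio_liminf A A' beta t @[t --> (0 : R)^'] --> e%:E /\
  size_ratio_limsup A A' beta t @[t --> (0 : R)^'] --> e%:E.

(* - log P_0(S_n >= t + t_n) / n --> d(sqrt t) / 2; [lne 0 = -oo]. *)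
Definition large_deviation (S : nat -> Omega -> R) (delta : R) (dd : R -> R) : Prop :=
  forall t : R, 0 < t < delta ^+ 2 -> forall u : R^nat, u @ \oo --> (0 : R) ->
    (- ((n%:R^-1)%:E * lne (Pr 0%R [set w | (t + u n <= S n w)%R])))%E @[n --> \oo]
      --> (dd (Num.sqrt t) / 2)%:E.

End Tests.

Section LargeDeviationData.
Context {R : realType}.

(* d(s) = s^2 / (6 l) + sum_(j >= 3) a_j s^j on (-delta, delta). *)
Definition rate_series (l delta : R) (dd : R -> R) : Prop :=
  exists a : R^nat, [/\ a 0%N = 0, a 1%N = 0, a 2%N = (6 * l)^-1 &
    forall s : R, `|s| < delta -> series (fun j => a j * s ^+ j) @ \oo --> dd s].

Definition tau_minus (A : stat) (delta : R) : R :=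
  Num.min (Num.min 1 (delta ^+ 2)) (Num.sqrt (3 * kernel_sup A)).

Definition tau_plus (A : stat) (delta : R) : R :=
  Num.min (Num.sqrt (3 * kernel_sup A)) (- 2^-1 + Num.sqrt (delta ^+ 2 + 4^-1)).

Definition tau (A : stat) (delta : R) : R :=
  Num.min (tau_minus A delta) (tau_plus A delta).

Definition c_plus (b : stat -> R -> R) (dd : stat -> R -> R)
    (dplus : stat -> R -> R -> R) (A : stat) (e t : R) : R :=
  if simple_stat A then dd A (Num.sqrt (b A t))
  else dplus A e (Num.sqrt (b A t * (1 - b A t))).

Definition c_minus (b : stat -> R -> R) (dd : stat -> R -> R)
    (dminus : stat -> R -> R -> R) (A : stat) (e t : R) : R :=
  if simple_stat A then dd A (Num.sqrt (b A t))
  else dminus A e (Num.sqrt (b A t * (1 + b A t))).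

End LargeDeviationData.

(* Main.v *)
Require Import Defs.
From HB Require Import structures.
From mathcomp Require Import all_boot all_order all_algebra all_fingroup.
From mathcomp Require Import finmap.
From mathcomp Require Import all_classical all_reals all_analysis.
From mathcomp Require Import measurable_realfun ring lra zify.
Set Implicit Arguments.
Unset Strict Implicit.
Unset Printing Implicit Defensive.
Import Order.TTheory GRing.Theory Num.Theory.
Import numFieldNormedType.Exports.
Local Open Scope classical_set_scope.
Local Open Scope ring_scope.

(** Up to a constant and, for F, a product of signs that averages out, the kernel of each
    statistic is a linear combination of sums over the three pairings of {1,2,3,4} of
    products of a function of the x-order and a function of the y-order.  Hence the
    kernel of K(A) is almost everywhere a nonnegative combination of products
    W_k(x,x') W_k'(y,y'), where W_k(x,x') is the integral over s of
    psi_k(s,x) psi_k(s,x').  The function cos(2 pi x) cos(2 pi y) is an eigenfunction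
    with positive eigenvalue, and <K(A)q,q> is a nonnegative combination of integrals of
    D_kk'^2, D_kk'(s,t) being the integral of q(x,y) psi_k(s,x) psi_k'(t,y).  If some
    D_kk' vanished almost everywhere, right continuity and the vanishing margins of q
    would force all integrals of q over quadrants to be 0, that is q = 0; so <K(A)q,q> > 0.

    Expanding the product densities and using the degeneracy of the kernel gives
    b_A(t) = 6 t^2 <K(A)q,q> + o(t^2).  Since |T_n - V_n| = O(1/n) off ties and T_n
    concentrates at b_A(t) under P_t, the large deviation limits at b_A(t), perturbed by
    null sequences, give N ~ log(1/alpha) / rate between the two rates, which bounds the
    ratios.  For A in {C,D,E} one uses V^- <= V <= V^+ and the monotonicity of the rates
    in the level, inherited from that of the tails.  Finally d(s) ~ s^2/(6 lambda) turns
    the bounds into the efficiency as t and then epsilon tend to 0. *)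

(** * Bounded measurable functions and Fubini's theorem *)

(** The statement assumes neither positive eigenvalues, nor positivity of <K(A)q,q>, nor the
    expansion of b_A, so the kernels have to be made explicit. This works because each pairing sum
    factors into an x-part and a y-part, and each factor, once averaged over two uniform points, is
    affine in a classical Gram kernel: that of the Cramer-von Mises statistic (k = 0) or that of
    Watson's statistic (k = 1). The cosine is a common eigenfunction of both and serves as a witness
    that the largest eigenvalue is positive. The attained level is a tail probability evaluated at
    the random point T_n, whereas the large deviation limits concern deterministic levels. Their
    stability under null sequences bridges the gap: T_n lies within a null sequence of b_A(t) with
    probability tending to 1, and tails are monotone. The levels b(1 - b) and b(1 + b) are handled
    through b(1 - b) <= b <= b(1 + b) alone. In the final limit epsilon is fixed first, according to
    the wanted precision, and t tends to 0 afterwards; the ratios of sample sizes do not depend on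
    epsilon. *)

Section bounded_functions.
Context d (T : measurableType d) {R : realType}.
Implicit Types f g : T -> R.

(** Boundedness is required at every point, not almost everywhere, so that sections, compositions
    and partial integrals remain in the class without exceptional sets. *)
Definition bfun f := measurable_fun setT f /\ exists M, forall x, `|f x| <= M.

Lemma bfun_bounded f (A : set T) : bfun f -> [bounded f x | x in A].
Proof.
move=> [_ [M fM]]; exists M; split; first by rewrite num_real.
by move=> N MN x Ax /=; rewrite (le_trans (fM x))// ltW.
Qed.

Lemma bfun_cst (c : R) : bfun (fun=> c).
Proof. by split; [exact: measurable_cst|exists `|c|]. Qed.

Lemma bfunD f g : bfun f -> bfun g -> bfun (fun x => f x + g x).
Proof.
move=> [mf [M fM]] [mg [N gN]]; split; first exact: measurable_funD.
by exists (M + N) => x; rewrite (le_trans (ler_normD _ _))// lerD.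
Qed.

Lemma bfunM f g : bfun f -> bfun g -> bfun (fun x => f x * g x).
Proof.
move=> [mf [M fM]] [mg [N gN]]; split; first exact: measurable_funM.
by exists (M * N) => x; rewrite normrM ler_pM.
Qed.

Lemma bfunN f : bfun f -> bfun (fun x => - f x).
Proof.
move=> /(bfunM (bfun_cst (- 1))).
by under eq_fun do rewrite mulN1r.
Qed.

Lemma bfunB f g : bfun f -> bfun g -> bfun (fun x => f x - g x).
Proof. by move=> bf /bfunN; exact: bfunD. Qed.

Lemma bfun_sum I (s : seq I) (F : I -> T -> R) :
  (forall i, bfun (F i)) -> bfun (fun x => \sum_(i <- s) F i x).
Proof.
move=> bF; elim: s => [|i s ih].
  by under eq_fun do rewrite big_nil; exact: bfun_cst.
by under eq_fun do rewrite big_cons; exact: bfunD.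
Qed.

Lemma bfun_indic (A : set T) : measurable A -> bfun \1_A.
Proof.
move=> mA; split; first exact: measurable_indic.
by exists 1 => x; rewrite indicE; case: (_ \in _); rewrite ?normr1 ?normr0.
Qed.

Variable mu : probability T R.

Lemma integrable_bfun f : bfun f -> mu.-integrable setT (EFin \o f).
Proof.
move=> bf; apply: measurable_bounded_integrable => //.
- by rewrite -ge0_fin_numE// fin_num_measure.
- by case: bf.
- exact: bfun_bounded.
Qed.

Lemma integrableM_bfun f g : mu.-integrable setT (EFin \o f) -> bfun g ->
  mu.-integrable setT (EFin \o (fun x => f x * g x)).
Proof.
move=> intf bg; have := integrableMl measurableT intf (proj1 bg) (bfun_bounded _ bg).
by apply: eq_integrable => // x _ /=; rewrite EFinM.
Qed.

Lemma Rintegral_cst1 (c : R) : \int[mu]_x c = c.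
Proof.
rewrite Rintegral_cst//; transitivity (c * 1); last exact: mulr1.
by congr (_ * _); exact: (congr1 fine (probability_setT mu)).
Qed.

Lemma Rintegral_sum I (s : seq I) (F : I -> T -> R) :
  (forall i, mu.-integrable setT (EFin \o F i)) ->
  \int[mu]_x (\sum_(i <- s) F i x) = \sum_(i <- s) \int[mu]_x F i x.
Proof.
move=> iF; elim: s => [|i s ih].
  rewrite big_nil -[RHS](Rintegral_cst1 0); congr (Rintegral _ _ _).
  by apply: funext => x; rewrite big_nil.
rewrite big_cons -ih -RintegralD//; last first.
  have := integrable_sum measurableT s (P := predT) (fun i _ => iF i).
  by apply: eq_integrable => // x _ /=; rewrite sumEFin.
by congr (Rintegral _ _ _); apply: funext => x; rewrite big_cons.
Qed.

Lemma Rintegral_norm_le f (M : R) : measurable_fun setT f ->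
  (forall x, `|f x| <= M) -> `|\int[mu]_x f x| <= M.
Proof.
move=> mf fM; have bf : bfun f by split=> //; exists M.
have bnf : bfun (fun x => `|f x|).
  by split; [exact: measurableT_comp|exists M => x; rewrite normr_id].
rewrite (le_trans (le_normr_Rintegral measurableT (integrable_bfun bf)))//.
rewrite -[leRHS]Rintegral_cst1; apply: le_Rintegral => //.
- exact: integrable_bfun.
- exact/integrable_bfun/bfun_cst.
Qed.

Lemma ae_eq_Rintegral f g : measurable_fun setT f -> measurable_fun setT g ->
  ae_eq mu setT f g -> \int[mu]_x f x = \int[mu]_x g x.
Proof.
move=> mf mg fg; congr fine; apply: ae_eq_integral => //.
- exact/measurable_EFinP.
- exact/measurable_EFinP.
- by move: fg; apply: filterS => x /= h /h ->.
Qed.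

End bounded_functions.

Lemma bfun_comp d d' (T : measurableType d) (S : measurableType d') {R : realType}
    (k : S -> T) (f : T -> R) :
  measurable_fun setT k -> bfun f -> bfun (fun x => f (k x)).
Proof.
move=> mk [mf [M fM]]; split; first exact: measurableT_comp.
by exists M => x; exact: fM.
Qed.

Section fubini_real.
Context d1 d2 (T1 : measurableType d1) (T2 : measurableType d2) {R : realType}.
Variables (m1 : probability T1 R) (m2 : probability T2 R).

Lemma Rintegral_prod12 (F : T1 * T2 -> R) :
  (m1 \x m2)%E.-integrable setT (EFin \o F) ->
  (forall x, m2.-integrable setT (EFin \o (fun y => F (x, y)))) ->
  \int[m1]_x \int[m2]_y F (x, y) = \int[(m1 \x m2)%E]_z F z.
Proof.
move=> iF iFx; rewrite /Rintegral -(integral12_prod_meas1 iF); congr fine.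
apply: eq_integral => x _ /=; rewrite /fubini_F/= fineK//.
exact: integrable_fin_num (iFx x).
Qed.

Lemma Rintegral_prod21 (F : T1 * T2 -> R) :
  (m1 \x m2)%E.-integrable setT (EFin \o F) ->
  (forall y, m1.-integrable setT (EFin \o (fun x => F (x, y)))) ->
  \int[m2]_y \int[m1]_x F (x, y) = \int[(m1 \x m2)%E]_z F z.
Proof.
move=> iF iFy; rewrite /Rintegral -(integral21_prod_meas1 iF); congr fine.
apply: eq_integral => y _ /=; rewrite /fubini_G/= fineK//.
exact: integrable_fin_num (iFy y).
Qed.

Lemma integrable_prodM (u : T1 -> R) (v : T2 -> R) :
  m1.-integrable setT (EFin \o u) -> m2.-integrable setT (EFin \o v) ->
  (m1 \x m2)%E.-integrable setT (EFin \o (fun z => u z.1 * v z.2)).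
Proof.
move=> iu iv.
have mu' : measurable_fun setT u by apply/measurable_EFinP; exact: measurable_int iu.
have mv' : measurable_fun setT v by apply/measurable_EFinP; exact: measurable_int iv.
apply/integrable12ltyP.
  apply/measurable_EFinP; apply: measurable_funM.
    exact: measurableT_comp.
  exact: measurableT_comp.
have -> : (fun x => \int[m2]_y `|(EFin \o (fun z => (u z.1 * v z.2)%R)) (x, y)|)%E =
    (fun x => `|u x|%:E * \int[m2]_y `|(v y)%:E|)%E.
  apply: funext => x /=; rewrite -ge0_integralZl//=.
  - by apply: eq_integral => y _; rewrite normrM EFinM.
  - apply/measurable_EFinP; exact: measurableT_comp.
rewrite ge0_integralZr//=.
- apply: lte_mul_pinfty.
  + by apply: integral_ge0.
  + move/integrableP : iu => [_ iu]; rewrite ge0_fin_numE//; exact: integral_ge0.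
  + by move/integrableP : iv => [_].
- apply/measurable_EFinP; exact: measurableT_comp.
- exact: integral_ge0.
Qed.

End fubini_real.

Section fubini_weighted.
Context d1 d2 (T1 : measurableType d1) (T2 : measurableType d2) {R : realType}.
Variables (m1 : probability T1 R) (m2 : probability T2 R).

Variables (u : T1 -> R) (v : T2 -> R) (f : T1 * T2 -> R).
Hypotheses (iu : m1.-integrable setT (EFin \o u))
  (iv : m2.-integrable setT (EFin \o v)) (bf : bfun f).

Lemma integrable_prodM_bfun :
  (m1 \x m2)%E.-integrable setT (EFin \o (fun z => u z.1 * (v z.2 * f z))).
Proof.
have := integrableMl measurableT (integrable_prodM iu iv) (proj1 bf) (bfun_bounded _ bf).
by apply: eq_integrable => // x _ /=; rewrite -EFinM mulrA.
Qed.

Lemma bfun_section1 x : bfun (fun y => f (x, y)).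
Proof. by apply: (bfun_comp (k := pair x)). Qed.

Lemma bfun_section2 y : bfun (fun x => f (x, y)).
Proof. by apply: (bfun_comp (k := pair^~ y)). Qed.

Lemma Rintegral_weighted12 :
  \int[m1]_x (u x * \int[m2]_y (v y * f (x, y))) =
  \int[(m1 \x m2)%E]_z (u z.1 * (v z.2 * f z)).
Proof.
rewrite -Rintegral_prod12.
- congr Rintegral; apply: funext => x /=; rewrite RintegralZl//.
  apply: integrableM_bfun => //; exact: bfun_section1.
- exact: integrable_prodM_bfun.
- move=> x /=; have h : m2.-integrable setT (EFin \o (fun y => v y * f (x, y))).
    apply: integrableM_bfun => //; exact: bfun_section1.
  by apply: eq_integrable (integrableZl measurableT (u x) h) => //.
Qed.

Lemma Rintegral_weighted21 :
  \int[m2]_y (v y * \int[m1]_x (u x * f (x, y))) =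
  \int[(m1 \x m2)%E]_z (u z.1 * (v z.2 * f z)).
Proof.
have h y : m1.-integrable setT (EFin \o (fun x => u x * f (x, y))).
  apply: integrableM_bfun => //; exact: bfun_section2.
rewrite -Rintegral_prod21.
- congr Rintegral; apply: funext => y /=; rewrite -RintegralZl//.
  by congr Rintegral; apply: funext => x; rewrite mulrCA.
- exact: integrable_prodM_bfun.
- move=> y /=; apply: eq_integrable (integrableZl measurableT (v y) (h y)) => //.
  by move=> x _ /=; rewrite -EFinM mulrCA.
Qed.

Lemma Rintegral_swap :
  \int[m1]_x (u x * \int[m2]_y (v y * f (x, y))) =
  \int[m2]_y (v y * \int[m1]_x (u x * f (x, y))).
Proof. by rewrite Rintegral_weighted12 Rintegral_weighted21. Qed.

(** The bound is M times the integral of |v|. This closure property allows iterated integrals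
    against weights, such as q, that are merely integrable. *)
Lemma bfun_partial_integral : bfun (fun x => \int[m2]_y (v y * f (x, y))).
Proof.
have h x : m2.-integrable setT (EFin \o (fun y => v y * f (x, y))).
  apply: integrableM_bfun => //; exact: bfun_section1.
split.
  have i1 : m1.-integrable setT (EFin \o cst 1) by exact/integrable_bfun/bfun_cst.
  have := integrableMl measurableT (integrable_prodM i1 iv) (proj1 bf) (bfun_bounded _ bf).
  move=> /measurable_fubini_F/(measurableT_comp (fine_measurable measurableT)) => H.
  apply: eq_measurable_fun H => x _ /=.
  rewrite /fubini_F/=; congr fine; apply: eq_integral => y _ /=.
  by rewrite -EFinM mul1r.
case: bf => mf [M fM].
exists (M * \int[m2]_y `|v y|) => x.
rewrite (le_trans (le_normr_Rintegral measurableT (h x)))//.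
have iv' : m2.-integrable setT (EFin \o (fun y => `|v y|)).
  by have := integrable_abse iv.
rewrite -RintegralZl//; apply: le_Rintegral => //.
- by have := integrable_abse (h x).
- by apply: eq_integrable (integrableZl measurableT M iv') => //.
- by move=> y _; rewrite normrM mulrC ler_wpM2r.
Qed.

End fubini_weighted.

Lemma Rintegral_prod_indep d1 d2 (T1 : measurableType d1) (T2 : measurableType d2)
    {R : realType} (m1 : probability T1 R) (m2 : probability T2 R) (f : T1 -> R) (g : T2 -> R) :
  m1.-integrable setT (EFin \o f) -> m2.-integrable setT (EFin \o g) ->
  \int[m1]_x \int[m2]_y (f x * g y) = (\int[m1]_x f x) * \int[m2]_y g y.
Proof.
move=> iff ig; rewrite -RintegralZr//; congr Rintegral; apply: funext => x.
by rewrite RintegralZl.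
Qed.

(** * Uniqueness of measures and the law of four observations *)

Section measure_uniqueness.
Context {R : realType}.

Definition image_measure d1 d2 (T1 : measurableType d1) (T2 : measurableType d2)
    (m : {measure set T1 -> \bar R}) (f : T1 -> T2) (mf : measurable_fun setT f) :
    {measure set T2 -> \bar R} :=
  measure_function_pushforward__canonical__measure_function_Measure m mf.

Lemma rectangle_measure_unique d1 d2 (T1 : measurableType d1) (T2 : measurableType d2)
    (m m' : {measure set (T1 * T2) -> \bar R}) : (m setT < +oo)%E ->
  (forall A B, measurable A -> measurable B -> m (A `*` B) = m' (A `*` B)) ->
  forall X, measurable X -> m X = m' X.
Proof.
move=> moo mm' X mX.
apply: (measure_unique [set A `*` B | A in measurable & B in measurable]
  (fun=> setT)) => //.
- by rewrite measurable_prod_measurableType.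
- move=> _ _ [A mA [B mB <-]] [C mC [D mD <-]]; exists (A `&` C).
    exact: measurableI.
  by exists (B `&` D); [exact: measurableI|rewrite setXI].
- by move=> _; exists setT => //; exists setT => //; rewrite setXTT.
- by rewrite bigcup_const//; exists 0%N.
- by move=> _ [A mA [B mB <-]]; exact: mm'.
Qed.

(** Freezing one side of a rectangle leaves a measure in the other side: restrict to a strip, then
    project. Uniqueness on boxes or quadrants thus reduces to one factor at a time. *)
Lemma section1_measure d1 d2 (T1 : measurableType d1) (T2 : measurableType d2)
    (m : {measure set (T1 * T2) -> \bar R}) (Y : set T2) : measurable Y ->
  exists m1 : {measure set T1 -> \bar R}, forall X, m1 X = m (X `*` Y).
Proof.
move=> mY; have mTY : measurable ([set: T1] `*` Y) by exact: measurableX.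
exists (image_measure (mrestr m mTY) measurable_fst) => X.
rewrite /= /pushforward/= /mrestr; congr (m _).
by apply/seteqP; split => -[x y] /=; tauto.
Qed.

Lemma section2_measure d1 d2 (T1 : measurableType d1) (T2 : measurableType d2)
    (m : {measure set (T1 * T2) -> \bar R}) (X : set T1) : measurable X ->
  exists m2 : {measure set T2 -> \bar R}, forall Y, m2 Y = m (X `*` Y).
Proof.
move=> mX; have mXT : measurable (X `*` [set: T2]) by exact: measurableX.
exists (image_measure (mrestr m mXT) measurable_snd) => Y.
rewrite /= /pushforward/= /mrestr; congr (m _).
by apply/seteqP; split => -[x y] /=; tauto.
Qed.

Lemma rectangle_finite d1 d2 (T1 : measurableType d1) (T2 : measurableType d2)
    (m : {measure set (T1 * T2) -> \bar R}) X Y : (m setT < +oo)%E ->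
  measurable X -> measurable Y -> (m (X `*` Y) < +oo)%E.
Proof.
move=> moo mX mY; apply: le_lt_trans moo; apply: le_measure => //;
  rewrite inE//; exact: measurableX.
Qed.

Lemma box_measure_unique d1 d2 d3 d4 (T1 : measurableType d1) (T2 : measurableType d2)
    (T3 : measurableType d3) (T4 : measurableType d4)
    (m m' : {measure set ((T1 * T2) * (T3 * T4)) -> \bar R}) : (m setT < +oo)%E ->
  (forall A B C D, measurable A -> measurable B -> measurable C -> measurable D ->
     m ((A `*` B) `*` (C `*` D)) = m' ((A `*` B) `*` (C `*` D))) ->
  forall X, measurable X -> m X = m' X.
Proof.
move=> moo mm'; apply: rectangle_measure_unique => // X Y mX mY.
have [m2 m2E] := section2_measure m mX.
have [m2' m2'E] := section2_measure m' mX.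
rewrite -m2E -m2'E; apply: rectangle_measure_unique => //.
  by rewrite m2E; exact: rectangle_finite.
move=> C D mC mD; rewrite m2E m2'E.
have mCD : measurable (C `*` D) by exact: measurableX.
have [m1 m1E] := section1_measure m mCD.
have [m1' m1'E] := section1_measure m' mCD.
rewrite -m1E -m1'E; apply: rectangle_measure_unique => //.
  by rewrite m1E; exact: rectangle_finite.
by move=> A B mA mB; rewrite m1E m1'E; exact: mm'.
Qed.

Lemma ray_measure_unique (m m' : {measure set R -> \bar R}) : (m setT < +oo)%E ->
  (forall x, m `]-oo, x]%classic = m' `]-oo, x]%classic) ->
  forall X, measurable X -> m X = m' X.
Proof.
move=> moo mm' X mX.
(* The library generates the Borel sets by the open right rays, which are the complements of the
   members of [G]. *)
pose G := [set A : set R | exists x, A = `]-oo, x]%classic].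
apply: (measure_unique G (fun n => `]-oo, n%:R]%classic)) => //.
- etransitivity; first exact: RGenOInfty.measurableE.
  rewrite eqEsubset; split => A.
    apply: smallest_sub; first exact: smallest_sigma_algebra.
    move=> _ [x ->]; rewrite -setCitvl; apply: sigma_algebraC.
    by apply: sub_sigma_algebra; exists x.
  apply: smallest_sub; first exact: smallest_sigma_algebra.
  move=> _ [x ->]; rewrite -setCitvr; apply: sigma_algebraC.
  by apply: sub_sigma_algebra; exists x.
- move=> _ _ [x ->] [y ->]; exists (Num.min x y).
  by apply/seteqP; split => z /=; rewrite !in_itv/= le_min => /andP.
- by move=> n; exists n%:R.
- apply/seteqP; split => // x _; exists (Num.bound `|x|) => //=.
  by rewrite in_itv/=; exact: le_trans (ler_norm x) (ltW (archi_boundP (normr_ge0 x))).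
- by move=> _ [x ->]; exact: mm'.
- by move=> n; apply: le_lt_trans moo; apply: le_measure => //; rewrite inE.
Qed.

Lemma quadrant_measure_unique (m m' : {measure set (R * R) -> \bar R}) :
  (m setT < +oo)%E ->
  (forall x y, m (`]-oo, x] `*` `]-oo, y]) = m' (`]-oo, x] `*` `]-oo, y])) ->
  forall X, measurable X -> m X = m' X.
Proof.
move=> moo mm'; apply: rectangle_measure_unique => // X Y mX mY.
have [m2 m2E] := section2_measure m mX.
have [m2' m2'E] := section2_measure m' mX.
rewrite -m2E -m2'E; apply: ray_measure_unique => //.
  by rewrite m2E; exact: rectangle_finite.
move=> y; rewrite m2E m2'E.
have mY' : measurable (`]-oo, y] : set R) by [].
have [m1 m1E] := section1_measure m mY'.
have [m1' m1'E] := section1_measure m' mY'.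
rewrite -m1E -m1'E; apply: ray_measure_unique => //.
  by rewrite m1E; exact: rectangle_finite.
by move=> x; rewrite m1E m1'E; exact: mm'.
Qed.

End measure_uniqueness.

Section product_probability.
Context d1 d2 (T1 : measurableType d1) (T2 : measurableType d2) {R : realType}.
Variables (m1 : probability T1 R) (m2 : probability T2 R).

Definition prod_prob : set (T1 * T2) -> \bar R := (m1 \x m2)%E.

HB.instance Definition _ := Measure.on prod_prob.

Let prod_prob_setT : prod_prob setT = 1%E.
Proof.
rewrite -setXTT /prod_prob product_measure1E//.
rewrite -[1%E]mule1; congr (_ * _)%E; exact: probability_setT.
Qed.

HB.instance Definition _ := Measure_isProbability.Build _ _ _ prod_prob prod_prob_setT.

Definition prodP : probability (T1 * T2)%type R := prod_prob.

Lemma prodPE A B : measurable A -> measurable B ->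
  prodP (A `*` B) = (m1 A * m2 B)%E.
Proof. by move=> mA mB; exact: product_measure1E. Qed.

End product_probability.

Lemma Rintegral_image d1 d2 (T1 : measurableType d1) (T2 : measurableType d2) {R : realType}
    (mu : probability T1 R) (nu : probability T2 R) (phi : T1 -> T2) (f : T2 -> R) :
  measurable_fun setT phi -> (forall A, measurable A -> mu (phi @^-1` A) = nu A) ->
  bfun f -> \int[mu]_x f (phi x) = \int[nu]_y f y.
Proof.
move=> mphi munu bf; congr fine.
have /= := integral_pushforward mphi (mu := mu) (D := setT) (f := EFin \o f).
rewrite preimage_setT => <- //.
- by apply: eq_measure_integral => A mA _; exact: munu.
- by apply/measurable_EFinP; case: bf.
- exact: integrable_bfun (bfun_comp mphi bf).
Qed.

Section joint_law.
Context {R : realType} d (Omega : measurableType d) (Pr : probability Omega R).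
Variables (Z : nat -> Omega -> R * R) (P : probability (R * R)%type R).
Hypotheses (mZ : forall i, measurable_fun setT (Z i))
  (indep : mutually_independent Pr Z)
  (law : forall i A, measurable A -> Pr (Z i @^-1` A) = P A).

(** Nested pairs match the iterated binary product measure [law4], which a function on ['I_4] would
    not. *)
Definition quad (i : 'I_4 -> nat) (w : Omega) : ((R * R) * (R * R)) * ((R * R) * (R * R)) :=
  ((Z (i (inord 0)) w, Z (i (inord 1)) w), (Z (i (inord 2)) w, Z (i (inord 3)) w)).

Lemma measurable_quad i : measurable_fun setT (quad i).
Proof. by apply/measurable_fun_pairP; split; apply/measurable_fun_pairP; split; exact: mZ. Qed.

Lemma ord4P (i : 'I_4) : [\/ i = inord 0, i = inord 1, i = inord 2 | i = inord 3].
Proof.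
by case: i => -[|[|[|[|//]]]] ?; [apply: Or41|apply: Or42|apply: Or43|apply: Or44];
  apply: val_inj; rewrite /= inordK.
Qed.

Lemma independent_family (I : finType) (i : I -> nat) (A : I -> set (R * R)) :
  injective i -> (forall k, measurable (A k)) ->
  Pr (\bigcap_(k in setT) Z (i k) @^-1` A k) = (\prod_k P (A k))%E.
Proof.
move=> inj_i mA.
pose J := [fset i k | k in I]%fset.
(* Independence is stated for sets indexed by observation numbers; [B] carries [A] along the
   injection, with [setT] as default off its image. *)
pose B j := if [pick k | i k == j] is Some k then A k else setT.
have BE k : B (i k) = A k.
  rewrite /B; case: pickP => [k' /eqP/inj_i -> //|/(_ k)].
  by rewrite eqxx.
have mB j : measurable (B j) by rewrite /B; case: pickP.
have -> : \bigcap_(k in setT) Z (i k) @^-1` A k = \bigcap_(j in [set` J]) Z j @^-1` B j.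
  apply/seteqP; split => w /= H.
    move=> j /= /imfsetP[k _ ->] /=; rewrite BE; exact: H.
  by move=> k _; have := H (i k); rewrite /= BE; apply; apply/imfsetP; exists k.
rewrite indep// big_imfset/=; last by move=> k k' _ _; exact: inj_i.
rewrite -big_enum/=; under eq_bigr do rewrite law// BE.
by rewrite big_enum.
Qed.

Definition law4 : probability (((R * R) * (R * R)) * ((R * R) * (R * R)))%type R := prodP (prodP P P) (prodP P P).

Lemma law4_box A B C D : measurable A -> measurable B -> measurable C -> measurable D ->
  law4 ((A `*` B) `*` (C `*` D)) = (P A * P B * (P C * P D))%E.
Proof.
move=> mA mB mC mD; rewrite /law4 prodPE; try exact: measurableX.
by rewrite !prodPE.
Qed.

Let fam (A B C D : set (R * R)) (k : 'I_4) := tnth [tuple A; B; C; D] k.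

Let preimage_quad i A B C D : quad i @^-1` ((A `*` B) `*` (C `*` D)) =
  \bigcap_(k in setT) Z (i k) @^-1` fam A B C D k.
Proof.
apply/seteqP; split => w /=.
  move=> [[? ?] [? ?]] k _.
  by case: (ord4P k) => ->; rewrite /fam (tnth_nth set0) /= inordK.
by move=> H; split; split; have := H (inord _) I; rewrite /fam;
  move=> /(_ _); [move=> /(_ 0%N)|move=> /(_ 1%N)|move=> /(_ 2%N)|move=> /(_ 3%N)];
  rewrite (tnth_nth set0)/= inordK.
Qed.

Let measurable_fam A B C D k : measurable A -> measurable B -> measurable C ->
  measurable D -> measurable (fam A B C D k).
Proof.
move=> mA mB mC mD; rewrite /fam (tnth_nth set0).
by case: (ord4P k) => ->; rewrite inordK.
Qed.

Let prod_fam A B C D : (\prod_k P (fam A B C D k) = P A * P B * (P C * P D))%E.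
Proof.
rewrite !big_ord_recl big_ord0 mule1 !muleA /fam.
by rewrite !(tnth_nth set0).
Qed.

(** Injectivity on the disjoint sum says that all eight indices are distinct; then the two
    quadruples are independent copies. *)
Lemma quad_pair_law (i i' : 'I_4 -> nat) :
  injective (fun k : 'I_4 + 'I_4 => match k with inl a => i a | inr b => i' b end) ->
  forall X, measurable X ->
    Pr ((fun w => (quad i w, quad i' w)) @^-1` X) = prodP law4 law4 X.
Proof.
move=> inj.
have mq : measurable_fun setT (fun w => (quad i w, quad i' w)).
  by apply/measurable_fun_pairP; split; exact: measurable_quad.
pose M := image_measure Pr mq.
suff H X : measurable X -> M X = prodP law4 law4 X by [].
apply: rectangle_measure_unique => {X}.
  by rewrite /M/= /pushforward preimage_setT (le_lt_trans (probability_le1 _ _))// ltry.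
move=> X Y mX mY.
have [m2 m2E] := section2_measure M mX.
have [m2' m2'E] := section2_measure (prodP law4 law4) mX.
have Moo : (M setT < +oo)%E.
  by rewrite /M/= /pushforward preimage_setT (le_lt_trans (probability_le1 _ _))// ltry.
rewrite -m2E -m2'E; apply: box_measure_unique => //.
  by rewrite m2E; exact: rectangle_finite.
move=> A B C D mA mB mC mD; rewrite m2E m2'E.
have mY' : measurable ((A `*` B) `*` (C `*` D)).
  by apply: measurableX; exact: measurableX.
have [m1 m1E] := section1_measure M mY'.
have [m1' m1'E] := section1_measure (prodP law4 law4) mY'.
rewrite -m1E -m1'E; apply: box_measure_unique => //.
  by rewrite m1E; exact: rectangle_finite.
move=> A' B' C' D' mA' mB' mC' mD'; rewrite m1E m1'E.
rewrite [RHS]prodPE//; last by apply: measurableX; exact: measurableX.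
rewrite !law4_box// -!prod_fam.
transitivity (\prod_(k : 'I_4 + 'I_4) P (match k with inl a => fam A' B' C' D' a
    | inr b => fam A B C D b end))%E; last by rewrite big_sumType.
rewrite -(independent_family inj); last by case=> k; exact: measurable_fam.
rewrite /M/= /pushforward; congr (Pr _).
rewrite (_ : _ @^-1` _ = quad i @^-1` ((A' `*` B') `*` (C' `*` D')) `&`
   quad i' @^-1` ((A `*` B) `*` (C `*` D)))//.
rewrite !preimage_quad; apply/seteqP; split => w /=.
  by move=> [H H'] [] k _; [exact: H|exact: H'].
by move=> H; split => k _; [exact: (H (inl k))|exact: (H (inr k))].
Qed.

Lemma quad_law (i : 'I_4 -> nat) : injective i ->
  forall X, measurable X -> Pr (quad i @^-1` X) = law4 X.
Proof.
move=> inj X mX.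
pose M := image_measure Pr (measurable_quad i).
suff H Y : measurable Y -> M Y = law4 Y by exact: H.
apply: box_measure_unique => {Y}.
  by rewrite /M/= /pushforward preimage_setT (le_lt_trans (probability_le1 _ _))// ltry.
move=> A B C D mA mB mC mD; rewrite [RHS]law4_box// -prod_fam.
rewrite -(independent_family inj); last by move=> k; exact: measurable_fam.
by rewrite /M/= /pushforward preimage_quad.
Qed.

Lemma Rintegral_quad (i : 'I_4 -> nat) (F : _ -> R) : injective i -> bfun F ->
  \int[Pr]_w F (quad i w) = \int[law4]_z F z.
Proof.
by move=> inj bF; apply: Rintegral_image => //; [exact: measurable_quad|exact: quad_law].
Qed.

Lemma Rintegral_quad_pair (i i' : 'I_4 -> nat) (F : _ -> R) :
  injective (fun k : 'I_4 + 'I_4 => match k with inl a => i a | inr b => i' b end) ->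
  bfun F ->
  \int[Pr]_w (F (quad i w) * F (quad i' w)) = (\int[law4]_z F z) ^+ 2.
Proof.
move=> inj bF.
pose G (z : _ * _) := F z.1 * F z.2.
have bG : bfun G by apply: bfunM; apply: bfun_comp.
have /= -> := @Rintegral_image _ _ _ _ _ Pr (prodP law4 law4)
  (fun w => (quad i w, quad i' w)) G _ (quad_pair_law inj) bG; last first.
  by apply/measurable_fun_pairP; split; exact: measurable_quad.
rewrite -(@Rintegral_prod12 _ _ _ _ _ law4 law4 G).
- by rewrite /G/= (@Rintegral_prod_indep _ _ _ _ _ law4 law4 F F)//; exact: integrable_bfun.
- exact: integrable_bfun.
- move=> z; apply: integrable_bfun; exact: (bfun_section1 bG).
Qed.

End joint_law.

(** * Permutations of a sample and pattern sums *)

Section ranks.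
Context {R : realType}.

Lemma rank_eq n (x x' : 'I_n -> R) :
  (forall i j, (x i <= x j) = (x' i <= x' j)) -> rank x =1 rank x'.
Proof.
move=> xx' i; apply: val_inj => /=; congr (_.-1); apply: eq_card => j.
by rewrite !inE xx'.
Qed.

Lemma rankS n (x : 'I_n -> R) i : (rank x i).+1 = #|[pred j | x j <= x i]|.
Proof.
rewrite /= prednK//; apply/card_gt0P; exists i; by rewrite inE.
Qed.

Lemma rank_lt n (x : 'I_n -> R) i j : ((rank x i : nat) < rank x j)%N = (x i < x j).
Proof.
rewrite -ltnS rankS -[X in (_ < X)%N]/((rank x j).+1) rankS.
case: (ltP (x i) (x j)) => xij.
  apply: proper_card; apply/properP; split.
    by apply/fintype.subsetP => k; rewrite !inE => /le_trans; apply; exact: ltW.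
  by exists j; rewrite !inE// -ltNge.
apply/negbTE; rewrite -leqNgt; apply: subset_leq_card.
by apply/fintype.subsetP => k; rewrite !inE => /le_trans; apply.
Qed.

Lemma rank_inj n (x : 'I_n -> R) : injective x -> injective (rank x).
Proof.
move=> inj i j rij; apply: inj; apply: le_anti.
by rewrite !leNgt -!rank_lt rij ltnn.
Qed.

Lemma rank_permP n (x : 'I_n -> R) : injective x ->
  exists2 Q : 'S_n, rank_perm x = Some Q &
    forall i j, ((Q i : nat) < Q j)%N = (x i < x j).
Proof.
move=> inj; rewrite /rank_perm.
have rinj : injectiveb [ffun i => rank x i].
  by apply/injectiveP => i j; rewrite !ffunE; exact: rank_inj.
exists (Perm rinj).
  by rewrite insubT.
by move=> i j; rewrite !unlock /= !ffunE rank_lt.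
Qed.

Lemma rank_permN n (x : 'I_n -> R) : ~ injective x -> rank_perm x = None.
Proof.
move=> ninj; rewrite /rank_perm insubF//; apply/negP => /injectiveP rinj.
apply: ninj => i j xij; apply: rinj; rewrite !ffunE; apply: val_inj => /=.
by congr (_.-1); apply: eq_card => k; rewrite !inE xij.
Qed.

(** The value of a permutation at i is the number of j placed below i, so the order determines
    it. *)
Lemma perm_order_eq n (s t : 'S_n) :
  (forall i j, ((s i : nat) < s j)%N = (t i < t j)%N) -> s = t.
Proof.
have cnt (u : 'S_n) i : #|[set j | (u j < u i)%N]%SET| = u i.
  rewrite -(card_imset _ (@perm_inj _ u)).
  rewrite (_ : (u @: _)%SET = [set k : 'I_n | (k < u i)%N]%SET); last first.
    apply/finset.setP => k; rewrite inE; apply/imsetP/idP => [[j]|ku]; first by rewrite inE => ju ->.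
    by exists ((u^-1)%g k); rewrite ?inE permKV.
  have winj : injective (widen_ord (ltnW (ltn_ord (u i)))).
    by move=> a b /(congr1 val) /= /val_inj.
  rewrite -[RHS]card_ord -(card_imset predT winj).
  apply: eq_card => k; rewrite inE; apply/idP/imsetP => [ku|[j _ ->]].
    by exists (Ordinal ku) => //; apply: val_inj.
  by rewrite /= ltn_ord.
move=> st; apply/permP => i; apply: val_inj.
transitivity #|[set j | (s j < s i)%N]%SET|; first by rewrite cnt.
transitivity #|[set j | (t j < t i)%N]%SET|; last exact: cnt.
by congr #|pred_of_set _|; apply/finset.setP => j; rewrite !finset.inE st.
Qed.

Lemma sample_permP n (z : 'I_n -> R * R) :
  injective (fun i => (z i).1) -> injective (fun i => (z i).2) ->
  exists Q V : 'S_n, [/\ sample_perm z = Some (Q^-1 * V)%g,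
    forall i j, ((Q i : nat) < Q j)%N = ((z i).1 < (z j).1) &
    forall i j, ((V i : nat) < V j)%N = ((z i).2 < (z j).2)].
Proof.
move=> /rank_permP[Q Qe Ql] /rank_permP[V Ve Vl]; exists Q, V; split => //.
by rewrite /sample_perm Qe Ve.
Qed.

Definition no_ties n (z : 'I_n -> R * R) :=
  injective (fun i => (z i).1) /\ injective (fun i => (z i).2).

Lemma sample_permN n (z : 'I_n -> R * R) : ~ no_ties z -> sample_perm z = None.
Proof.
move=> nz; rewrite /sample_perm.
have [i1|/rank_permN -> //] := pselect (injective (fun i => (z i).1)).
have [i2|/rank_permN -> //] := pselect (injective (fun i => (z i).2)).
  by exfalso; apply: nz.
by case: rank_perm.
Qed.

(** Dependence on the sample through comparisons only is what yields measurability later. *)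
Lemma sample_perm_eq n (z z' : 'I_n -> R * R) :
  (forall i j, ((z i).1 <= (z j).1) = ((z' i).1 <= (z' j).1)) ->
  (forall i j, ((z i).2 <= (z j).2) = ((z' i).2 <= (z' j).2)) ->
  sample_perm z = sample_perm z'.
Proof.
move=> h1 h2; rewrite /sample_perm /rank_perm.
have -> : [ffun i => rank (fun i => (z i).1) i] = [ffun i => rank (fun i => (z' i).1) i].
  by apply/ffunP => i; rewrite !ffunE; exact: rank_eq.
have -> // : [ffun i => rank (fun i => (z i).2) i] = [ffun i => rank (fun i => (z' i).2) i].
by apply/ffunP => i; rewrite !ffunE; exact: rank_eq.
Qed.

Lemma T_stat_eq (A : stat) n (z z' : 'I_n -> R * R) :
  sample_perm z = sample_perm z' -> T_stat A z = T_stat A z'.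
Proof.
by move=> zz'; rewrite /T_stat /excess /deficit /sample_pattern_sum zz'.
Qed.

(** Relabelling by t replaces Q and V by tQ and tV, and t cancels in the quotient. *)
Lemma sample_perm_permute n (z : 'I_n -> R * R) (t : 'S_n) :
  sample_perm (fun i => z (t i)) = sample_perm z.
Proof.
have [[i1 i2]|nt] := pselect (no_ties z); last first.
  rewrite !sample_permN// => -[i1 i2]; apply: nt; split.
    move=> i j ij; rewrite -(permKV t i) -(permKV t j); congr (t _); apply: i1.
    by rewrite !permKV.
  move=> i j ij; rewrite -(permKV t i) -(permKV t j); congr (t _); apply: i2.
  by rewrite !permKV.
have [Q [V [-> Ql Vl]]] := sample_permP i1 i2.
have i1' : injective (fun i => (z (t i)).1) by move=> i j /i1/perm_inj.
have i2' : injective (fun i => (z (t i)).2) by move=> i j /i2/perm_inj.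
have [Q' [V' [-> Ql' Vl']]] := sample_permP i1' i2'.
have -> : Q' = (t * Q)%g by apply: perm_order_eq => i j; rewrite Ql' !permM Ql.
have -> : V' = (t * V)%g by apply: perm_order_eq => i j; rewrite Vl' !permM Vl.
by rewrite invMg mulgA -(mulgA _ _ t) mulVg mulg1.
Qed.

(** The identity is the only increasing self-map of four points. *)
Lemma occurrence_id (s p : 'S_4) (m : {ffun 'I_4 -> 'I_4}) :
  occurrence s p m = (m == [ffun i => i]) && (p == s).
Proof.
apply/idP/andP => [/forallP H|[/eqP -> /eqP ->]]; last first.
  apply/forallP => i; apply/forallP => j; apply/implyP => ij.
  by rewrite !ffunE ij eqxx.
have mincr (i j : 'I_4) : (i < j)%N -> (m i < m j)%N.
  by move=> ij; have /forallP/(_ j)/implyP/(_ ij)/andP[] := H i.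
have mE : m = [ffun i => i].
  have minj : injective m.
    move=> i j mij; apply: val_inj; case: (ltngtP (val i) (val j)) => // /mincr.
      by rewrite mij ltnn.
    by rewrite mij ltnn.
  suff -> : m = [ffun i => (1%g : 'S_4) i].
    by apply/ffunP => i; rewrite !ffunE perm1.
  have -> : (1%g : 'S_4) = perm minj.
    apply: perm_order_eq => i j; rewrite !perm1 !permE.
    case: (ltngtP (val i) (val j)) => [/mincr -> //|ji|/val_inj ->].
      by apply/esym/negbTE; rewrite -leqNgt ltnW// mincr.
    by rewrite ltnn.
  by apply/ffunP => i; rewrite ffunE permE.
split; first by rewrite mE.
apply/eqP; apply: perm_order_eq => i j.
have h (a b : 'I_4) : (a < b)%N -> ((p a : nat) < p b)%N = (s a < s b)%N.
  move=> ab; have /forallP/(_ b)/implyP/(_ ab)/andP[_ /eqP] := H a.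
  by rewrite mE !ffunE.
case: (ltngtP (val i) (val j)) => [/h //|ji|/val_inj ->]; last by rewrite !ltnn.
have ij : i != j by apply: contraTneq ji => ->; rewrite ltnn.
have flip (u : 'S_4) : ((u i : nat) < u j)%N = ~~ (u j < u i)%N.
  rewrite -leqNgt ltn_neqAle; case: eqP => //= /val_inj/perm_inj ij'.
  by rewrite ij' eqxx in ij.
by rewrite !flip h.
Qed.

Lemma pattern_sum4 (A : {set 'S_4}) (p : 'S_4) : pattern_sum A p = (p \in A)%:R :> R.
Proof.
rewrite /pattern_sum /pattern_density binn.
have H (s : 'S_4) : #|[pred m : {ffun 'I_4 -> 'I_4} | occurrence s p m]| = (p == s).
  rewrite (eq_card (B := [pred m | (m == [ffun i => i]) && (p == s)])); last first.
    by move=> m; rewrite !inE occurrence_id.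
  case: (p == s).
    by rewrite -[RHS](card1 [ffun i : 'I_4 => i]); apply: eq_card => m; rewrite !inE ?andbT.
  by apply: eq_card0 => m; rewrite !inE ?andbF.
under eq_bigr do rewrite H divr1.
case: (boolP (p \in A)) => pA.
  rewrite (bigD1 p)//= eqxx big1 ?addr0// => s /andP[_].
  by rewrite eq_sym => /negbTE ->.
rewrite big1// => s sA; case: eqP => // ps.
by rewrite ps sA in pA.
Qed.

Lemma sample_pattern_sum4 (A : {set 'S_4}) (z : 'I_4 -> R * R) :
  sample_pattern_sum A z = oapp (fun p => (p \in A)%:R) 0 (sample_perm z).
Proof.
by rewrite /sample_pattern_sum; case: sample_perm => //= p; exact: pattern_sum4.
Qed.

Lemma ord_incr_inj k n (m : 'I_k -> 'I_n) :
  (forall i j : 'I_k, (i < j)%N -> (m i < m j)%N) -> injective m.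
Proof.
move=> mincr i j mij; apply: val_inj; case: (ltngtP (val i) (val j)) => // /mincr.
  by rewrite mij ltnn.
by rewrite mij ltnn.
Qed.

Definition increasing_tuple k n (m : {ffun 'I_k -> 'I_n}) : bool :=
  [forall i : 'I_k, forall j : 'I_k, (i < j)%N ==> (m i < m j)%N].

Lemma increasing_tupleP k n (m : {ffun 'I_k -> 'I_n}) :
  reflect (forall i j : 'I_k, (i < j)%N -> (m i < m j)%N) (increasing_tuple m).
Proof.
apply: (iffP forallP) => [H i j ij|H i].
  by have /forallP/(_ j)/implyP/(_ ij) := H i.
by apply/forallP => j; apply/implyP; exact: H.
Qed.

(** Once the points are sorted by their first coordinate through Q^-1, an increasing tuple selects a
    subsample whose x-ranks form the identity, so its permutation is read off from the y-ranks
    alone. *)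
Lemma occurrence_sorted n (z : 'I_n -> R * R) (Q V : 'S_n)
    (m : {ffun 'I_4 -> 'I_n}) (s : 'S_4) :
  no_ties z ->
  (forall i j, ((Q i : nat) < Q j)%N = ((z i).1 < (z j).1)) ->
  (forall i j, ((V i : nat) < V j)%N = ((z i).2 < (z j).2)) ->
  occurrence s (Q^-1 * V)%g m =
  increasing_tuple m && (sample_perm (fun k => z ((Q^-1)%g (m k))) == Some s).
Proof.
move=> [i1 i2] Ql Vl.
have [/increasing_tupleP mi|mi] := boolP (increasing_tuple m); last first.
  apply/negbTE; apply: contra mi => /forallP H; apply/increasing_tupleP => i j ij.
  by have /forallP/(_ j)/implyP/(_ ij)/andP[] := H i.
have minj := ord_incr_inj mi.
have i1' : injective (fun k => (z ((Q^-1)%g (m k))).1) by move=> i j /i1/perm_inj/minj.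
have i2' : injective (fun k => (z ((Q^-1)%g (m k))).2) by move=> i j /i2/perm_inj/minj.
have [Q' [V' [-> Ql' Vl']]] := sample_permP i1' i2'.
have mlt (i j : 'I_4) : (m i < m j)%N = (i < j)%N.
  apply/idP/idP => [|/mi //]; apply: contraTT; rewrite -!leqNgt leq_eqVlt.
  by move=> /predU1P[/val_inj ->//|/mi/ltnW].
have -> : Q' = 1%g.
  by apply: perm_order_eq => i j; rewrite Ql' -Ql !permKV !perm1 mlt.
rewrite invg1 mul1g /=.
apply/idP/eqP => [/forallP H|[] <-]; last first.
  apply/forallP => i; apply/forallP => j; apply/implyP => ij.
  by rewrite mi//= Vl' !permM Vl.
have h (i j : 'I_4) : (i < j)%N -> ((V' i : nat) < V' j)%N = (s i < s j)%N.
  move=> ij; have /forallP/(_ j)/implyP/(_ ij)/andP[_ /eqP <-] := H i.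
  by rewrite Vl' !permM Vl.
congr Some; apply: perm_order_eq => i j.
case: (ltngtP (val i) (val j)) => [/h //|ji|/val_inj ->]; last by rewrite !ltnn.
have ij : i != j by apply: contraTneq ji => ->; rewrite ltnn.
have flip (u : 'S_4) : ((u i : nat) < u j)%N = ~~ (u j < u i)%N.
  rewrite -leqNgt ltn_neqAle; case: eqP => //= /val_inj/perm_inj ij'.
  by rewrite ij' eqxx in ij.
by rewrite !flip h.
Qed.

(** Every injective tuple has exactly one increasing rearrangement, and there are 24
    rearrangements. *)
Lemma sum_injective_increasing n (f : {ffun 'I_4 -> 'I_n} -> R) :
  (forall (m : {ffun 'I_4 -> 'I_n}) (t : 'S_4), f [ffun k => m (t k)] = f m) ->
  \sum_(m : {ffun 'I_4 -> 'I_n} | injectiveb m) f m =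
  24%:R * \sum_(m : {ffun 'I_4 -> 'I_n} | increasing_tuple m) f m.
Proof.
move=> fsym.
have H (m : {ffun 'I_4 -> 'I_n}) : injectiveb m ->
    f m = \sum_(t : 'S_4 | increasing_tuple [ffun k => m (t k)]) f [ffun k => m (t k)].
  move=> /injectiveP minj.
  (* The sorting permutation is the inverse of the rank permutation of the indices, viewed as real
     numbers. *)
  have [Q Qe Ql] := @rank_permP 4 (fun k => (m k)%:R) (fun i j ij => minj _ _ (val_inj (mulrIn (oner_neq0 R) ij))).
  rewrite (big_pred1 (Q^-1)%g) ?fsym// => t /=.
  apply/increasing_tupleP/eqP => [H|->].
    have {}H (i j : 'I_4) : ((i : nat) < j)%N = ((m (t i) : nat) < m (t j))%N.
      apply/idP/idP => [ij|]; first by have := H i j ij; rewrite !ffunE.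
      apply: contraTT; rewrite -!leqNgt leq_eqVlt => /predU1P[/val_inj ->//|ji].
      by have := H j i ji; rewrite !ffunE => /ltnW.
    suff : (t * Q = 1)%g by move=> /(canRL (mulgK _)) ->; rewrite mul1g.
    by apply: perm_order_eq => i j; rewrite !permM !perm1 Ql ltr_nat -H.
  by move=> i j ij; rewrite !ffunE -(@ltr_nat R) -Ql !permKV.
rewrite (eq_bigr _ H) (exchange_big_dep predT)//=.
have K (t : 'S_4) : \sum_(m : {ffun 'I_4 -> 'I_n} | injectiveb m &&
     increasing_tuple [ffun k => m (t k)]) f [ffun k => m (t k)] =
   \sum_(m : {ffun 'I_4 -> 'I_n} | increasing_tuple m) f m.
  rewrite [RHS](reindex (fun m : {ffun 'I_4 -> 'I_n} => [ffun k => m (t k)])) /=; last first.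
    exists (fun m : {ffun 'I_4 -> 'I_n} => [ffun k => m ((t^-1)%g k)]) => m _.
      by apply/ffunP => k; rewrite !ffunE permKV.
    by apply/ffunP => k; rewrite !ffunE permK.
  apply: eq_bigl => m; rewrite andb_idl// => /increasing_tupleP/ord_incr_inj mi.
  apply/injectiveP => i j mij; rewrite -(permKV t i) -(permKV t j); congr (t _).
  by apply: mi; rewrite !ffunE !permKV.
under eq_bigr do rewrite K.
by rewrite sumr_const card_Sn mulr_natl.
Qed.

(** This is the U-statistic property, in the form of a sum over ordered tuples of distinct indices;
    it gives both the bounds on the statistics and their comparison with [V_n]. *)
Lemma sum_injective_pattern_sum (W : {set 'S_4}) n (z : 'I_n -> R * R) : (4 <= n)%N -> no_ties z ->
  \sum_(m : {ffun 'I_4 -> 'I_n} | injectiveb m) sample_pattern_sum W (fun k => z (m k)) =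
  (n ^_ 4)%:R * sample_pattern_sum W z.
Proof.
move=> n4 nt; have [i1 i2] := nt.
have [Q [V [zQV Ql Vl]]] := sample_permP i1 i2.
pose f (m : {ffun 'I_4 -> 'I_n}) := sample_pattern_sum W (fun k => z ((Q^-1)%g (m k))).
have fsym (m : {ffun 'I_4 -> 'I_n}) (t : 'S_4) : f [ffun k => m (t k)] = f m.
  rewrite /f /sample_pattern_sum -(sample_perm_permute (fun k => z ((Q^-1)%g (m k))) t).
  by congr (oapp _ _ (sample_perm _)); apply: funext => k; rewrite ffunE.
rewrite (reindex (fun m : {ffun 'I_4 -> 'I_n} => [ffun k => (Q^-1)%g (m k)])) /=; last first.
  exists (fun m : {ffun 'I_4 -> 'I_n} => [ffun k => Q (m k)]) => m _.
    by apply/ffunP => k; rewrite !ffunE permKV.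
  by apply/ffunP => k; rewrite !ffunE permK.
transitivity (\sum_(m : {ffun 'I_4 -> 'I_n} | injectiveb m) f m).
  apply: eq_big => [m|m _].
    apply/injectiveP/injectiveP => mi i j.
      by move=> mij; apply: mi; rewrite !ffunE mij.
    by rewrite !ffunE => /perm_inj/mi.
  by rewrite /f; congr sample_pattern_sum; apply: funext => k; rewrite ffunE.
rewrite sum_injective_increasing//.
have fE (m : {ffun 'I_4 -> 'I_n}) : increasing_tuple m ->
    f m = \sum_(s in W) (occurrence s (Q^-1 * V)%g m)%:R.
  move=> mi; rewrite /f sample_pattern_sum4.
  under eq_bigr => s _ do rewrite (occurrence_sorted m s nt Ql Vl) mi/=.
  case: sample_perm => [p|]/=; last by rewrite big1.
  case: (boolP (p \in W)) => pW.
    rewrite (bigD1 p)//= eqxx big1 ?addr0// => s /andP[_].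
    by rewrite eq_sym => /negbTE sp; rewrite (_ : Some p == Some s = (p == s))// sp.
  rewrite big1// => s sW; rewrite (_ : Some p == Some s = (p == s))//.
  by case: eqP => // ps; rewrite ps sW in pW.
rewrite (eq_bigr _ fE) exchange_big/= /sample_pattern_sum zQV/= /pattern_sum /pattern_density.
have c0 : ('C(n, 4))%:R != 0 :> R by rewrite pnatr_eq0 -lt0n bin_gt0.
rewrite -mulr_suml -bin_ffact natrM mulrC [X in _ = X]mulrC -!mulrA.
rewrite [X in _ = _ * X]mulrA mulVf// mul1r; congr (_ * _).
apply: eq_bigr => s _; rewrite -sum1_card natr_sum/= big_mkcond [RHS]big_mkcond/=.
apply: eq_bigr => m _; rewrite (occurrence_sorted m s nt Ql Vl) inE
  (occurrence_sorted m s nt Ql Vl).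
by case: increasing_tuple => //=; case: (_ == _).
Qed.


(** The right-hand side involves only the two lists of values, so membership in a pattern set
    becomes a question that can be computed on lists. *)
Lemma one_line_quotient (Q V : 'S_4) : one_line (Q^-1 * V)%g =
  [seq (nth 0%N [seq val (V i) | i <- enum 'I_4] (index j [seq val (Q i) | i <- enum 'I_4])).+1
     | j <- iota 0 4].
Proof.
rewrite /one_line -[in RHS]val_enum_ord -[RHS]map_comp; apply: eq_map => j /=; congr _.+1.
have -> : index (val j) [seq val (Q i) | i <- enum 'I_4] = (Q^-1)%g j.
  rewrite -{1}(permKV Q j) (map_comp val) index_map; last exact: val_inj.
  rewrite index_map; last exact: perm_inj.
  by rewrite index_enum_ord.
rewrite (nth_map ord0) ?size_enum_ord// nth_ord_enum permM.
by [].
Qed.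

Lemma one_line_inj n : injective (@one_line n).
Proof.
move=> s t st; apply: perm_order_eq => i j.
have h k : s k = t k :> nat.
  have := congr1 (fun l => nth 0%N l k) st.
  rewrite /one_line (nth_map k) ?size_enum_ord// (nth_map k) ?size_enum_ord//.
  by rewrite nth_ord_enum => -[].
by rewrite !h.
Qed.

Definition pattern_words_ok (w : seq (seq nat)) : bool :=
  uniq w && all (fun l => [&& size l == 4%N, uniq l & all (fun x => 0 < x <= 4)%N l]) w.

Lemma card_patterns w : pattern_words_ok w -> #|patterns w| = size w.
Proof.
case/andP => uw /allP wok.
have H l : l \in w -> exists s : 'S_4, one_line s = l.
  move=> /wok/and3P[/eqP sl ul /allP al].
  have lt4 (i : 'I_4) : ((nth 0 l i).-1 < 4)%N.
    have /al/andP[l0 l4] : nth 0%N l i \in l by rewrite mem_nth// sl.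
    by rewrite -ltnS prednK.
  have finj : injective (fun i => Ordinal (lt4 i)).
    move=> i j /(congr1 val) /= ij; apply: val_inj; apply/eqP.
    rewrite -(nth_uniq 0%N _ _ ul) ?sl ?ltn_ord//; apply/eqP.
    have /al/andP[i0 _] : nth 0%N l i \in l by rewrite mem_nth// sl.
    have /al/andP[j0 _] : nth 0%N l j \in l by rewrite mem_nth// sl.
    by rewrite -(prednK i0) -(prednK j0) ij.
  exists (perm finj); apply: (@eq_from_nth _ 0%N).
    by rewrite size_map size_enum_ord sl.
  move=> k; rewrite size_map size_enum_ord => k4.
  rewrite /one_line (nth_map ord0) ?size_enum_ord// permE/= nth_enum_ord// prednK//.
  by have /al/andP[] : nth 0%N l k \in l by rewrite mem_nth// sl.
rewrite cardE -(size_map (@one_line 4)); apply/perm_size/uniq_perm => //.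
  by rewrite map_inj_uniq ?enum_uniq//; exact: one_line_inj.
move=> l; apply/mapP/idP => [[s]|lw].
  by rewrite mem_enum inE => sw ->.
by have [s sl] := H l lw; exists s => //; rewrite mem_enum inE sl.
Qed.

Lemma card_patternsB : #|patternsB| = 8%N. Proof. exact: card_patterns. Qed.
Lemma card_patternsC : #|patternsC| = 8%N. Proof. exact: card_patterns. Qed.
Lemma card_patternsD : #|patternsD| = 8%N. Proof. exact: card_patterns. Qed.
Lemma card_patternsE : #|patternsE| = 8%N. Proof. exact: card_patterns. Qed.

(** The lists of B and C share four words, whence the twelve elements of F. *)
Definition wordsF := undup
  ([:: [:: 1; 2; 3; 4]; [:: 1; 2; 4; 3]; [:: 2; 1; 3; 4]; [:: 2; 1; 4; 3];
      [:: 3; 4; 1; 2]; [:: 3; 4; 2; 1]; [:: 4; 3; 1; 2]; [:: 4; 3; 2; 1]] ++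
   [:: [:: 1; 2; 3; 4]; [:: 1; 4; 3; 2]; [:: 2; 1; 4; 3]; [:: 2; 3; 4; 1];
      [:: 3; 2; 1; 4]; [:: 3; 4; 1; 2]; [:: 4; 1; 2; 3]; [:: 4; 3; 2; 1]])%N.

Lemma patternsF_words : patternsF = patterns wordsF.
Proof.
rewrite /patternsF /patternsB /patternsC /patterns.
by apply/finset.setP => s; rewrite finset.in_setU !finset.in_set /wordsF mem_undup mem_cat.
Qed.

Lemma card_patternsF : #|patternsF| = 12%N.
Proof. rewrite patternsF_words; exact: card_patterns. Qed.

End ranks.

(** * The kernels as sums over pairings *)

(* 1 if, in the order [r], the pair {a, b} lies entirely below or entirely above
   {c, d}; [pair_alt] is 1 if the elements of the two pairs alternate. *)
Definition pair_low (r : rel nat) (a b c d : nat) : nat :=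
  (r a c * r a d * r b c * r b d + r c a * r c b * r d a * r d b)%N.

Definition chain (r : rel nat) (a b c d : nat) : nat := (r a b * r b c * r c d)%N.

Definition pair_alt (r : rel nat) (a b c d : nat) : nat :=
  (chain r a c b d + chain r a d b c + chain r b c a d + chain r b d a c +
   chain r c a d b + chain r c b d a + chain r d a c b + chain r d b c a)%N.

(* The parity of the number of inversions of the order [r] on {0, 1, 2, 3}. *)
Definition odd_rel (r : rel nat) : bool :=
  r 1%N 0%N (+) r 2%N 0%N (+) r 3%N 0%N (+) r 2%N 1%N (+) r 3%N 1%N (+) r 3%N 2%N.

Definition sum_pairings (f g : nat -> nat -> nat -> nat -> nat) : nat :=
  (f 0 1 2 3 * g 0 1 2 3 + f 0 2 1 3 * g 0 2 1 3 + f 0 3 1 2 * g 0 3 1 2)%N.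

Definition word_of (q v : seq nat) : seq nat :=
  [seq (nth 0%N v (index j q)).+1 | j <- iota 0 4].

Definition wordsB : seq (seq nat) :=
  [:: [:: 1; 2; 3; 4]; [:: 1; 2; 4; 3]; [:: 2; 1; 3; 4]; [:: 2; 1; 4; 3];
      [:: 3; 4; 1; 2]; [:: 3; 4; 2; 1]; [:: 4; 3; 1; 2]; [:: 4; 3; 2; 1]]%N.

Definition wordsC : seq (seq nat) :=
  [:: [:: 1; 2; 3; 4]; [:: 1; 4; 3; 2]; [:: 2; 1; 4; 3]; [:: 2; 3; 4; 1];
      [:: 3; 2; 1; 4]; [:: 3; 4; 1; 2]; [:: 4; 1; 2; 3]; [:: 4; 3; 2; 1]]%N.

Definition wordsD : seq (seq nat) :=
  [:: [:: 1; 3; 2; 4]; [:: 1; 3; 4; 2]; [:: 2; 4; 1; 3]; [:: 2; 4; 3; 1];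
      [:: 3; 1; 2; 4]; [:: 3; 1; 4; 2]; [:: 4; 2; 1; 3]; [:: 4; 2; 3; 1]]%N.

Definition wordsE : seq (seq nat) :=
  [:: [:: 1; 3; 2; 4]; [:: 1; 4; 2; 3]; [:: 2; 3; 1; 4]; [:: 2; 4; 1; 3];
      [:: 3; 1; 4; 2]; [:: 3; 2; 4; 1]; [:: 4; 1; 3; 2]; [:: 4; 2; 3; 1]]%N.

Definition order_of (q : seq nat) : rel nat := fun i j => (nth 0 q i < nth 0 q j)%N.

(** The last identity trades the indicator of the union F for those of B, C, D, E and the event that
    both orders have the same parity, that is, for a product of two signs. *)
Definition pattern_identities (r s : rel nat) (B C D E F : bool) : bool :=
  [&& B == sum_pairings (pair_low r) (pair_low s) :> nat,
      C == sum_pairings (pair_alt r) (pair_alt s) :> nat,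
      D == sum_pairings (pair_low r) (pair_alt s) :> nat,
      E == sum_pairings (pair_alt r) (pair_low s) :> nat
    & (3 * F + (D + E) + (odd_rel r == odd_rel s) == B + C + 2)%N].

Definition check_identities (q v : seq nat) : bool :=
  let l := word_of q v in
  pattern_identities (order_of q) (order_of v) (l \in wordsB) (l \in wordsC)
    (l \in wordsD) (l \in wordsE) ((l \in wordsB) || (l \in wordsC)).

(** Evaluates all 24 times 24 pairs of orders; the sample enters only through such a pair. *)
Lemma check_identities_permutations :
  all (fun q => all (check_identities q) (permutations (iota 0 4))) (permutations (iota 0 4)).
Proof. by vm_compute. Qed.

Lemma enum_ord4 : enum 'I_4 = [:: inord 0; inord 1; inord 2; inord 3].
Proof.
apply: (inj_map val_inj); rewrite val_enum_ord /= !inordK//.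
Qed.

Lemma values_permutations (Q : 'S_4) :
  [seq val (Q i) | i <- enum 'I_4] \in permutations (iota 0 4).
Proof.
rewrite mem_permutations; apply: uniq_perm.
- by rewrite map_comp map_inj_uniq ?(map_inj_uniq (@perm_inj _ Q)) ?enum_uniq//; exact: val_inj.
- exact: iota_uniq.
move=> x; rewrite mem_iota add0n leq0n /=; apply/mapP/idP => [[i _ ->]|x4].
  exact: ltn_ord.
by exists ((Q^-1)%g (Ordinal x4)); rewrite ?mem_enum// permKV.
Qed.

Section kernel_formula.
Context {R : realType}.
Implicit Types (x y : R) (z : 'I_4 -> R * R).

Definition lt01 x y : R := ((x < y)%R)%:R.

Definition ltrel (u : nat -> R) : rel nat := fun i j => (u i < u j)%R.

Definition lowR (a b c d : R) : R :=
  lt01 a c * lt01 a d * lt01 b c * lt01 b d + lt01 c a * lt01 c b * lt01 d a * lt01 d b.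

Definition chainR (a b c d : R) : R := lt01 a b * lt01 b c * lt01 c d.

Definition altR (a b c d : R) : R :=
  chainR a c b d + chainR a d b c + chainR b c a d + chainR b d a c +
  chainR c a d b + chainR c b d a + chainR d a c b + chainR d b c a.

Definition sgnR (a b c d : R) : R :=
  (1 - 2 * lt01 b a) * (1 - 2 * lt01 c a) * (1 - 2 * lt01 d a) *
  (1 - 2 * lt01 c b) * (1 - 2 * lt01 d b) * (1 - 2 * lt01 d c).

Definition pairingsR (f g : R -> R -> R -> R -> R) (z1 z2 z3 z4 : R * R) : R :=
  f z1.1 z2.1 z3.1 z4.1 * g z1.2 z2.2 z3.2 z4.2 +
  f z1.1 z3.1 z2.1 z4.1 * g z1.2 z3.2 z2.2 z4.2 +
  f z1.1 z4.1 z2.1 z3.1 * g z1.2 z4.2 z2.2 z3.2.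

(** The constants 1/3 are 8/24. For F, with e the product of the signs, the parity event has
    indicator (1 + e)/2, so three times the indicator of F is B + C - D - E + 3/2 - e/2 in terms of
    indicators; subtracting 12/24 leaves no constant. *)
Definition kernelR (A : stat) (z1 z2 z3 z4 : R * R) : R :=
  let B := pairingsR lowR lowR z1 z2 z3 z4 - 1 / 3 in
  let C := pairingsR altR altR z1 z2 z3 z4 - 1 / 3 in
  let D := 1 / 3 - pairingsR lowR altR z1 z2 z3 z4 in
  let E := 1 / 3 - pairingsR altR lowR z1 z2 z3 z4 in
  match A with
  | statB => B | statC => C | statD => D | statE => E | statDE => D + E
  | statF => (B + C + D + E) / 3
     - sgnR z1.1 z2.1 z3.1 z4.1 * sgnR z1.2 z2.2 z3.2 z4.2 / 6
  end.

Let X z i := (z (inord i : 'I_4)).1.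
Let Y z i := (z (inord i : 'I_4)).2.

Lemma pairings_natr z (f g : rel nat -> nat -> nat -> nat -> nat -> nat)
    (fR gR : R -> R -> R -> R -> R) :
  (forall (u : nat -> R) a b c d, (f (ltrel u) a b c d)%:R =
     fR (u a) (u b) (u c) (u d)) ->
  (forall (u : nat -> R) a b c d, (g (ltrel u) a b c d)%:R =
     gR (u a) (u b) (u c) (u d)) ->
  (sum_pairings (f (ltrel (X z))) (g (ltrel (Y z))))%:R =
  pairingsR fR gR (z (inord 0)) (z (inord 1)) (z (inord 2)) (z (inord 3)).
Proof.
by move=> fE gE; rewrite /sum_pairings !natrD !natrM !fE !gE.
Qed.

Lemma pair_low_natr (u : nat -> R) a b c d :
  (pair_low (ltrel u) a b c d)%:R = lowR (u a) (u b) (u c) (u d).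
Proof. by rewrite /pair_low natrD !natrM. Qed.

Lemma pair_alt_natr (u : nat -> R) a b c d :
  (pair_alt (ltrel u) a b c d)%:R = altR (u a) (u b) (u c) (u d).
Proof. by rewrite /pair_alt !natrD !natrM. Qed.

Lemma odd_rel_sgn (u : nat -> R) :
  sgnR (u 0%N) (u 1%N) (u 2%N) (u 3%N) = (- 1) ^+ odd_rel (ltrel u).
Proof.
rewrite /sgnR /odd_rel /lt01 /ltrel !signr_addb.
by do 5?[congr (_ * _)]; case: (_ < _)%R; rewrite /= ?expr1 ?expr0; lra.
Qed.

Lemma pattern_identities_sample z : no_ties z -> exists p,
  sample_perm z = Some p /\
  pattern_identities (ltrel (X z)) (ltrel (Y z))
    (p \in patternsB) (p \in patternsC) (p \in patternsD) (p \in patternsE)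
    (p \in patternsF).
Proof.
move=> [i1 i2]; have [Q [V [zQV Ql Vl]]] := sample_permP i1 i2.
exists (Q^-1 * V)%g; split => //.
have /allP/(_ _ (values_permutations Q))/allP/(_ _ (values_permutations V)) :=
  check_identities_permutations.
rewrite /check_identities /word_of -one_line_quotient.
have oQ i j : (i < 4)%N -> (j < 4)%N ->
    order_of [seq val (Q i) | i <- enum 'I_4] i j = ltrel (X z) i j.
  move=> i4 j4; rewrite /order_of enum_ord4 /ltrel /X -Ql.
  by move: i j i4 j4 => [|[|[|[|//]]]] [|[|[|[|//]]]].
have oV i j : (i < 4)%N -> (j < 4)%N ->
    order_of [seq val (V i) | i <- enum 'I_4] i j = ltrel (Y z) i j.
  move=> i4 j4; rewrite /order_of enum_ord4 /ltrel /Y -Vl.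
  by move: i j i4 j4 => [|[|[|[|//]]]] [|[|[|[|//]]]].
rewrite /pattern_identities /sum_pairings /pair_low /pair_alt /chain /odd_rel.
rewrite !oQ// !oV// /patternsF finset.in_setU /patternsB /patternsC /patternsD /patternsE /patterns.
by rewrite !finset.in_set.
Qed.

Lemma kernel4_no_ties A z : no_ties z ->
  kernel4 A z = kernelR A (z (inord 0)) (z (inord 1)) (z (inord 2)) (z (inord 3)).
Proof.
move=> /pattern_identities_sample[p [zp]] /and5P[].
move=> /eqP/(congr1 (fun n => n%:R : R)) Be /eqP/(congr1 (fun n => n%:R : R)) Ce.
move=> /eqP/(congr1 (fun n => n%:R : R)) De /eqP/(congr1 (fun n => n%:R : R)) Ee.
move=> /eqP Fn.
rewrite (pairings_natr z pair_low_natr pair_low_natr) in Be.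
rewrite (pairings_natr z pair_alt_natr pair_alt_natr) in Ce.
rewrite (pairings_natr z pair_low_natr pair_alt_natr) in De.
rewrite (pairings_natr z pair_alt_natr pair_low_natr) in Ee.
have sE : sgnR (X z 0) (X z 1) (X z 2) (X z 3) * sgnR (Y z 0) (Y z 1) (Y z 2) (Y z 3) =
    2 * (odd_rel (ltrel (X z)) == odd_rel (ltrel (Y z)))%:R - 1.
  rewrite !odd_rel_sgn; case: odd_rel; case: odd_rel; rewrite /= ?expr1 ?expr0; lra.
have Fe : 3 * (p \in patternsF)%:R + ((p \in patternsD)%:R + (p \in patternsE)%:R) +
    (odd_rel (ltrel (X z)) == odd_rel (ltrel (Y z)))%:R =
    (p \in patternsB)%:R + (p \in patternsC)%:R + 2 :> R.
  by move: Fn; do 5 case: (_ \in _); case: (_ == _) => //= _; rewrite ?mulr0 ?mulr1; lra.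
rewrite Be Ce De Ee in Fe.
have c8 : (8%N)%:R / 24 = 1 / 3 :> R by lra.
have c12 : (12%N)%:R / 24 = 1 / 2 :> R by lra.
rewrite /kernel4 /T_stat /excess /deficit !sample_pattern_sum4 zp /=.
rewrite card_patternsB card_patternsC card_patternsD card_patternsE card_patternsF.
rewrite Be Ce De Ee c8 c12 /kernelR.
case: A => //.
move: Fe sE; rewrite /X /Y => Fe ->; lra.
Qed.

End kernel_formula.

(** * Concentration of the statistics *)

Lemma ffact_le_expn n k : (n ^_ k <= n ^ k)%N.
Proof.
elim: k => // k ih; by rewrite ffactnSr expnSr leq_mul// leq_subr.
Qed.

Lemma card_injective4 n : #|[pred m : {ffun 'I_4 -> 'I_n} | injectiveb m]| = (n ^_ 4)%N.
Proof.
have := card_inj_ffuns 'I_4 'I_n; rewrite !card_ord => <-.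
by apply: eq_card => m; rewrite !finset.inE.
Qed.

(** Arithmetical form of the union bound over the pairs of places where a tuple may repeat a value.
    It yields the constants 6 for four indices and 28 for eight. *)
Lemma expn_le_ffact n k : (n ^ k.+1 <= n ^_ k.+1 + 'C(k.+1, 2) * n ^ k)%N.
Proof.
elim: k => [|k ih]; first by rewrite expn1 ffactn1 leq_addr.
rewrite expnSr ffactnSr binS bin1.
have [kn|nk] := leqP k.+1 n; last first.
  rewrite (leq_trans _ (leq_addl _ _))// expnSr -expnSr expnSr mulnC leq_mul//.
  by rewrite (leq_trans (ltnW nk))// leq_addl.
apply: (@leq_trans ((n ^_ k.+1 + 'C(k.+1, 2) * n ^ k) * n)); first by rewrite leq_mul2r ih orbT.
rewrite mulnDl -mulnA -expnSr mulnDl.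
have h1 : (n ^_ k.+1 * n = n ^_ k.+1 * (n - k.+1) + n ^_ k.+1 * k.+1)%N.
  by rewrite -mulnDr subnK.
by rewrite h1 -addnA leq_add2l addnC leq_add2l mulnC leq_mul2l/= ffact_le_expn.
Qed.

Lemma card_noninjective (I : finType) n k : #|I| = k.+1 ->
  (#|[set f : {ffun I -> 'I_n} | ~~ injectiveb f]%SET| <= 'C(k.+1, 2) * n ^ k)%N.
Proof.
move=> Ik.
have := cardsC [set f : {ffun I -> 'I_n} | injectiveb f]%SET.
rewrite card_inj_ffuns card_ffun Ik !card_ord => H.
rewrite -(leq_add2l (n ^_ k.+1)) (leq_trans _ (expn_le_ffact n k))// -H leq_add2l.
by apply: subset_leq_card; apply/fintype.subsetP => f; rewrite !finset.inE.
Qed.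

Section measurability.
Context d (S : measurableType d) {R : realType}.

Lemma measurable_fun_finite d' (T : measurableType d') (I : finType) (f : S -> I) (g : S -> T) :
  (forall i, measurable [set w | f w = i]) ->
  (forall w w', f w = f w' -> g w = g w') -> measurable_fun setT g.
Proof.
move=> mf fg _ B mB; rewrite setTI.
rewrite (_ : _ @^-1` _ =
   \bigcup_(i in [set i | exists w, f w = i /\ B (g w)]) [set w | f w = i]).
  by apply: fin_bigcup_measurable => // i _; exact: mf.
apply/seteqP; split => [w Bw|w [i [w' [<- Bw']]] /= /fg -> //].
by exists (f w) => //; exists w.
Qed.

(** The table [c] of all comparisons takes finitely many values on measurable sets, and the
    permutation, including its absence under ties, is a function of this table. *)
Lemma measurable_sample_perm n (Y : 'I_n -> S -> R * R) d' (T : measurableType d')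
    (g : ('I_n -> R * R) -> T) :
  (forall k, measurable_fun setT (Y k)) ->
  (forall z z', sample_perm z = sample_perm z' -> g z = g z') ->
  measurable_fun setT (fun w => g (fun k => Y k w)).
Proof.
move=> mY gE.
pose c w : {ffun 'I_n * 'I_n -> bool * bool} :=
  [ffun ij => ((Y ij.1 w).1 <= (Y ij.2 w).1, (Y ij.1 w).2 <= (Y ij.2 w).2)].
apply: (@measurable_fun_finite _ _ _ c).
  move=> i; rewrite (_ : [set w | _] = \bigcap_(ij in [set: 'I_n * 'I_n])
    ([set w | ((Y ij.1 w).1 <= (Y ij.2 w).1) = (i ij).1] `&`
     [set w | ((Y ij.1 w).2 <= (Y ij.2 w).2) = (i ij).2])).
    have m1 k : measurable_fun setT (fun w => (Y k w).1) by exact: measurableT_comp.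
    have m2 k : measurable_fun setT (fun w => (Y k w).2) by exact: measurableT_comp.
    apply: fin_bigcap_measurable => // ij _; apply: measurableI.
      have := @measurable_fun_ler _ _ _ setT _ _ (m1 ij.1) (m1 ij.2).
      by move=> /(_ measurableT [set (i ij).1] I); rewrite setTI.
    have := @measurable_fun_ler _ _ _ setT _ _ (m2 ij.1) (m2 ij.2).
    by move=> /(_ measurableT [set (i ij).2] I); rewrite setTI.
  apply/seteqP; split => w /=.
    by move=> <- ij _; rewrite ffunE.
  by move=> H; apply/ffunP => ij; rewrite ffunE; have [-> ->] := H ij I; case: (i ij).
move=> w w' cc'; apply: gE; apply: sample_perm_eq => i j.
  by have := congr1 (fun h : {ffun _ -> _} => (h (i, j)).1) cc'; rewrite !ffunE.
by have := congr1 (fun h : {ffun _ -> _} => (h (i, j)).2) cc'; rewrite !ffunE.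
Qed.

Lemma measurable_T_stat A n (Y : 'I_n -> S -> R * R) :
  (forall k, measurable_fun setT (Y k)) ->
  measurable_fun setT (fun w => T_stat A (fun k => Y k w)).
Proof. by move=> mY; apply: measurable_sample_perm => // z z'; exact: T_stat_eq. Qed.

End measurability.

Section bounds.
Context {R : realType}.

(** Without ties the sum is an average of indicators over injective tuples; with ties it is 0. *)
Lemma sample_pattern_sum01 W n (z : 'I_n -> R * R) : (4 <= n)%N ->
  0 <= sample_pattern_sum W z <= 1.
Proof.
have b4 (z4 : 'I_4 -> R * R) : 0 <= sample_pattern_sum W z4 <= 1.
  rewrite sample_pattern_sum4; case: sample_perm => [p|]/=; last by rewrite lexx ler01.
  by case: (_ \in _); rewrite ?lexx ?ler01.
move=> n4; have [nt|nt] := pselect (no_ties z); last first.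
  by rewrite /sample_pattern_sum sample_permN//= lexx ler01.
have c0 : (0 : R) < (n ^_ 4)%:R by rewrite ltr0n ffact_gt0.
have E := sum_injective_pattern_sum W n4 nt.
have S0 : 0 <= \sum_(m : {ffun 'I_4 -> 'I_n} | injectiveb m)
    sample_pattern_sum W (fun k => z (m k)).
  by apply: sumr_ge0 => m _; case/andP: (b4 (fun k => z (m k))).
have S1 : \sum_(m : {ffun 'I_4 -> 'I_n} | injectiveb m)
    sample_pattern_sum W (fun k => z (m k)) <= (n ^_ 4)%:R.
  rewrite -(card_injective4 n) -sumr_const.
  by apply: ler_sum => m _; case/andP: (b4 (fun k => z (m k))).
rewrite E in S0 S1; apply/andP; split; first by rewrite -(pmulr_rge0 _ c0).
by rewrite -(ler_pM2l c0) mulr1.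
Qed.

Lemma T_stat_bound A n (z : 'I_n -> R * R) : (4 <= n)%N -> `|T_stat A z| <= 2.
Proof.
move=> n4; have s01 W := sample_pattern_sum01 W z n4.
rewrite /T_stat /excess /deficit card_patternsB card_patternsC card_patternsD
  card_patternsE card_patternsF.
have := s01 patternsB; have := s01 patternsC; have := s01 patternsD; have := s01 patternsE.
have := s01 patternsF.
by case: A => /andP[? ?] /andP[? ?] /andP[? ?] /andP[? ?] /andP[? ?]; rewrite ler_norml; lra.
Qed.

Lemma kernel4_bound A (z : 'I_4 -> R * R) : `|kernel4 A z| <= 2.
Proof. exact: T_stat_bound. Qed.

Lemma sum_injective_kernel4 A n (z : 'I_n -> R * R) : (4 <= n)%N -> no_ties z ->
  \sum_(m : {ffun 'I_4 -> 'I_n} | injectiveb m) kernel4 A (fun k => z (m k)) =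
  (n ^_ 4)%:R * T_stat A z.
Proof.
move=> n4 nt; have H W := sum_injective_pattern_sum W n4 nt.
have c : \sum_(m : {ffun 'I_4 -> 'I_n} | injectiveb m) 1 = (n ^_ 4)%:R :> R.
  by rewrite sumr_const card_injective4.
have e W (a : R) : \sum_(m : {ffun 'I_4 -> 'I_n} | injectiveb m)
    (sample_pattern_sum W (fun k => z (m k)) - a) =
    (n ^_ 4)%:R * (sample_pattern_sum W z - a).
  rewrite mulrBr sumrB H; congr (_ - _).
  by rewrite -c mulr_suml; apply: eq_bigr => m _; rewrite mul1r.
have f W (a : R) : \sum_(m : {ffun 'I_4 -> 'I_n} | injectiveb m)
    (a - sample_pattern_sum W (fun k => z (m k))) =
    (n ^_ 4)%:R * (a - sample_pattern_sum W z).
  under eq_bigr do rewrite -opprB.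
  by rewrite sumrN e -mulrN opprB.
rewrite /kernel4 /T_stat /excess /deficit; case: A; rewrite ?e ?f//.
by rewrite big_split/= !f -mulrDr.
Qed.

(** At most 6 n^3 tuples repeat an index, and each changes the average by at most 2 + 2, which gives
    24. *)
Lemma vstat_T_stat A n (z : 'I_n -> R * R) : (4 <= n)%N -> no_ties z ->
  `|n%:R ^- 4 * (\sum_(m : {ffun 'I_4 -> 'I_n}) kernel4 A (fun k => z (m k)))
    - T_stat A z| <= 24 / n%:R.
Proof.
move=> n4 nt.
have n0 : (0 : R) < n%:R by rewrite ltr0n (leq_trans _ n4).
rewrite (bigID (fun m : {ffun 'I_4 -> 'I_n} => injectiveb m))/= sum_injective_kernel4//.
set S := \sum_(_ | _) _.
set N := #|[set m : {ffun 'I_4 -> 'I_n} | ~~ injectiveb m]%SET|.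
have NE : (n ^_ 4 + N = n ^ 4)%N.
  have := cardsC [set f : {ffun 'I_4 -> 'I_n} | injectiveb f]%SET.
  rewrite card_inj_ffuns card_ffun !card_ord => <-; congr addn.
  by apply: eq_card => f; rewrite !finset.inE.
have Nle : N%:R <= 6 * n%:R ^+ 3 :> R.
  by have := @card_noninjective 'I_4 n 3 (card_ord 4); rewrite -/N -(ler_nat R) natrM natrX.
have S2 : `|S| <= 2 * N%:R.
  rewrite (le_trans (ler_norm_sum _ _ _))//.
  apply: (@le_trans _ _ (\sum_(m : {ffun 'I_4 -> 'I_n} | ~~ injectiveb m) 2)).
    by apply: ler_sum => m _; exact: kernel4_bound.
  rewrite sumr_const -[leLHS]mulr_natr ler_wpM2l// ler_nat /N.
  by apply: subset_leq_card; apply/fintype.subsetP => m; rewrite finset.inE.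
have T2 := T_stat_bound A z n4.
have ffE : (n ^_ 4)%:R = n%:R ^+ 4 - N%:R :> R.
  by rewrite -natrX -NE natrD addrK.
have -> : n%:R ^- 4 * ((n ^_ 4)%:R * T_stat A z + S) - T_stat A z =
    n%:R ^- 4 * (S - N%:R * T_stat A z).
  by rewrite ffE; field; rewrite gt_eqF.
rewrite normrM ger0_norm ?invr_ge0 ?exprn_ge0 ?ler0n//.
rewrite mulrC ler_pdivrMr ?exprn_gt0//.
have -> : 24 / n%:R * n%:R ^+ 4 = 24 * n%:R ^+ 3 :> R by field; rewrite gt_eqF.
rewrite (le_trans (ler_normB _ _))// normrM (ger0_norm (ler0n _ _)).
have : N%:R * `|T_stat A z| <= N%:R * 2 by rewrite ler_wpM2l.
lra.
Qed.

End bounds.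

Section second_moment.
Context {R : realType} d (Omega : measurableType d) (Pr : probability Omega R).
Variables (Z : nat -> Omega -> R * R) (P : probability (R * R)%type R).
Hypotheses (mZ : forall i, measurable_fun setT (Z i))
  (indep : mutually_independent Pr Z)
  (law : forall i A, measurable A -> Pr (Z i @^-1` A) = P A).
Variable A : stat.

Definition kernelT (z : ((R * R) * (R * R)) * ((R * R) * (R * R))) : R :=
  kernel4 A (tnth [tuple z.1.1; z.1.2; z.2.1; z.2.2]).

Lemma bfun_kernelT : bfun kernelT.
Proof.
split; last by exists 2 => z; exact: kernel4_bound.
apply: (@measurable_T_stat _ _ R A 4 (fun k z => tnth [tuple z.1.1; z.1.2; z.2.1; z.2.2] k)).
move=> k; case: (ord4P k) => ->; rewrite /tnth /= inordK//=; repeat apply: measurableT_comp => //.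
Qed.

Lemma kernel4_quad (i : 'I_4 -> nat) w :
  kernel4 A (fun k => Z (i k) w) = kernelT (quad Z i w).
Proof.
congr (kernel4 A); apply: funext => k.
by case: (ord4P k) => ->; rewrite /tnth /= inordK.
Qed.

Definition mean4 : R := \int[law4 P]_z kernelT z.

Lemma b_fun_mean4 : \int[Pr]_w kernel4 A (@sample R _ _ Z 4 w) = mean4.
Proof.
rewrite /mean4 -(@Rintegral_quad _ _ _ _ _ _ mZ indep law (fun k => val k))//.
- by congr Rintegral; apply: funext => w; rewrite -kernel4_quad.
- exact: bfun_kernelT.
Qed.

Lemma bfun_V_n n : bfun (V_n Z A n).
Proof.
apply: bfunM; first exact: bfun_cst.
apply: bfun_sum => m.
have -> : (fun w => kernel4 A (fun k => @sample R _ _ Z n w (m k))) =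
    (fun w => kernelT (quad Z (fun k => val (m k)) w)).
  by apply: funext => w; rewrite -kernel4_quad.
by apply: bfun_comp; [exact: measurable_quad|exact: bfun_kernelT].
Qed.

(** Pairs of quadruples with eight distinct indices contribute 0 by independence; each of the at
    most 28 n^7 others contributes at most 4^2, and 448 = 28 * 16. The argument is valid under every
    law of the family. *)
Lemma V_n_second_moment n : (0 < n)%N ->
  \int[Pr]_w (V_n Z A n w - mean4) ^+ 2 <= 448 / n%:R.
Proof.
move=> n0; have n0' : (0 : R) < n%:R by rewrite ltr0n.
pose F z := kernelT z - mean4.
have bF : bfun F by apply: bfunB; [exact: bfun_kernelT|exact: bfun_cst].
have mean2 : `|mean4| <= 2.
  apply: Rintegral_norm_le; first by case: bfun_kernelT.
  by move=> z; exact: kernel4_bound.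
have F4 z : `|F z| <= 4.
  rewrite (le_trans (ler_normB _ _))//; have := kernel4_bound A (tnth [tuple z.1.1; z.1.2; z.2.1; z.2.2]).
  rewrite -/(kernelT z); lra.
have F0 : \int[law4 P]_z F z = 0.
  rewrite RintegralB//; [|exact/integrable_bfun/bfun_kernelT|exact/integrable_bfun/bfun_cst].
  by rewrite Rintegral_cst1 subrr.
(* A pair of quadruples becomes one map on the disjoint sum, so that distinctness of all eight
   indices is injectivity. *)
pose I8 := ('I_4 + 'I_4)%type.
pose q1 (g : {ffun I8 -> 'I_n}) (k : 'I_4) : nat := g (inl k).
pose q2 (g : {ffun I8 -> 'I_n}) (k : 'I_4) : nat := g (inr k).
have E w : (V_n Z A n w - mean4) ^+ 2 =
    n%:R ^- 8 * \sum_(g : {ffun I8 -> 'I_n}) (F (quad Z (q1 g) w) * F (quad Z (q2 g) w)).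
  have -> : V_n Z A n w - mean4 =
      n%:R ^- 4 * \sum_(m : {ffun 'I_4 -> 'I_n}) F (quad Z (fun k => val (m k)) w).
    rewrite sumrB mulrBr; congr (_ - _).
      by rewrite /V_n; congr (_ * _); apply: eq_bigr => m _; rewrite -kernel4_quad.
    rewrite sumr_const card_ffun !card_ord -[X in _ = _ * X]mulr_natr natrX mulrCA mulVf ?mulr1//.
    by rewrite expf_neq0// gt_eqF.
  rewrite exprMn exprVn -exprM; congr (_ * _).
  rewrite expr2 mulr_suml; under eq_bigr do rewrite mulr_sumr.
  rewrite pair_big/= [RHS](reindex (fun p : {ffun 'I_4 -> 'I_n} * {ffun 'I_4 -> 'I_n} =>
     [ffun x : I8 => match x with inl k => p.1 k | inr k => p.2 k end]))/=.
    apply: eq_bigr => p _; congr (F _ * F _); congr (quad Z _ w);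
      by apply: funext => k; rewrite /q1 /q2 ffunE.
  exists (fun g : {ffun I8 -> 'I_n} => ([ffun k => g (inl k)], [ffun k => g (inr k)])) => [p _|g _].
    by case: p => p1 p2; congr (_, _); apply/ffunP => k; rewrite !ffunE.
  by apply/ffunP => -[k|k]; rewrite !ffunE.
under eq_Rintegral do rewrite E.
have bG (g : {ffun I8 -> 'I_n}) : bfun (fun w => F (quad Z (q1 g) w) * F (quad Z (q2 g) w)).
  by apply: bfunM; apply: bfun_comp => //; exact: measurable_quad.
rewrite RintegralZl//; last by apply: integrable_bfun; exact: bfun_sum.
rewrite Rintegral_sum; last by move=> g; exact: integrable_bfun.
rewrite (bigID (fun g : {ffun I8 -> 'I_n} => injectiveb g))/= big1 ?add0r; last first.
  move=> g /injectiveP gi; rewrite (Rintegral_quad_pair mZ indep law)//.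
    by rewrite F0 expr0n.
  by move=> [k|k] [l|l] /= /val_inj/gi.
rewrite mulrC ler_pdivrMr ?exprn_gt0//.
have -> : 448 / n%:R * n%:R ^+ 8 = 448 * n%:R ^+ 7 :> R by field; rewrite gt_eqF.
set N := #|[set g : {ffun I8 -> 'I_n} | ~~ injectiveb g]%SET|.
have Nle : N%:R <= 28 * n%:R ^+ 7 :> R.
  have := @card_noninjective I8 n 7; rewrite card_sum !card_ord => /(_ erefl).
  by rewrite -/N -(ler_nat R) natrM natrX.
apply: (@le_trans _ _ (16 * N%:R)); last lra.
rewrite (le_trans (ler_norm _))// (le_trans (ler_norm_sum _ _ _))//.
apply: (@le_trans _ _ (\sum_(g : {ffun I8 -> 'I_n} | ~~ injectiveb g) 16)).
  apply: ler_sum => g _; apply: Rintegral_norm_le; first by case: (bG g).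
  move=> w; rewrite normrM (le_trans (ler_pM _ _ (F4 _) (F4 _)))//; lra.
rewrite sumr_const -[leLHS]mulr_natr ler_wpM2l// ler_nat /N.
by apply: subset_leq_card; apply/fintype.subsetP => m; rewrite finset.inE.
Qed.

End second_moment.

(** * Sample sizes from large deviation bounds *)

Section large_deviation_bounds.
Context {R : realType}.

Lemma ld_bounds (p : nat -> \bar R) (r e : R) :
  (forall n, (0 <= p n <= 1)%E) -> 0 < e ->
  (- ((n%:R^-1)%:E * lne (p n)))%E @[n --> \oo] --> r%:E ->
  \forall n \near \oo, ((expR (- (n%:R * (r + e))))%:E <= p n)%E /\
    (p n <= (expR (- (n%:R * (r - e))))%:E)%E.
Proof.
move=> p01 e0 /fine_cvgP[fin /cvgrPdist_lt/(_ _ e0) cvg].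
near=> n.
have n0 : (0 : R) < n%:R by rewrite ltr0n; near: n; exact: nbhs_infty_gt.
have : `|r - fine (- ((n%:R^-1)%:E * lne (p n)))%E| < e by near: n; exact: cvg.
have : (- ((n%:R^-1)%:E * lne (p n)))%E \is a fin_num by near: n; exact: fin.
have /andP[pn0 pn1] := p01 n.
case: (p n) pn0 pn1 => [x| |] //; rewrite !lee_fin => x0 x1.
(* A vanishing probability would make the normalised logarithm infinite, against its finiteness for
   large n. *)
move: x0; rewrite le_eqVlt => /predU1P[<-|x0].
  by rewrite le0_lneNy// mulrNy gtr0_sg ?invr_gt0// mul1e.
rewrite lne_EFin// => _ /=.
rewrite ltr_norml => /andP[h1 h2].
rewrite -{1 2}(lnK x0) !ler_expR; split.
  rewrite -(ler_pM2l (_ : 0 < n%:R^-1)) ?invr_gt0// mulrN mulrA mulVf ?gt_eqF// mul1r; lra.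
rewrite -(ler_pM2l (_ : 0 < n%:R^-1)) ?invr_gt0// mulrN mulrA mulVf ?gt_eqF// mul1r; lra.
Unshelve. all: by end_near. Qed.

Lemma ld_monotone (p p' : nat -> \bar R) (r r' : R) :
  (forall n, (0 <= p n <= 1)%E) -> (forall n, (0 <= p' n <= 1)%E) ->
  (\forall n \near \oo, (p n <= p' n)%E) ->
  (- ((n%:R^-1)%:E * lne (p n)))%E @[n --> \oo] --> r%:E ->
  (- ((n%:R^-1)%:E * lne (p' n)))%E @[n --> \oo] --> r'%:E -> r' <= r.
Proof.
move=> p01 p01' pp' pr pr'; rewrite leNgt; apply/negP => rr'.
(* With a slack of a third of the gap, the exponential lower bound for p exceeds the upper bound for
   p'. *)
have e0 : 0 < (r' - r) / 3 by rewrite divr_gt0// subr_gt0.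
have H : \forall n \near \oo, False.
  near=> n.
  have n0 : (0 : R) < n%:R by rewrite ltr0n; near: n; exact: nbhs_infty_gt.
  have [h _] : ((expR (- (n%:R * (r + (r' - r) / 3))))%:E <= p n)%E /\
    (p n <= (expR (- (n%:R * (r - (r' - r) / 3))))%:E)%E.
    by near: n; exact: ld_bounds.
  have [_ h'] : ((expR (- (n%:R * (r' + (r' - r) / 3))))%:E <= p' n)%E /\
    (p' n <= (expR (- (n%:R * (r' - (r' - r) / 3))))%:E)%E.
    by near: n; exact: ld_bounds.
  have hh : (p n <= p' n)%E by near: n.
  have := le_trans h (le_trans hh h').
  rewrite lee_fin ler_expR lerN2 ler_pM2l//; lra.
by have [N _ /(_ N (leqnn N))] := H.
Unshelve. all: by end_near. Qed.

End large_deviation_bounds.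

Section sample_size_bounds.
Context {R : realType} d (Omega : measurableType d).
Variables (Pr : R -> probability Omega R) (Z : nat -> Omega -> R * R).
Variables (A : stat) (beta t b rp rm : R) (u : R^nat).
Hypotheses (beta01 : 0 < beta < 1) (rp0 : 0 < rp) (rm0 : 0 < rm).
Hypothesis mT : forall n, measurable_fun setT (T_n Z A n).

Let psi n (x : R) : \bar R := Pr 0 [set w | x <= T_n Z A n w].

Hypothesis lln : forall e : R, 0 < e -> \forall n \near \oo,
  (Pr t [set w | (u n <= `|T_n Z A n w - b|)%R] <= e%:E)%E.
Hypothesis upper : forall e : R, 0 < e -> \forall n \near \oo,
  (psi n (b - u n) <= (expR (- (n%:R * (rp - e))))%:E)%E.
Hypothesis lower : forall e : R, 0 < e -> \forall n \near \oo,
  ((expR (- (n%:R * (rm + e))))%:E <= psi n (b + u n))%E.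

Let psi_mono n x y : x <= y -> (psi n y <= psi n x)%E.
Proof.
move=> xy; apply: le_measure; rewrite ?inE.
- by rewrite -[X in measurable X]setTI; apply: measurable_fun_le => //; exact: measurable_cst.
- by rewrite -[X in measurable X]setTI; apply: measurable_fun_le => //; exact: measurable_cst.
- by move=> w /=; exact: le_trans.
Qed.

(** The tail is monotone in the level, so the values of the statistic that lead to rejection form an
    interval. *)
Let measurable_rejection n alpha :
  measurable [set w | (attained_level Pr Z A n w <= alpha%:E)%E].
Proof.
pose I := [set x : R | (psi n x <= alpha%:E)%E].
have mI : measurable I.
  apply: is_interval_measurable => x y Ix Iy z /andP[xz zy].
  exact: le_trans (psi_mono n xz) Ix.
by have := mT n measurableT mI; rewrite setTI.
Qed.

Let measurable_deviation n : measurable [set w | u n <= `|T_n Z A n w - b|].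
Proof.
rewrite -[X in measurable X]setTI; apply: measurable_fun_le => //.
by apply: measurableT_comp => //; apply: measurable_funB.
Qed.

(** Unless T_n deviates from b by at least u n, the attained level lies between the tails at b + u n
    and b - u n. Beyond ln(1/alpha)/(rp - e) the larger tail is at most alpha, so the test rejects;
    below ln(1/alpha)/(rm + e) the smaller one exceeds alpha, so it accepts. The thresholds from
    which the estimates hold are fixed before alpha, hence K is independent of alpha. *)
Lemma sample_size_near (e : R) : 0 < e -> e < rp -> exists K : R,
  \forall alpha \near (0 : R)^'+, exists x : R,
    [/\ sample_size Pr Z A alpha beta t = x%:E, 4 <= x,
        ln (alpha^-1) / (rm + e) <= x & x <= ln (alpha^-1) / (rp - e) + K].
Proof.
move=> e0 erp; have /andP[b0 b1] := beta01.
have b1' : 0 < 1 - beta by rewrite subr_gt0.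
have [N _ HN] : \forall n \near \oo, (psi n (b - u n) <= (expR (- (n%:R * (rp - e))))%:E)%E /\
   (Pr t [set w | (u n <= `|T_n Z A n w - b|)%R] <= (1 - beta)%:E)%E.
  by apply: filterS2 (upper e0) (lln b1') => n.
(* Half of beta stands for any value strictly below beta: for sizes below the critical one,
   rejection forces a deviation, and the power is at most this value. *)
have [M _ HM] : \forall n \near \oo, ((expR (- (n%:R * (rm + e))))%:E <= psi n (b + u n))%E /\
   (Pr t [set w | (u n <= `|T_n Z A n w - b|)%R] <= (beta / 2)%:E)%E.
  have b2 : 0 < beta / 2 by rewrite divr_gt0.
  by apply: filterS2 (lower e0) (lln b2) => n.
(* The constant absorbs the threshold [N], the minimal size 4 and the rounding up of the critical
   size. *)
exists ((maxn N 4).+1)%:R.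
have rpe : 0 < rp - e by rewrite subr_gt0.
have rme : 0 < rm + e by rewrite addr_gt0.
near=> alpha.
have a0 : 0 < alpha by near: alpha; exact: nbhs_right_gt.
have a1 : alpha < 1 by near: alpha; exact: nbhs_right_lt.
have aM : alpha < expR (- (M%:R * (rm + e))).
  by near: alpha; apply: nbhs_right_lt; exact: expR_gt0.
pose l := ln (alpha^-1).
have l0 : 0 < l by rewrite ln_gt0// invf_gt1.
have alE : alpha = expR (- l) by rewrite /l lnV ?posrE// opprK lnK.
have lM : M%:R < l / (rm + e).
  by move: aM; rewrite alE ltr_expR ltrN2 ltr_pdivlMr.
pose S := [set m : nat | (4 <= m)%N /\ forall n, (m <= n)%N ->
    (beta%:E <= Pr t [set w | (attained_level Pr Z A n w <= alpha%:E)%E])%E].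
have Slow m : S m -> l / (rm + e) <= m%:R.
  move=> [m4 Sm]; rewrite leNgt; apply/negP => ml.
  (* Membership of m in [S] constrains all larger sizes, and for small alpha the threshold [M] is
     itself below the critical size; so the power at the maximum of both gives the contradiction. *)
  pose n := maxn m M.
  have nl : n%:R < l / (rm + e) by rewrite /n /maxn; case: ifP.
  have [h1 h2] := HM n (leq_maxr m M).
  have := Sm n (leq_maxl m M); apply/negP; rewrite -ltNge.
  apply: (@le_lt_trans _ _ (beta / 2)%:E); last by rewrite lte_fin ltr_pdivrMr// ltr_pMr// ltr1n.
  apply: le_trans h2; apply: le_measure; rewrite ?inE//.
  move=> w /= Lw; rewrite leNgt; apply/negP => dev.
  have : (attained_level Pr Z A n w <= alpha%:E)%E by [].
  apply/negP; rewrite -ltNge; apply: lt_le_trans (le_trans h1 _); last first.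
    apply: psi_mono; move: dev; rewrite ltr_norml => /andP[_]; lra.
  by rewrite alE lte_fin ltr_expR ltrN2 -ltr_pdivlMr.
have [m0 Sm0 m0le] : exists2 m, S m & m%:R <= l / (rp - e) + ((maxn N 4).+1)%:R.
  pose k := (Num.trunc (l / (rp - e))).+1.
  have /andP[tle tgt] := truncn_itv (ltW (divr_gt0 l0 rpe)).
  have kge : l / (rp - e) <= k%:R by exact: ltW.
  exists (maxn N 4 + k)%N.
    split; first by rewrite (leq_trans (leq_maxr N 4))// leq_addr.
    move=> n kn; have nN : (N <= n)%N.
      by rewrite (leq_trans _ kn)// (leq_trans (leq_maxl N 4))// leq_addr.
    have [h1 h2] := HN n nN.
    have ->  : beta%:E = (1 - (1 - beta)%:E)%E by rewrite -EFinB; congr EFin; lra.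
    apply: (@le_trans _ _ (1 - Pr t [set w | (u n <= `|T_n Z A n w - b|)%R])%E).
      by apply: leeB.
    rewrite -probability_setC//; apply: le_measure; rewrite ?inE//; first exact: measurableC.
    move=> w /= /negP; rewrite -ltNge => dev.
    apply: (@le_trans _ _ (psi n (b - u n))).
      by apply: psi_mono; move: dev; rewrite ltr_norml => /andP[]; lra.
    apply: le_trans h1 _; rewrite alE lee_fin ler_expR lerN2 -ler_pdivrMr//.
    by rewrite (le_trans kge)// ler_nat (leq_trans _ kn)// leq_addl.
  by rewrite addnS -addSn natrD addrC lerD2r.
have inf_le : (sample_size Pr Z A alpha beta t <= (m0%:R)%:E)%E.
  by apply: ge_ereal_inf; exists (m0%:R)%:E => //; exists m0.
have le_inf (y : R) : (forall m, S m -> y <= m%:R) -> (y%:E <= sample_size Pr Z A alpha beta t)%E.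
  move=> ylb; apply: le_ereal_inf_tmp => _ [m Sm <-]; rewrite lee_fin; exact: ylb.
have ge4 : ((4 : R)%:E <= sample_size Pr Z A alpha beta t)%E.
  by apply: le_inf => m [m4 _]; rewrite ler_nat.
have fin : sample_size Pr Z A alpha beta t \is a fin_num.
  by move: ge4 inf_le; case: sample_size.
exists (fine (sample_size Pr Z A alpha beta t)); split.
- by rewrite fineK.
- by rewrite -lee_fin fineK.
- by rewrite -lee_fin fineK//; exact: le_inf.
- by rewrite -lee_fin fineK// (le_trans inf_le)// lee_fin.
Unshelve. all: by end_near. Qed.

End sample_size_bounds.

Section ratio_bounds.
Context {R : realType}.

(* Both sides of the ratio are asymptotically proportional to [l = ln alpha^-1]. *)
Lemma limf_einf_ratio (N N' : R -> \bar R) (c a b : R) : 0 < a -> 0 < b -> 0 < c -> c < b / a ->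
  (exists K : R, \forall alpha \near (0 : R)^'+, exists x y : R,
    [/\ N alpha = x%:E, N' alpha = y%:E, 0 < y,
       ln (alpha^-1) / a <= x & y <= ln (alpha^-1) / b + K]) ->
  (c%:E <= limf_einf (fun alpha => N alpha / N' alpha)%E (0 : R)^'+)%E.
Proof.
move=> a0 b0 c0 cab [K H].
rewrite limf_einfE.
pose V := [set alpha : R | (c%:E <= N alpha / N' alpha)%E].
apply: (@le_trans _ _ (ereal_inf [set (N alpha / N' alpha)%E | alpha in V])).
  by apply: le_ereal_inf_tmp => _ [alpha Va <-].
apply: ereal_sup_ubound; exists V => //.
(* The gap between the two slopes in l = ln(1/alpha) is what beats the additive constant K as soon
   as l is large. *)
have g0 : 0 < a^-1 - c / b.
  rewrite subr_gt0 ltr_pdivrMr// mulrC.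
  by move: cab; rewrite ltr_pdivlMr// -ltr_pdivlMr// mulrC.
rewrite /nbhs/=.
near=> alpha.
have al0 : 0 < alpha by near: alpha; exact: nbhs_right_gt.
have al1 : alpha < expR (- (c * `|K| / (a^-1 - c / b))).
  by near: alpha; apply: nbhs_right_lt; exact: expR_gt0.
have [x [y [Nx Ny y0 xl yu]]] : exists x y : R,
    [/\ N alpha = x%:E, N' alpha = y%:E, 0 < y,
       ln (alpha^-1) / a <= x & y <= ln (alpha^-1) / b + K] by near: alpha.
rewrite /V/= Nx Ny inver gt_eqF// -EFinM lee_fin ler_pdivlMr//.
apply: le_trans xl; set l := ln (alpha^-1) in yu *.
have lK : c * `|K| <= l * (a^-1 - c / b).
  rewrite -ler_pdivrMr// /l lnV ?posrE// lerNr -ler_expR lnK ?posrE//; exact: ltW.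
have := ler_wpM2l (ltW c0) yu.
have := ler_wpM2l (ltW c0) (ler_norm K).
have : l * (a^-1 - c / b) = l / a - c * (l / b) by ring.
rewrite mulrDr; lra.
Unshelve. all: by end_near. Qed.

Lemma limf_esup_ratio (N N' : R -> \bar R) (c a b : R) : 0 < a -> 0 < b -> 0 < c -> b / a < c ->
  (exists K : R, \forall alpha \near (0 : R)^'+, exists x y : R,
    [/\ N alpha = x%:E, N' alpha = y%:E, 0 < y,
       ln (alpha^-1) / b <= y & x <= ln (alpha^-1) / a + K]) ->
  (limf_esup (fun alpha => N alpha / N' alpha)%E (0 : R)^'+ <= c%:E)%E.
Proof.
move=> a0 b0 c0 cab [K H].
rewrite limf_esupE.
pose V := [set alpha : R | (N alpha / N' alpha <= c%:E)%E].
apply: (@le_trans _ _ (ereal_sup [set (N alpha / N' alpha)%E | alpha in V])); last first.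
  by apply: ge_ereal_sup => _ [alpha Va <-].
apply: ereal_inf_lbound; exists V => //.
have g0 : 0 < c / b - a^-1.
  by rewrite subr_gt0 ltr_pdivlMr// mulrC.
near=> alpha.
have al0 : 0 < alpha by near: alpha; exact: nbhs_right_gt.
have al1 : alpha < expR (- (`|K| / (c / b - a^-1))).
  by near: alpha; apply: nbhs_right_lt; exact: expR_gt0.
have [x [y [Nx Ny y0 yl xu]]] : exists x y : R,
    [/\ N alpha = x%:E, N' alpha = y%:E, 0 < y,
       ln (alpha^-1) / b <= y & x <= ln (alpha^-1) / a + K] by near: alpha.
rewrite /V/= Nx Ny inver gt_eqF// -EFinM lee_fin ler_pdivrMr//.
apply: le_trans xu _; set l := ln (alpha^-1) in yl *.
have lK : `|K| <= l * (c / b - a^-1).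
  rewrite -ler_pdivrMr// /l lnV ?posrE// lerNr -ler_expR lnK ?posrE//; exact: ltW.
have := ler_wpM2l (ltW c0) yl.
have := ler_norm K.
have : l * (c / b - a^-1) = c * (l / b) - l / a by ring.
lra.
Unshelve. all: by end_near. Qed.

Lemma limf_einf_le_esup (f : R -> \bar R) :
  (limf_einf f (0 : R)^'+ <= limf_esup f (0 : R)^'+)%E.
Proof.
rewrite limf_einfE limf_esupE.
apply: ge_ereal_sup => _ [V FV <-]; apply: le_ereal_inf_tmp => _ [W FW <-].
have [x [Vx Wx]] : exists x, (V `&` W) x.
  by apply: (@filter_ex _ (0 : R)^'+); exact: filterI.
apply: (@le_trans _ _ (f x)).
  by apply: ereal_inf_lbound; exists x.
by apply: ereal_sup_ubound; exists x.
Qed.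

End ratio_bounds.

(** * Absence of ties and the law of large numbers *)

Lemma measurable_eq_set d (T : measurableType d) {R : realType} (f g : T -> R) :
  measurable_fun setT f -> measurable_fun setT g -> measurable [set w | f w = g w].
Proof.
move=> mf mg; have := measurable_fun_eqr mf mg measurableT (Y := [set true]) I.
by rewrite setTI; congr measurable; apply/seteqP; split => z /= /eqP.
Qed.

Section model.
Context {R : realType} (Theta : set R) (P : R -> probability (R * R)%type R)
  (qq : R -> R * R -> R) (q : R * R -> R) (family : copula_family Theta P qq q)
  d (Omega : measurableType d) (Pr : R -> probability Omega R) (Z : nat -> Omega -> R * R)
  (obs : iid_observations Theta P Pr Z).

Lemma measurable_unit_square : measurable (@unit_square R).
Proof. exact: measurableX. Qed.

Lemma integrable_qq t : Theta t -> (P 0).-integrable setT (EFin \o qq t).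
Proof.
move=> /(qq_L2 family) h; apply/Lfun1_integrable; apply: Lfun_subset12 h.
exact: fin_num_measure.
Qed.

Lemma integrable_q : (P 0).-integrable setT (EFin \o q).
Proof.
apply/Lfun1_integrable; apply: Lfun_subset12 (q_L2 family).
exact: fin_num_measure.
Qed.

Lemma integrable_density t : Theta t ->
  (P 0).-integrable setT (EFin \o (fun z => 1 + t * qq t z)).
Proof.
move=> Tt; have i1 : (P 0).-integrable setT (EFin \o cst 1).
  exact/integrable_bfun/bfun_cst.
have := integrableD measurableT i1 (integrableZl measurableT t (integrable_qq Tt)).
by apply: eq_integrable => // z _ /=.
Qed.

Lemma dominated t : Theta t -> forall A, measurable A -> P 0 A = 0%E -> P t A = 0%E.
Proof.
move=> Tt A mA A0; rewrite (P_density family Tt mA); apply: null_set_integral => //.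
by apply: measurable_funTS; exact: measurable_int (integrable_density Tt).
Qed.

Lemma line1_null t c : Theta t -> P t [set z | z.1 = c] = 0%E.
Proof.
move=> Tt; have E : [set z : R * R | z.1 = c] = [set c] `*` setT.
  by apply/seteqP; split => -[x y] /=; [move=> ->|case].
have m : measurable ([set c] `*` [set: R]) by exact: measurableX.
rewrite E; apply: dominated => //; rewrite (P0_uniform family)// /unit_square -setXI.
rewrite product_measure1E//; try exact: measurableI.
apply/eqP; rewrite mule_eq0; apply/orP; left; rewrite eq_le measure_ge0 andbT.
rewrite -(lebesgue_measure_set1 c).
by apply: le_measure; rewrite ?inE//; exact: measurableI.
Qed.

Lemma line2_null t c : Theta t -> P t [set z | z.2 = c] = 0%E.
Proof.
move=> Tt; have E : [set z : R * R | z.2 = c] = setT `*` [set c].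
  by apply/seteqP; split => -[x y] /=; [move=> ->|case].
have m : measurable ([set: R] `*` [set c]) by exact: measurableX.
rewrite E; apply: dominated => //; rewrite (P0_uniform family)// /unit_square -setXI.
rewrite product_measure1E//; try exact: measurableI.
apply/eqP; rewrite mule_eq0; apply/orP; right; rewrite eq_le measure_ge0 andbT.
rewrite -(lebesgue_measure_set1 c).
by apply: le_measure; rewrite ?inE//; exact: measurableI.
Qed.

Section fixed_parameter.
Variables (t : R) (Tt : Theta t).

Let mZ := Z_measurable obs.
Let indep := Z_independent obs Tt.
Let law := Z_law obs Tt.

Lemma pair_null (X : set ((R * R) * (R * R))) i j : i != j -> measurable X ->
  (forall z, P t (xsection X z) = 0%E) -> Pr t [set w | X (Z i w, Z j w)] = 0%E.
Proof.
move=> ij mX X0.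
(* The pair i, j is padded by two larger indices so that the law of four observations applies. *)
pose k (a : 'I_4) : nat := nth 0%N [:: i; j; (i + j).+1; (i + j).+2] a.
have kinj : injective k.
  move=> a b; rewrite /k => /eqP ab; apply: val_inj; move: ab.
  rewrite nth_uniq ?ltn_ord//; first by move=> /eqP.
  by rewrite /= !inE !negb_or ij /=; lia.
have mXT : measurable (X `*` [set: (R * R) * (R * R)]) by exact: measurableX.
have := quad_law mZ indep law kinj mXT.
rewrite (_ : quad Z k @^-1` _ = [set w | X (Z i w, Z j w)]); last first.
  by apply/seteqP; split => w; rewrite /quad /k /= !inordK//=; tauto.
move=> ->; rewrite /law4 prodPE//.
rewrite (_ : prodP (P t) (P t) X = 0%E) ?mul0e//.
rewrite /prodP /= /prod_prob /= /product_measure1.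
by apply: integral0_eq => z _; exact: X0.
Qed.

Lemma tie1_null i j : i != j -> Pr t [set w | (Z i w).1 = (Z j w).1] = 0%E.
Proof.
move=> ij; have := @pair_null [set z | z.1.1 = z.2.1] i j ij; apply.
  by apply: measurable_eq_set; exact: measurableT_comp.
move=> z; rewrite -(line1_null z.1 Tt); congr (P t _).
by apply/seteqP; split => z'; rewrite /xsection/= inE/=.
Qed.

Lemma tie2_null i j : i != j -> Pr t [set w | (Z i w).2 = (Z j w).2] = 0%E.
Proof.
move=> ij; have := @pair_null [set z | z.1.2 = z.2.2] i j ij; apply.
  by apply: measurable_eq_set; exact: measurableT_comp.
move=> z; rewrite -(line2_null z.2 Tt); congr (P t _).
by apply/seteqP; split => z'; rewrite /xsection/= inE/=.
Qed.

Definition ties n : set Omega := [set w | ~ no_ties (@sample R _ _ Z n w)].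

Lemma measurable_ties n : measurable (ties n).
Proof.
have := @measurable_sample_perm _ _ R n (fun k w => Z k w) _ _ (fun z => isSome (sample_perm z))
  (fun k => mZ k) _.
move=> /(_ (fun z z' e => congr1 isSome e) measurableT [set false] I).
rewrite setTI; congr measurable; apply/seteqP; split => w; rewrite /ties /=.
  move=> + [i1 i2]; have [Q [V [e _ _]]] := sample_permP i1 i2.
  by rewrite /sample in e *; rewrite e.
by move=> /sample_permN; rewrite /sample => ->.
Qed.

Lemma ties_null n : Pr t (ties n) = 0%E.
Proof.
apply: measure_negligible; first exact: measurable_ties.
pose E i j := if i == j then set0 else
  [set w | (Z i w).1 = (Z j w).1] `|` [set w | (Z i w).2 = (Z j w).2].
apply: (@negligibleS _ _ _ _ (\bigcup_i \bigcup_j E i j)).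
  move=> w nt; apply: contrapT => H; apply: nt; split => i j ij; apply: val_inj;
    apply/eqP; apply: contraPT isT => nij _; apply: H; exists (val i) => //;
    exists (val j) => //; rewrite /E (negbTE nij); [left|right]; exact: ij.
apply: negligible_bigcup => i; apply: negligible_bigcup => j; rewrite /E.
case: eqVneq => ij; first exact: negligible_set0.
have me (f : R * R -> R) : measurable_fun setT f ->
    measurable [set w | f (Z i w) = f (Z j w)].
  by move=> mf; apply: measurable_eq_set; exact: measurableT_comp.
apply: negligibleU; apply/negligibleP.
- exact: me.
- exact: tie1_null.
- exact: me.
- exact: tie2_null.
Qed.

Lemma measurable_T_n A n : measurable_fun setT (T_n Z A n).
Proof. exact: (measurable_T_stat A (Y := fun k w => Z k w)). Qed.

Lemma measurable_V_n A n : measurable_fun setT (V_n Z A n).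
Proof. by have [] := bfun_V_n mZ A n. Qed.

Lemma V_n_chebyshev A n (k : R) : (0 < n)%N -> 0 < k ->
  (Pr t [set w | (k <= `|V_n Z A n w - b_fun Pr Z A t|)%R] <= (448 / n%:R / k ^+ 2)%:E)%E.
Proof.
move=> n0 k0; set E := [set w | _].
have bE : b_fun Pr Z A t = mean4 (P t) A by exact: b_fun_mean4.
have mE : measurable E.
  rewrite -[X in measurable X]setTI; apply: measurable_fun_le => //.
  by apply: measurableT_comp => //; apply: measurable_funB => //; exact: measurable_V_n.
have bV : bfun (fun w => V_n Z A n w - b_fun Pr Z A t).
  by apply: bfunB; [exact: bfun_V_n|exact: bfun_cst].
have bV2 : bfun (fun w => (V_n Z A n w - b_fun Pr Z A t) ^+ 2).
  by under eq_fun do rewrite expr2; exact: bfunM.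
have pE : Pr t E = (\int[Pr t]_w \1_E w)%:E.
  rewrite /Rintegral fineK; first by rewrite integral_indic// setIT.
  by rewrite integral_indic// setIT fin_num_measure.
rewrite pE lee_fin ler_pdivlMr ?exprn_gt0// mulrC.
rewrite -RintegralZl//; last exact/integrable_bfun/bfun_indic.
apply: (@le_trans _ _ (\int[Pr t]_w ((V_n Z A n w - b_fun Pr Z A t) ^+ 2))).
  apply: le_Rintegral => //.
  - by apply: integrable_bfun; apply: bfunM; [exact: bfun_cst|exact: bfun_indic].
  - exact: integrable_bfun.
  - move=> w _; rewrite indicE; case: (boolP (w \in E)) => [/[!inE] wE|_].
      by rewrite mulr1 -[leRHS]real_normK ?num_real// ler_pXn2r// ?nnegrE ltW.
    by rewrite mulr0 sqr_ge0.
rewrite bE; exact: V_n_second_moment.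
Qed.

(* n^(-1/4) dominates the standard deviation of V_n, of order n^(-1/2), and 24/n
   bounds |T_n - V_n| in the absence of ties. *)
Definition deviation (n : nat) : R := Num.sqrt (Num.sqrt n%:R^-1) + 24 / n%:R.

Lemma deviation_cvg0 : deviation n @[n --> \oo] --> (0 : R).
Proof.
have c : (n%:R^-1 : R) @[n --> \oo] --> (0 : R).
  by have := @cvg_harmonic R; rewrite /harmonic -(@cvg_shiftS R (fun n => n%:R^-1)).
rewrite -(addr0 (0 : R)) /deviation; apply: cvgD.
  rewrite -[X in _ --> X](_ : Num.sqrt (Num.sqrt 0) = 0 :> R); last by rewrite !sqrtr0.
  by apply: continuous_cvg; [exact: sqrt_continuous|apply: continuous_cvg => //; exact: sqrt_continuous].
by rewrite -(mulr0 24); apply: cvgM => //; exact: cvg_cst.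
Qed.

Lemma T_n_lln A (e : R) : 0 < e -> \forall n \near \oo,
  (Pr t [set w | (deviation n <= `|T_n Z A n w - b_fun Pr Z A t|)%R] <= e%:E)%E.
Proof.
move=> e0; near=> n.
have n4 : (4 <= n)%N by near: n; exact: nbhs_infty_ge.
have n0 : (0 : R) < n%:R by rewrite ltr0n (leq_trans _ n4).
pose k : R := Num.sqrt (Num.sqrt n%:R^-1).
have k0 : 0 < k by rewrite !sqrtr_gt0 invr_gt0.
pose E := [set w | (k <= `|V_n Z A n w - b_fun Pr Z A t|)%R].
have mE : measurable E.
  rewrite -[X in measurable X]setTI; apply: measurable_fun_le => //.
  by apply: measurableT_comp => //; apply: measurable_funB => //; exact: measurable_V_n.
apply: (@le_trans _ _ (Pr t (E `|` ties n))).
  apply: le_measure; rewrite ?inE.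
  - rewrite -[X in measurable X]setTI; apply: measurable_fun_le => //.
    by apply: measurableT_comp => //; apply: measurable_funB => //; exact: measurable_T_n.
  - by apply: measurableU => //; exact: measurable_ties.
  - move=> w /= dev; have [nt|nt] := pselect (no_ties (@sample R _ _ Z n w)); last by right.
    left; rewrite /E/=; have := vstat_T_stat A n4 nt.
    rewrite -/(V_n Z A n w) -/(T_n Z A n w).
    move: dev; rewrite /deviation -/k.
    set v := V_n _ _ _ _; set T := T_n _ _ _ _; set b := b_fun _ _ _ _ => h1 h2.
    have : `|T - b| <= `|v - b| + `|v - T|.
      by rewrite (_ : T - b = (v - b) - (v - T)) ?ler_normB//; ring.
    lra.
apply: (le_trans (measureU2 _ mE (measurable_ties n))).
rewrite [X in (_ + X)%E]ties_null adde0.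
apply: le_trans (V_n_chebyshev A (leq_trans _ n4) k0) _ => //.
rewrite lee_fin /k sqr_sqrtr ?sqrtr_ge0//.
(* Since k^2 = n^(-1/2), the Chebyshev bound 448/(n k^2) is 448 n^(-1/2). *)
have key (x v : R) : 0 < v -> v ^+ 2 = x -> 448 * x / v = 448 * v.
  by move=> v0 <-; field; rewrite gt_eqF.
rewrite (key _ _ _ (sqr_sqrtr _)) ?sqrtr_gt0 ?invr_gt0 ?invr_ge0 ?ler0n//.
have : Num.sqrt n%:R^-1 <= e / 448.
  have c0 : (0 : R) < 448 by rewrite ltr0n.
  have e1 : 0 < e / 448 := divr_gt0 e0 c0.
  rewrite -(ger0_norm (ltW e1)) -sqrtr_sqr; apply: ler_wsqrtr.
  have e2 : 0 < ((e / 448) ^+ 2)^-1 by rewrite invr_gt0 exprn_gt0.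
  rewrite -[leRHS]invrK lef_pV2 ?posrE//.
  near: n; exact: nbhs_infty_ger.
lra.
Unshelve. all: by end_near. Qed.

End fixed_parameter.

End model.

(** * Integrals over the unit interval *)

Section unit_interval.
Context {R : realType}.

Let U0 : probability (measurableTypeR R) R := uniform_prob (@ltr01 R).

Let measurable_idU : measurable_fun setT (idfun : measurableTypeR R -> R).
Proof. by move=> _ A mA; rewrite setTI. Qed.

(** The identity transports the library's uniform law from [measurableTypeR R] to [R] with its
    default measurable structure, the one used in [R * R]. *)
Definition uniform01 : set R -> \bar R := pushforward U0 (idfun : measurableTypeR R -> R).

Let uniform01_0 : uniform01 set0 = 0%E.
Proof. exact: measure0. Qed.

Let uniform01_ge0 A : (0 <= uniform01 A)%E.
Proof. exact: measure_ge0. Qed.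

Let uniform01_sigma_additive : semi_sigma_additive uniform01.
Proof. exact: (@measure_semi_sigma_additive _ _ _ (image_measure U0 measurable_idU)). Qed.

HB.instance Definition _ := isMeasure.Build _ _ _ uniform01
  uniform01_0 uniform01_ge0 uniform01_sigma_additive.

Let uniform01_setT : uniform01 setT = 1%E.
Proof. exact: (probability_setT U0). Qed.

HB.instance Definition _ := Measure_isProbability.Build _ _ _ uniform01 uniform01_setT.

Definition U : probability R R := uniform01.

Lemma U_measure (A : set R) : measurable A -> U A = lebesgue_measure (A `&` `[0, 1]%classic).
Proof.
move=> mA.
have -> : U A = (\int[U0]_x (\1_A x)%:E)%E by rewrite integral_indic// setIT.
rewrite /U0 integral_uniform//.
- by rewrite subr0 invr1 mul1e integral_indic// setIC.
- by apply/measurable_EFinP; exact: measurable_indic.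
Qed.

Lemma Rintegral_U (g : R -> R) : bfun g ->
  \int[U]_x g x = \int[lebesgue_measure]_(x in `[0, 1]) g x.
Proof.
move=> bg; rewrite -(@Rintegral_image _ _ _ _ _ U0 U idfun g measurable_idU)//.
have [mg _] := bg.
have mg' : measurable_fun [set: measurableTypeR R] (EFin \o g).
  by apply/measurable_EFinP => _ A mA; exact: mg.
congr fine; rewrite integralE [RHS]integralE; congr (_ - _)%E.
  rewrite /U0 integral_uniform//; first by rewrite subr0 invr1 mul1e.
  exact: measurable_funepos.
rewrite /U0 integral_uniform//; first by rewrite subr0 invr1 mul1e.
exact: measurable_funeneg.
Qed.

(** The integrand may be cut off by an indicator: it agrees with the continuous f on [a, b] and
    vanishes on the rest of the unit interval. *)
Lemma U_ftc (g f F : R -> R) a b : bfun g -> 0 <= a -> a <= b -> b <= 1 ->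
  (forall s, a <= s <= b -> g s = f s) ->
  (forall s, 0 <= s <= 1 -> ~~ (a <= s <= b) -> g s = 0) ->
  continuous f -> (forall x : R, is_derive x 1 F (f x)) ->
  \int[U]_s g s = F b - F a.
Proof.
move=> bg a0 ab b1 gf g0 cf dF.
rewrite Rintegral_U//.
have -> : \int[lebesgue_measure]_(x in `[0, 1]) g x =
    \int[lebesgue_measure]_(x in `[a, b]) f x.
  rewrite Rintegral_mkcond [RHS]Rintegral_mkcond; congr Rintegral; apply: funext => x.
  rewrite !patchE !mem_setE !in_itv/=.
  case: ifPn => x01; case: ifPn => xab//.
  - exact: gf.
  - exact: g0.
  - exfalso; move/negP: x01; apply; move/andP: xab => [ax xb].
    by rewrite (le_trans a0 ax) (le_trans xb b1).
move: ab; rewrite le_eqVlt => /predU1P[->|ab].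
  by rewrite set_itv1 Rintegral_set1 subrr.
have dF1 x : derivable F x 1 by have := dF x.
have cF : continuous F.
  by move=> x; apply: differentiable_continuous; exact/derivable1_diffP.
rewrite /Rintegral (continuous_FTC2 ab (F := F))//.
- exact: continuous_subspaceT.
- split.
  + by move=> x _.
  + exact: cvg_at_right_filter (cF a).
  + exact: cvg_at_left_filter (cF b).
- by move=> x _; rewrite derive1E; apply: derive_val.
Qed.

Definition le01 (x y : R) : R := ((x <= y)%R)%:R.

(** A version of the coordinate that is bounded on the whole line, so that polynomials in it stay in
    [bfun]. *)
Definition clamp (x : R) : R := Num.max 0 (Num.min x 1).

Lemma clampE x : 0 <= x <= 1 -> clamp x = x.
Proof. by move=> /andP[x0 x1]; rewrite /clamp min_l// max_r. Qed.

Lemma clamp01 x : 0 <= clamp x <= 1.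
Proof.
by rewrite /clamp le_max lexx/= ge_max ler01/= ge_min lexx orbT.
Qed.

Lemma bfun_clamp : bfun clamp.
Proof.
split; first by apply: measurable_maxr => //; apply: measurable_minr.
by exists 1 => x; have /andP[c0 c1] := clamp01 x; rewrite ger0_norm.
Qed.

Lemma bfun_bool d (T : measurableType d) (f : T -> bool) : measurable_fun setT f ->
  bfun (fun x => (f x)%:R : R).
Proof.
move=> mf; have -> : (fun x => (f x)%:R : R) = \1_(f @^-1` [set true]).
  apply: funext => x; rewrite indicE; congr (nat_of_bool _)%:R.
  by apply/idP/idP => [fx|/[!inE]//]; rewrite inE.
by apply: bfun_indic; have := mf measurableT [set true] I; rewrite setTI.
Qed.

Lemma bfun_le01 d (T : measurableType d) (f g : T -> R) : measurable_fun setT f ->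
  measurable_fun setT g -> bfun (fun x => le01 (f x) (g x)).
Proof. by move=> mf mg; apply: bfun_bool; exact: measurable_fun_ler. Qed.

Lemma bfun_lt01 d (T : measurableType d) (f g : T -> R) : measurable_fun setT f ->
  measurable_fun setT g -> bfun (fun x => lt01 (f x) (g x)).
Proof. by move=> mf mg; apply: bfun_bool; exact: measurable_fun_ltr. Qed.

Lemma continuous_idR : continuous (fun x : R => x).
Proof. by move=> x; exact: cvg_id. Qed.

Lemma U_set1 c : U [set c] = 0%E.
Proof.
rewrite U_measure//; apply/eqP; rewrite eq_le measure_ge0 andbT.
rewrite -(lebesgue_measure_set1 c); apply: le_measure; rewrite ?inE//.
exact: measurableI.
Qed.

Lemma U_ae_neq c (p : R -> Prop) : (forall s, s != c -> p s) -> {ae U, forall s, p s}.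
Proof.
move=> H; apply: (negligibleS _ (A := [set c])).
  by move=> s /=; apply: contra_notP => /eqP; exact: H.
by apply/negligibleP => //; exact: U_set1.
Qed.

Section elementary.
Variable c : R.
Hypothesis c01 : 0 <= c <= 1.
Let c0 : 0 <= c. Proof. by case/andP: c01. Qed.
Let c1 : c <= 1. Proof. by case/andP: c01. Qed.

Lemma int_le_l : \int[U]_s le01 c s = 1 - c.
Proof.
apply: (U_ftc (f := cst 1) (F := id) (a := c) (b := 1)) => //.
- exact: bfun_le01 (measurable_cst c) (@measurable_id _ _ _).
- by move=> s /andP[cs _]; rewrite /le01 cs.
- by move=> s /andP[_ s1]; rewrite s1 andbT /le01 => /negbTE ->.
- by move=> x; exact: cvg_cst.
Qed.

Lemma int_le_r : \int[U]_s le01 s c = c.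
Proof.
rewrite -[RHS]subr0; apply: (U_ftc (f := cst 1) (F := id) (a := 0) (b := c)) => //.
- exact: bfun_le01 (@measurable_id _ _ _) (measurable_cst c).
- by move=> s /andP[_ cs]; rewrite /le01 cs.
- by move=> s /andP[s0 _]; rewrite s0 /= /le01 => /negbTE ->.
- by move=> x; exact: cvg_cst.
Qed.

Lemma int_lt_l : \int[U]_s lt01 c s = 1 - c.
Proof.
rewrite -int_le_l; apply: ae_eq_Rintegral.
- by have [] := bfun_lt01 (measurable_cst c) (@measurable_id _ _ _).
- by have [] := bfun_le01 (measurable_cst c) (@measurable_id _ _ _).
have H : {ae U, forall s, lt01 c s = le01 c s}.
  by apply: (U_ae_neq (c := c)) => s sc; rewrite /lt01 /le01 lt_def sc.
by apply: filterS H.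
Qed.

Lemma int_lt_r : \int[U]_s lt01 s c = c.
Proof.
rewrite -[RHS]int_le_r; apply: ae_eq_Rintegral.
- by have [] := bfun_lt01 (@measurable_id _ _ _) (measurable_cst c).
- by have [] := bfun_le01 (@measurable_id _ _ _) (measurable_cst c).
have H : {ae U, forall s, lt01 s c = le01 s c}.
  by apply: (U_ae_neq (c := c)) => s sc; rewrite /lt01 /le01 lt_def eq_sym sc.
by apply: filterS H.
Qed.

Lemma int_le_clamp : \int[U]_s (le01 c s * clamp s) = (1 - c ^+ 2) / 2.
Proof.
have -> : (1 - c ^+ 2) / 2 = 1 ^+ 2 / 2 - c ^+ 2 / 2 by rewrite expr1n; lra.
apply: (U_ftc (f := id) (F := fun x => x ^+ 2 / 2) (a := c) (b := 1)) => //.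
- exact: bfunM (bfun_le01 (measurable_cst c) (@measurable_id _ _ _)) bfun_clamp.
- move=> s /andP[cs s1]; rewrite /le01 cs mul1r clampE// s1 andbT.
  exact: le_trans cs.
- by move=> s /andP[_ s1]; rewrite s1 andbT /le01 => /negbTE ->; rewrite mul0r.
- exact: continuous_idR.
- by move=> x; apply: is_derive_eq; rewrite /GRing.scale /=; field.
Qed.

Lemma int_clamp2 : \int[U]_s (clamp s * clamp s) = 3^-1.
Proof.
have -> : 3^-1 = 1 ^+ 3 / 3 - 0 ^+ 3 / 3 :> R by rewrite expr1n expr0n/=; lra.
apply: (U_ftc (f := fun x => x ^+ 2) (F := fun x => x ^+ 3 / 3) (a := 0) (b := 1)) => //.
- exact: bfunM bfun_clamp bfun_clamp.
- by move=> s s01; rewrite clampE.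
- by move=> s -> .
- by move=> x; exact: exprn_continuous.
- by move=> x; apply: is_derive_eq; rewrite /GRing.scale /=; field.
Qed.

Lemma int_clamp : \int[U]_s clamp s = 2^-1.
Proof.
have -> : 2^-1 = 1 ^+ 2 / 2 - 0 ^+ 2 / 2 :> R by rewrite expr1n expr0n/=; lra.
apply: (U_ftc (f := id) (F := fun x => x ^+ 2 / 2) (a := 0) (b := 1)) => //.
- exact: bfun_clamp.
- by move=> s s01; rewrite clampE.
- by move=> s -> .
- exact: continuous_idR.
- by move=> x; apply: is_derive_eq; rewrite /GRing.scale /=; field.
Qed.

Let w : R := 2 * pi.
Let w0 : w != 0. Proof. by rewrite /w mulf_neq0 ?gt_eqF ?pi_gt0. Qed.

Lemma bfun_cosw : bfun (fun x : R => cos (w * x)).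
Proof.
split; first by apply: measurableT_comp; [exact: (continuous_measurable_fun (@continuous_cos R))|exact: mulrl_measurable].
by exists 1 => x; rewrite ler_norml cos_geN1 cos_le1.
Qed.

Lemma bfun_sinw : bfun (fun x : R => sin (w * x)).
Proof.
split; first by apply: measurableT_comp; [exact: (continuous_measurable_fun (@continuous_sin R))|exact: mulrl_measurable].
by exists 1 => x; rewrite ler_norml sin_geN1 sin_le1.
Qed.

Let cos_w : cos w = 1. Proof. by rewrite /w mulrC mulr_natr cos2pi. Qed.
Let sin_w : sin w = 0. Proof. by rewrite /w mulrC mulr_natr sin2pi. Qed.

Lemma int_le_cos : \int[U]_s (le01 s c * cos (w * s)) = sin (w * c) / w.
Proof.
rewrite -[RHS]subr0 -[X in _ - X](_ : sin (w * 0) / w = 0); last by rewrite mulr0 sin0 mul0r.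
apply: (U_ftc (f := fun x => cos (w * x)) (F := fun x => sin (w * x) / w) (a := 0) (b := c)) => //.
- exact: bfunM (bfun_le01 (@measurable_id _ _ _) (measurable_cst c)) bfun_cosw.
- by move=> s /andP[_ sc]; rewrite /le01 sc mul1r.
- by move=> s /andP[s0 _]; rewrite s0 /= /le01 => /negbTE ->; rewrite mul0r.
- move=> x; apply: continuous_comp; last exact: continuous_cos.
  by apply: cvgM; [exact: cvg_cst|exact: cvg_id].
- move=> x; apply: is_derive_eq; rewrite /GRing.scale /=; field.
  exact: w0.
Qed.

Lemma int_le_sin : \int[U]_s (le01 c s * sin (w * s)) = (cos (w * c) - 1) / w.
Proof.
have -> : (cos (w * c) - 1) / w = - cos (w * 1) / w - (- cos (w * c) / w).
  by rewrite mulr1 cos_w; field; exact: w0.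
apply: (U_ftc (f := fun x => sin (w * x)) (F := fun x => - cos (w * x) / w) (a := c) (b := 1)) => //.
- exact: bfunM (bfun_le01 (measurable_cst c) (@measurable_id _ _ _)) bfun_sinw.
- by move=> s /andP[cs _]; rewrite /le01 cs mul1r.
- by move=> s /andP[_ s1]; rewrite s1 andbT /le01 => /negbTE ->; rewrite mul0r.
- move=> x; apply: continuous_comp; last exact: continuous_sin.
  by apply: cvgM; [exact: cvg_cst|exact: cvg_id].
- move=> x; apply: is_derive_eq; rewrite /GRing.scale /=; field.
  exact: w0.
Qed.

Lemma int_clamp_sin : \int[U]_s (clamp s * sin (w * s)) = - w^-1.
Proof.
pose F (x : R) := sin (w * x) / w ^+ 2 - x * cos (w * x) / w.
have -> : - w^-1 = F 1 - F 0.
  by rewrite /F !mulr1 !mulr0 sin0 cos_w sin_w; field; exact: w0.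
apply: (U_ftc (f := fun x => x * sin (w * x)) (F := F) (a := 0) (b := 1)) => //.
- exact: bfunM bfun_clamp bfun_sinw.
- by move=> s s01; rewrite clampE.
- by move=> s -> .
- move=> x; apply: cvgM; first exact: cvg_id.
  apply: continuous_comp; last exact: continuous_sin.
  by apply: cvgM; [exact: cvg_cst|exact: cvg_id].
- move=> x; apply: is_derive_eq; rewrite /GRing.scale /=; field.
  exact: w0.
Qed.

Lemma int_clamp_cos : \int[U]_s (clamp s * cos (w * s)) = 0.
Proof.
pose F (x : R) := cos (w * x) / w ^+ 2 + x * sin (w * x) / w.
have -> : 0 = F 1 - F 0.
  by rewrite /F !mulr1 !mulr0 cos0 cos_w sin_w; field; exact: w0.
apply: (U_ftc (f := fun x => x * cos (w * x)) (F := F) (a := 0) (b := 1)) => //.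
- exact: bfunM bfun_clamp bfun_cosw.
- by move=> s s01; rewrite clampE.
- by move=> s -> .
- move=> x; apply: cvgM; first exact: cvg_id.
  apply: continuous_comp; last exact: continuous_cos.
  by apply: cvgM; [exact: cvg_cst|exact: cvg_id].
- move=> x; apply: is_derive_eq; rewrite /GRing.scale /=; field.
  exact: w0.
Qed.

Lemma int_cos : \int[U]_s cos (w * s) = 0.
Proof.
have -> : 0 = sin (w * 1) / w - sin (w * 0) / w.
  by rewrite mulr1 mulr0 sin0 sin_w; field; exact: w0.
apply: (U_ftc (f := fun x => cos (w * x)) (F := fun x => sin (w * x) / w) (a := 0) (b := 1)) => //.
- exact: bfun_cosw.
- by move=> s -> .
- move=> x; apply: continuous_comp; last exact: continuous_cos.
  by apply: cvgM; [exact: cvg_cst|exact: cvg_id].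
- move=> x; apply: is_derive_eq; rewrite /GRing.scale /=; field.
  exact: w0.
Qed.

End elementary.

End unit_interval.

(** * One-dimensional kernels *)

(** A list of coefficients and functions lets an explicit integrand be integrated termwise by a
    single rewrite, after [ring] or [field] has identified it with the sum. *)
Lemma Rintegral_lin d (T : measurableType d) {R : realType} (mu : probability T R)
    (l : seq (R * (T -> R))) : foldr (fun p Q => bfun p.2 /\ Q) True l ->
  \int[mu]_x (\sum_(p <- l) p.1 * p.2 x) = \sum_(p <- l) p.1 * \int[mu]_x p.2 x.
Proof.
elim: l => [|[c f] l ih] /=.
  by move=> _; rewrite big_nil -[RHS](Rintegral_cst1 mu); apply: eq_Rintegral => x _; rewrite big_nil.
move=> [bf bl]; rewrite big_cons -ih// /=.
have bs : bfun (fun x => \sum_(p <- l) p.1 * p.2 x).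
  elim: l bl {ih} => [|[c' f'] l ih] /=; first by move=> _; under eq_fun do rewrite big_nil; exact: bfun_cst.
  move=> [bf' /ih bl]; under eq_fun do rewrite big_cons.
  by apply: bfunD => //; apply: bfunM => //; exact: bfun_cst.
rewrite -RintegralZl//; last exact: integrable_bfun.
rewrite -RintegralD//; last 2 first.
- by apply: integrable_bfun; apply: bfunM => //; exact: bfun_cst.
- exact: integrable_bfun.
by apply: eq_Rintegral => x _; rewrite big_cons.
Qed.

Lemma ae2_eq_Rintegral d1 d2 (T1 : measurableType d1) (T2 : measurableType d2) {R : realType}
    (m1 : probability T1 R) (m2 : probability T2 R) (f g : T1 * T2 -> R) :
  bfun f -> bfun g -> {ae m1, forall x, {ae m2, forall y, f (x, y) = g (x, y)}} ->
  \int[m1]_x \int[m2]_y f (x, y) = \int[m1]_x \int[m2]_y g (x, y).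
Proof.
move=> bf bg fg.
have i1 : m2.-integrable setT (EFin \o cst 1) by exact/integrable_bfun/bfun_cst.
have mI (h : T1 * T2 -> R) : bfun h -> measurable_fun setT (fun x => \int[m2]_y h (x, y)).
  move=> bh; have [mh _] := bfun_partial_integral m1 i1 bh.
  by move: mh; under eq_fun do under eq_Rintegral do rewrite mul1r.
apply: ae_eq_Rintegral; [exact: mI|exact: mI|].
apply: filterS fg => x fg _; apply: ae_eq_Rintegral.
- by have [] := bfun_section1 bf x.
- by have [] := bfun_section1 bg x.
- by apply: filterS fg.
Qed.

Section one_dimensional_kernels.
Context {R : realType}.
Implicit Types (k s x y : R).

(* For k = 0 this is the centred indicator of [x <= s]; the additional term for k = 1
   makes the Gram kernel [gker 1] a function of |x - y| only. *)
Definition psi k s x : R := le01 x s - clamp s - k * (2^-1 - clamp x).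

Definition gker k x y : R := \int[U]_s (psi k s x * psi k s y).

Lemma bfun_psi d (T : measurableType d) k (f g : T -> R) : measurable_fun setT f ->
  measurable_fun setT g -> bfun (fun z => psi k (f z) (g z)).
Proof.
move=> mf mg; apply: bfunB.
  by apply: bfunB; [exact: bfun_le01|exact: (bfun_comp mf (@bfun_clamp R))].
apply: bfunM; first exact: bfun_cst.
by apply: bfunB; [exact: bfun_cst|exact: (bfun_comp mg (@bfun_clamp R))].
Qed.

Lemma le01M x y s : le01 x s * le01 y s = le01 (Num.max x y) s.
Proof. by rewrite /le01 ge_max -natrM mulnb. Qed.

Lemma max01 x y : 0 <= x <= 1 -> 0 <= y <= 1 -> 0 <= Num.max x y <= 1.
Proof. by rewrite /Num.max; case: ifP. Qed.

(** For k = 0 this is the Cramer-von Mises kernel. For k = 1 it equals 1/12 - |x - y|/2 + (x -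
    y)^2/2, half the second Bernoulli polynomial at |x - y|, which is Watson's kernel. *)
Lemma gkerE k x y : 0 <= x <= 1 -> 0 <= y <= 1 ->
  gker k x y = 3^-1 - Num.max x y + (x ^+ 2 + y ^+ 2) / 2
    - (2 * k - k ^+ 2) * ((2^-1 - x) * (2^-1 - y)).
Proof.
move=> x01 y01; rewrite /gker.
pose mx := 2^-1 - x; pose my := 2^-1 - y.
have bl c : bfun (le01 c : R -> R).
  exact: (bfun_le01 (measurable_cst c) (@measurable_id _ _ _)).
have bc := @bfun_clamp R.
pose l := [:: (1, fun s => le01 (Num.max x y) s); (- 1, fun s => le01 x s * clamp s);
  (- 1, fun s => le01 y s * clamp s); (1, fun s => clamp s * clamp s);
  (- (k * my), fun s => le01 x s); (- (k * mx), fun s => le01 y s);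
  (k * my + k * mx, fun s => clamp s); (k ^+ 2 * mx * my, fun s => 1)] : seq (R * (R -> R)).
have -> : (fun s => psi k s x * psi k s y) = (fun s => \sum_(p <- l) p.1 * p.2 s).
  apply: funext => s; rewrite /l !big_cons big_nil/= -le01M /psi (clampE x01) (clampE y01).
  rewrite /mx /my; ring.
rewrite Rintegral_lin; last first.
  rewrite /l /=; split; first exact: bl.
  split; first exact: (bfunM (bl _) bc).
  split; first exact: (bfunM (bl _) bc).
  split; first exact: (bfunM bc bc).
  split; first exact: bl.
  split; first exact: bl.
  split; first exact: bc.
  by split => //; exact: bfun_cst.
rewrite /l !big_cons big_nil/= int_le_l ?max01// !int_le_clamp// int_clamp2 !int_le_l//.
by rewrite int_clamp Rintegral_cst1 /mx /my; field.
Qed.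

Lemma gker_sym k x y : gker k x y = gker k y x.
Proof. by apply: eq_Rintegral => s _; rewrite mulrC. Qed.

Definition J2 (f : R -> R -> R) : R := \int[U]_x \int[U]_y f x y.

Lemma bfun_lowR d (T : measurableType d) (f1 f2 f3 f4 : T -> R) :
  measurable_fun setT f1 -> measurable_fun setT f2 ->
  measurable_fun setT f3 -> measurable_fun setT f4 ->
  bfun (fun z => lowR (f1 z) (f2 z) (f3 z) (f4 z)).
Proof.
by move=> m1 m2 m3 m4; apply: bfunD; repeat apply: bfunM; exact: bfun_lt01.
Qed.

Lemma bfun_altR d (T : measurableType d) (f1 f2 f3 f4 : T -> R) :
  measurable_fun setT f1 -> measurable_fun setT f2 ->
  measurable_fun setT f3 -> measurable_fun setT f4 ->
  bfun (fun z => altR (f1 z) (f2 z) (f3 z) (f4 z)).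
Proof.
by move=> m1 m2 m3 m4; repeat apply: bfunD; repeat apply: bfunM; exact: bfun_lt01.
Qed.

Lemma bfun_sgnR d (T : measurableType d) (f1 f2 f3 f4 : T -> R) :
  measurable_fun setT f1 -> measurable_fun setT f2 ->
  measurable_fun setT f3 -> measurable_fun setT f4 ->
  bfun (fun z => sgnR (f1 z) (f2 z) (f3 z) (f4 z)).
Proof.
move=> m1 m2 m3 m4; repeat apply: bfunM; apply: bfunB; try exact: bfun_cst;
  apply: bfunM; try exact: bfun_cst; exact: bfun_lt01.
Qed.

(** Of the three pairings of four distinct numbers exactly one separates low from high, one
    alternates, and one is nested. *)
Lemma low_alt_sum x1 x2 x3 x4 : x1 != x2 -> x3 != x1 -> x3 != x2 ->
    x4 != x1 -> x4 != x2 -> x4 != x3 ->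
  lowR x1 x2 x3 x4 + lowR x1 x3 x2 x4 + lowR x1 x4 x2 x3 = 1 /\
  altR x1 x2 x3 x4 + altR x1 x3 x2 x4 + altR x1 x4 x2 x3 = 1.
Proof.
move=> n12 n31 n32 n41 n42 n43; rewrite /lowR /altR /chainR /lt01.
case: (ltgtP x1 x2) n12 => // h12 _; case: (ltgtP x3 x1) n31 => // h31 _;
case: (ltgtP x3 x2) n32 => // h32 _;
try (by move: (lt_trans (lt_trans h12 h32) h31); rewrite ltxx);
try (by move: (lt_trans (lt_trans h12 h31) h32); rewrite ltxx);
case: (ltgtP x4 x1) n41 => // h41 _; case: (ltgtP x4 x2) n42 => // h42 _;
try (by move: (lt_trans (lt_trans h12 h42) h41); rewrite ltxx);
try (by move: (lt_trans (lt_trans h12 h41) h42); rewrite ltxx);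
case: (ltgtP x4 x3) n43 => // h43 _;
try (by move: (lt_trans (lt_trans h31 h41) h43); rewrite ltxx);
try (by move: (lt_trans (lt_trans h31 h43) h41); rewrite ltxx);
try (by move: (lt_trans (lt_trans h32 h42) h43); rewrite ltxx);
try (by move: (lt_trans (lt_trans h32 h43) h42); rewrite ltxx);
by rewrite /= ?(mulr0, mulr1, mul0r, addr0, add0r).
Qed.

Lemma sgn_swap x1 x2 x3 x4 : x4 != x3 -> sgnR x1 x2 x4 x3 = - sgnR x1 x2 x3 x4.
Proof.
move=> n43; rewrite /sgnR (_ : 1 - 2 * lt01 x3 x4 = - (1 - 2 * lt01 x4 x3)); first ring.
by rewrite /lt01; case: (ltgtP x4 x3) n43 => //= _ _; lra.
Qed.

Lemma alt_sym x1 x2 x3 x4 : altR x1 x2 x3 x4 = altR x2 x1 x3 x4.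
Proof. rewrite /altR; ring. Qed.

Lemma J2_swap (f : R -> R -> R) : bfun (fun z => f z.1 z.2) -> J2 f = J2 (fun x y => f y x).
Proof.
move=> bf.
have i1 : U.-integrable setT (EFin \o (cst 1 : R -> R)) by exact/integrable_bfun/bfun_cst.
have E (g : R -> R -> R) : \int[U]_x (1 * \int[U]_y (1 * g x y)) = J2 g.
  by apply: eq_Rintegral => x _; rewrite mul1r; apply: eq_Rintegral => y _; rewrite mul1r.
have := Rintegral_swap i1 i1 bf; rewrite /= E => ->.
exact: (E (fun x y => f y x)).
Qed.

Lemma J2D (f g : R -> R -> R) : bfun (fun z => f z.1 z.2) -> bfun (fun z => g z.1 z.2) ->
  J2 (fun x y => f x y + g x y) = J2 f + J2 g.
Proof.
move=> bf bg.
have i1 : U.-integrable setT (EFin \o (cst 1 : R -> R)) by exact/integrable_bfun/bfun_cst.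
have bI h : bfun (fun z : R * R => h z.1 z.2 : R) -> bfun (fun x => \int[U]_y h x y).
  move=> bh; have := bfun_partial_integral U i1 bh.
  by under eq_fun do under eq_Rintegral do rewrite mul1r.
rewrite /J2 -RintegralD//; last 2 first.
- exact/integrable_bfun/bI.
- exact/integrable_bfun/bI.
apply: eq_Rintegral => x _; rewrite RintegralD//.
- exact/integrable_bfun/(bfun_section1 bf x).
- exact/integrable_bfun/(bfun_section1 bg x).
Qed.

Lemma J2_prod (f g : R -> R) : bfun f -> bfun g ->
  J2 (fun x y => f x * g y) = (\int[U]_x f x) * \int[U]_y g y.
Proof. by move=> bf bg; rewrite /J2 Rintegral_prod_indep//; exact: integrable_bfun. Qed.

Lemma lt01M x y s : lt01 x s * lt01 y s = lt01 (Num.max x y) s.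
Proof. by rewrite /lt01 gt_max -natrM mulnb. Qed.

Lemma lt01m x y s : lt01 s x * lt01 s y = lt01 s (Num.min x y).
Proof. by rewrite /lt01 lt_min -natrM mulnb. Qed.

Lemma int_between (u v : R) : 0 <= u <= 1 -> 0 <= v <= 1 -> u < v ->
  \int[U]_s (lt01 u s * lt01 s v : R) = v - u.
Proof.
move=> u01 v01 uv.
have bu : bfun (lt01 u : R -> R) by exact: (bfun_lt01 (measurable_cst u) (@measurable_id _ _ _)).
have bv : bfun (le01^~ u : R -> R) by exact: (bfun_le01 (@measurable_id _ _ _) (measurable_cst u)).
have bv' : bfun (lt01^~ v : R -> R) by exact: (bfun_lt01 (@measurable_id _ _ _) (measurable_cst v)).
have -> : (fun s => lt01 u s * lt01 s v) = (fun s => lt01 s v - le01 s u).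
  apply: funext => s; rewrite /lt01 /le01.
  by case: (ltP s v) => sv; case: (ltP u s) => us /=; rewrite ?mul0r ?mulr0 ?mulr1; lra.
by rewrite RintegralB// ?int_lt_r ?int_le_r//; exact: integrable_bfun.
Qed.

Section values.
Variables (x1 x2 : R).
Hypotheses (h1 : 0 <= x1 <= 1) (h2 : 0 <= x2 <= 1) (n12 : x1 != x2).

Let mc (c : R) d (T : measurableType d) : measurable_fun [set: T] (fun=> c) := measurable_cst c.

(** Both further points must lie above the maximum or both below the minimum of x1, x2. *)
Lemma J2_low1 : J2 (lowR x1 x2) = 2 * gker 0 x1 x2 + 3^-1.
Proof.
have v01 := max01 h1 h2.
have u01 : 0 <= Num.min x1 x2 <= 1 by rewrite /Num.min; case: ifP.
have b1 c : bfun (lt01 c : R -> R) by exact: (bfun_lt01 (measurable_cst c) (@measurable_id _ _ _)).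
have b2 c : bfun (lt01^~ c : R -> R) by exact: (bfun_lt01 (@measurable_id _ _ _) (measurable_cst c)).
have -> : lowR x1 x2 = (fun x y => lt01 (Num.max x1 x2) x * lt01 (Num.max x1 x2) y +
    lt01 x (Num.min x1 x2) * lt01 y (Num.min x1 x2)).
  by apply: funext => x; apply: funext => y; rewrite -!lt01M -!lt01m /lowR; ring.
rewrite J2D; last 2 first.
- by apply: bfunM; exact: bfun_comp (b1 _).
- by apply: bfunM; exact: bfun_comp (b2 _).
rewrite !J2_prod// int_lt_l// int_lt_r// gkerE//.
by rewrite /Num.max /Num.min; case: ifP => _; field.
Qed.

Let bm (f : R -> R -> R -> R -> R) : (forall d (T : measurableType d) (f1 f2 f3 f4 : T -> R),
  measurable_fun setT f1 -> measurable_fun setT f2 ->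
  measurable_fun setT f3 -> measurable_fun setT f4 ->
  bfun (fun z => f (f1 z) (f2 z) (f3 z) (f4 z))) ->
  [/\ bfun (fun z : R * R => f x1 x2 z.1 z.2), bfun (fun z : R * R => f x1 z.1 x2 z.2)
    & bfun (fun z : R * R => f x1 z.2 x2 z.1)].
Proof. by move=> bf; split; apply: bf => //; exact: measurable_cst. Qed.

(** The two other pairings are exchanged by swapping the integrated points, so each takes half of
    what the first one leaves of the total 1. *)
Let J2_others (f : R -> R -> R -> R -> R) :
  (forall d (T : measurableType d) (f1 f2 f3 f4 : T -> R),
  measurable_fun setT f1 -> measurable_fun setT f2 ->
  measurable_fun setT f3 -> measurable_fun setT f4 ->
  bfun (fun z => f (f1 z) (f2 z) (f3 z) (f4 z))) ->
  (forall x3 x4, x3 != x1 -> x3 != x2 ->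
    x4 != x1 -> x4 != x2 -> x4 != x3 -> f x1 x2 x3 x4 + f x1 x3 x2 x4 + f x1 x4 x2 x3 = 1) ->
  J2 (fun x3 x4 => f x1 x3 x2 x4) = (1 - J2 (f x1 x2)) / 2 /\
  J2 (fun x3 x4 => f x1 x4 x2 x3) = (1 - J2 (f x1 x2)) / 2.
Proof.
move=> bf fs; have [b1 b2 b3] := bm bf.
have E : J2 (fun x3 x4 => f x1 x4 x2 x3) = J2 (fun x3 x4 => f x1 x3 x2 x4).
  by rewrite (J2_swap b3).
have S : J2 (f x1 x2) + J2 (fun x3 x4 => f x1 x3 x2 x4) + J2 (fun x3 x4 => f x1 x4 x2 x3) = 1.
  rewrite -J2D// -J2D//; last exact: bfunD.
  have -> : 1 = J2 (fun _ _ => 1) by rewrite /J2 !Rintegral_cst1.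
  apply: (@ae2_eq_Rintegral _ _ _ _ _ U U (fun z => f x1 x2 z.1 z.2 + f x1 z.1 x2 z.2 + f x1 z.2 x2 z.1) (fun=> 1)).
  - by apply: bfunD => //; exact: bfunD.
  - exact: bfun_cst.
  have ae c := @U_ae_neq R c (fun s => s != c) (fun s h => h).
  apply: filterS2 (ae x1) (ae x2) => x3 n31 n32.
  by apply: filterS3 (ae x1) (ae x2) (ae x3) => x4 n41 n42 n43 /=; exact: fs.
by move: S; rewrite E; move: (J2 (f x1 x2)) (J2 _) => a b S; split; lra.
Qed.

Lemma J2_low23 : J2 (fun x3 x4 => lowR x1 x3 x2 x4) = 3^-1 - gker 0 x1 x2 /\
  J2 (fun x3 x4 => lowR x1 x4 x2 x3) = 3^-1 - gker 0 x1 x2.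
Proof.
have [||-> ->] := @J2_others lowR; last by rewrite J2_low1; split; lra.
- exact: bfun_lowR.
- by move=> x3 x4 *; have [] := @low_alt_sum x1 x2 x3 x4.
Qed.

(** Alternation means that exactly one further point falls between the given two; with d = |x1 - x2|
    the value is 2 d (1 - d). *)
Lemma J2_alt1 : J2 (altR x1 x2) = 3^-1 - 4 * gker 1 x1 x2.
Proof.
have main u v : 0 <= u <= 1 -> 0 <= v <= 1 -> u < v -> J2 (altR u v) = 3^-1 - 4 * gker 1 u v.
  move=> u01 v01 uv.
  have b1 c : bfun (lt01 c : R -> R) by exact: (bfun_lt01 (measurable_cst c) (@measurable_id _ _ _)).
  have b2 c : bfun (lt01^~ c : R -> R) by exact: (bfun_lt01 (@measurable_id _ _ _) (measurable_cst c)).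
  have bb : bfun (fun s => lt01 u s * lt01 s v : R) by exact: bfunM.
  have uv0 : lt01 v u = 0 by rewrite /lt01 ltNge ltW.
  have tr x : lt01 v x * lt01 x u = 0.
    rewrite /lt01; case: (ltP v x) => vx; rewrite ?mul0r//.
    by rewrite (_ : x < u = false) ?mulr0//; apply/negbTE; rewrite -leNgt ltW// (lt_trans uv).
  have -> : altR u v = (fun x y => (lt01 u x * lt01 x v) * lt01 v y +
      (lt01 v x) * (lt01 u y * lt01 y v) + (lt01 x u * (lt01 u y * lt01 y v)) +
      (lt01 u x * lt01 x v) * lt01 y u).
    apply: funext => x; apply: funext => y.
    rewrite /altR /chainR.
    rewrite (_ : lt01 v x * lt01 x u * lt01 u y = 0) ?tr ?mul0r//.
    rewrite (_ : lt01 x v * lt01 v y * lt01 y u = 0); last by rewrite -mulrA tr mulr0.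
    rewrite (_ : lt01 y v * lt01 v x * lt01 x u = 0); last by rewrite -mulrA tr mulr0.
    ring.
  have p1 f : bfun f -> bfun (fun z : R * R => f z.1 : R) by exact: bfun_comp.
  have p2 f : bfun f -> bfun (fun z : R * R => f z.2 : R) by exact: bfun_comp.
  have bx := p1 _ bb; have by_ := p2 _ bb.
  have t1 : bfun (fun z : R * R => (lt01 u z.1 * lt01 z.1 v) * lt01 v z.2).
    by apply: bfunM => //; exact: (p2 _ (b1 v)).
  have t2 : bfun (fun z : R * R => (lt01 v z.1) * (lt01 u z.2 * lt01 z.2 v)).
    by apply: bfunM => //; exact: (p1 _ (b1 v)).
  have t3 : bfun (fun z : R * R => (lt01 z.1 u * (lt01 u z.2 * lt01 z.2 v))).
    by apply: bfunM => //; exact: (p1 _ (b2 u)).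
  have t4 : bfun (fun z : R * R => (lt01 u z.1 * lt01 z.1 v) * lt01 z.2 u).
    by apply: bfunM => //; exact: (p2 _ (b2 u)).
  rewrite J2D//; last by apply: bfunD => //; exact: bfunD.
  rewrite J2D//; last exact: bfunD.
  rewrite J2D//.
  rewrite (@J2_prod (fun s => lt01 u s * lt01 s v) (lt01 v))//.
  rewrite (@J2_prod (lt01 v) (fun s => lt01 u s * lt01 s v))//.
  rewrite (@J2_prod (lt01^~ u) (fun s => lt01 u s * lt01 s v))//.
  rewrite (@J2_prod (fun s => lt01 u s * lt01 s v) (lt01^~ u))//.
  by rewrite int_between// int_lt_l// int_lt_r// gkerE// max_r ?ltW//; field.
case: (ltgtP x1 x2) n12 => // h _; first exact: main.
have -> : altR x1 x2 = altR x2 x1.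
  by apply: funext => x; apply: funext => y; exact: alt_sym.
by rewrite gker_sym; exact: main.
Qed.

Lemma J2_alt23 : J2 (fun x3 x4 => altR x1 x3 x2 x4) = 3^-1 + 2 * gker 1 x1 x2 /\
  J2 (fun x3 x4 => altR x1 x4 x2 x3) = 3^-1 + 2 * gker 1 x1 x2.
Proof.
have [||-> ->] := @J2_others altR; last by rewrite J2_alt1; split; lra.
- exact: bfun_altR.
- by move=> x3 x4 *; have [] := @low_alt_sum x1 x2 x3 x4.
Qed.

(** The sign of a permutation is antisymmetric in the two integrated points. This removes the sign
    term from the averaged kernel of F. *)
Lemma J2_sgn : J2 (sgnR x1 x2) = 0.
Proof.
have b : bfun (fun z : R * R => sgnR x1 x2 z.1 z.2) by have [] := bm bfun_sgnR.
have b' : bfun (fun z : R * R => sgnR x1 x2 z.2 z.1).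
  by apply: bfun_sgnR => //; exact: measurable_cst.
suff : J2 (sgnR x1 x2) + J2 (sgnR x1 x2) = 0 by lra.
rewrite {2}(J2_swap b) -J2D//.
have -> : 0 = J2 (fun _ _ => 0) by rewrite /J2 !Rintegral_cst1.
apply: (@ae2_eq_Rintegral _ _ _ _ _ U U (fun z => sgnR x1 x2 z.1 z.2 + sgnR x1 x2 z.2 z.1) (fun=> 0)).
- exact: bfunD.
- exact: bfun_cst.
have ae c := @U_ae_neq R c (fun s => s != c) (fun s h => h).
apply: filterS (ae x1) => x3 _; apply: filterS (ae x3) => x4 n43 /=.
by rewrite [X in _ + X]sgn_swap// subrr.
Qed.

End values.

End one_dimensional_kernels.

(** * The two-variable kernel *)

Section kernel2_formula.
Context {R : realType}.

Lemma U_ae01 : {ae U, forall s : R, 0 <= s <= 1}.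
Proof.
apply: (negligibleS _ (A := ~` (`[0, 1]%classic : set R))).
  by move=> s /=; rewrite in_itv.
apply/negligibleP; first exact: measurableC.
etransitivity; first by apply: U_measure; exact: measurableC.
by rewrite setICl measure0.
Qed.

Variable mu : probability (R * R)%type R.
Hypothesis muE : forall A, measurable A -> mu A = prodP U U A.

Lemma mu_Rintegral (f : R * R -> R) : bfun f ->
  \int[mu]_z f z = \int[U]_x \int[U]_y f (x, y).
Proof.
move=> bf; rewrite (@Rintegral_prod12 _ _ _ _ _ U U f).
- congr fine; apply: eq_measure_integral => A mA _; exact: muE.
- exact: (@integrable_bfun _ _ _ (prodP U U) _ bf).
- by move=> x; exact/integrable_bfun/(bfun_section1 bf x).
Qed.

Lemma mu_prod (f g : R -> R) : bfun f -> bfun g ->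
  \int[mu]_z (f z.1 * g z.2) = (\int[U]_x f x) * \int[U]_y g y.
Proof.
move=> bf bg; rewrite (mu_Rintegral (f := fun z => f z.1 * g z.2)).
  by rewrite /= Rintegral_prod_indep//; exact: integrable_bfun.
by apply: bfunM; exact: bfun_comp.
Qed.

Lemma mu_ae (p1 p2 : R -> Prop) : {ae U, forall x, p1 x} -> {ae U, forall x, p2 x} ->
  {ae mu, forall z, p1 z.1 /\ p2 z.2}.
Proof.
move=> [N1 [mN1 N10 h1]] [N2 [mN2 N20 h2]].
have E1 : mu (N1 `*` [set: R]) = 0%E.
  by etransitivity; [exact: muE (measurableX mN1 measurableT)|rewrite prodPE// N10 mul0e].
have E2 : mu ([set: R] `*` N2) = 0%E.
  by etransitivity; [exact: muE (measurableX measurableT mN2)|rewrite prodPE// N20 mule0].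
apply: (negligibleS _ (A := (N1 `*` [set: R]) `|` ([set: R] `*` N2))).
  move=> z /=; have [p1z|np1] := pselect (p1 z.1); last by left; split => //; exact: h1.
  by have [p2z|np2] := pselect (p2 z.2); [tauto|right; split => //; exact: h2].
apply: negligibleU.
  by apply/negligibleP; [exact: measurableX|exact: E1].
by apply/negligibleP; [exact: measurableX|exact: E2].
Qed.

Definition I2 (F : R * R -> R * R -> R) : R := \int[mu]_z3 \int[mu]_z4 F z3 z4.

Let i1 : mu.-integrable setT (EFin \o (cst 1)).
Proof. exact/integrable_bfun/bfun_cst. Qed.

Lemma bfun_inner d (T : measurableType d) (m : probability T R) (F : T * (R * R) -> R) :
  bfun F -> bfun (fun z => \int[mu]_z4 F (z, z4)).
Proof.
move=> bF; have := bfun_partial_integral m i1 bF.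
by under eq_fun do under eq_Rintegral do rewrite mul1r.
Qed.

Lemma I2_lin (l : seq (R * (R * R -> R * R -> R))) :
  foldr (fun p Q => bfun (fun z => p.2 z.1 z.2) /\ Q) True l ->
  I2 (fun z3 z4 => \sum_(p <- l) p.1 * p.2 z3 z4) = \sum_(p <- l) p.1 * I2 p.2.
Proof.
move=> H; rewrite /I2.
transitivity (\int[mu]_z3 \sum_(p <- [seq (p.1, fun z3 => \int[mu]_z4 p.2 z3 z4) | p <- l]) p.1 * p.2 z3).
  apply: eq_Rintegral => z3 _; rewrite big_map/=.
  have := @Rintegral_lin _ _ R mu [seq (p.1, p.2 z3) | p <- l]; rewrite !big_map/= => <-.
    by apply: eq_Rintegral => z4 _; rewrite big_map.
  elim: l H => //= p l ih [bp /ih hl]; split => //; exact: (bfun_section1 bp z3).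
rewrite Rintegral_lin ?big_map//.
elim: l H => //= p l ih [bp /ih hl]; split => //; exact: (bfun_inner mu bp).
Qed.

Lemma I2_prod (f g : R -> R -> R) : bfun (fun z => f z.1 z.2) -> bfun (fun z => g z.1 z.2) ->
  I2 (fun z3 z4 => f z3.1 z4.1 * g z3.2 z4.2) = J2 f * J2 g.
Proof.
move=> bf bg; rewrite /I2 /J2.
have iU : U.-integrable setT (EFin \o (cst 1 : R -> R)) by exact/integrable_bfun/bfun_cst.
have bI h : bfun (fun z : R * R => h z.1 z.2 : R) -> bfun (fun x => \int[U]_y h x y).
  move=> bh; have := bfun_partial_integral U iU bh.
  by under eq_fun do under eq_Rintegral do rewrite mul1r.
rewrite -(mu_prod (bI _ bf) (bI _ bg)); apply: eq_Rintegral => z _.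
by rewrite -mu_prod//; [exact: (bfun_section1 bf)|exact: (bfun_section1 bg)].
Qed.

Lemma no_ties_tuple (z1 z2 z3 z4 : R * R) :
  uniq [:: z1.1; z2.1; z3.1; z4.1] -> uniq [:: z1.2; z2.2; z3.2; z4.2] ->
  no_ties (tnth [tuple z1; z2; z3; z4]).
Proof.
move=> u1 u2; split.
  have /tuple_uniqP H : uniq [tuple of [:: z1.1; z2.1; z3.1; z4.1]] by [].
  move=> i j ij; apply: H; move: ij.
  by case: (ord4P i) => ->; case: (ord4P j) => ->; rewrite !(tnth_nth 0)/= !inordK.
have /tuple_uniqP H : uniq [tuple of [:: z1.2; z2.2; z3.2; z4.2]] by [].
move=> i j ij; apply: H; move: ij.
by case: (ord4P i) => ->; case: (ord4P j) => ->; rewrite !(tnth_nth 0)/= !inordK.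
Qed.

Lemma uniq4 (a b c e : R) : a != b -> c != a -> c != b -> e != a -> e != b -> e != c ->
  uniq [:: a; b; c; e].
Proof.
move=> h1 h2 h3 h4 h5 h6.
by rewrite /= !inE !negb_or h1 (eq_sym a c) h2 (eq_sym a e) h4 (eq_sym b c) h3 (eq_sym b e) h5
  (eq_sym c e) h6.
Qed.

Lemma kernel4_tuple A (z1 z2 z3 z4 : R * R) :
  uniq [:: z1.1; z2.1; z3.1; z4.1] -> uniq [:: z1.2; z2.2; z3.2; z4.2] ->
  kernel4 A (tnth [tuple z1; z2; z3; z4]) = kernelR A z1 z2 z3 z4.
Proof.
move=> u1 u2; rewrite kernel4_no_ties; last exact: no_ties_tuple.
by rewrite !(tnth_nth (0, 0))/= !inordK.
Qed.

(** Averaging gives 1/3 + 2g, 1/3 - g, 1/3 - g for [lowR] and 1/3 - 4h, 1/3 + 2h, 1/3 + 2h for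
    [altR] over the three pairings, where g and h are [gker] for k = 0 and k = 1. In the sum of
    products the linear terms cancel and the constants add up to 1/3, while the bilinear terms have
    weights 4 + 2, 16 + 8 and -(8 + 4); the minus sign is undone by the sign convention for D and E.
    F gets a third of each. *)
Definition coef (A : stat) (k k' : bool) : R :=
  match A, k, k' with
  | statB, false, false => 6
  | statC, true, true => 24
  | statD, false, true => 12
  | statE, true, false => 12
  | statDE, false, true => 12
  | statDE, true, false => 12
  | statF, false, false => 2
  | statF, true, true => 8
  | statF, _, _ => 4
  | _, _, _ => 0
  end.

Definition Kform (A : stat) (z z' : R * R) : R :=
  \sum_(k : bool) \sum_(k' : bool) coef A k k' * (gker k%:R z.1 z'.1 * gker k'%:R z.2 z'.2).

Lemma Kform_kernelR A (z1 z2 : R * R) : unit_square z1 -> unit_square z2 ->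
  z1.1 != z2.1 -> z1.2 != z2.2 -> I2 (kernelR A z1 z2) = Kform A z1 z2.
Proof.
move=> [/= x1 y1] [/= x2 y2] n1 n2; move: x1 x2 y1 y2; rewrite /= !in_itv/= => x1 x2 y1 y2.
have mc (c : R) : measurable_fun [set: (R * R) * (R * R)] (fun=> c) by exact: measurable_cst.
have m1 : measurable_fun [set: (R * R) * (R * R)] (fun z => z.1.1) by exact: measurableT_comp.
have m2 : measurable_fun [set: (R * R) * (R * R)] (fun z => z.1.2) by exact: measurableT_comp.
have m3 : measurable_fun [set: (R * R) * (R * R)] (fun z => z.2.1) by exact: measurableT_comp.
have m4 : measurable_fun [set: (R * R) * (R * R)] (fun z => z.2.2) by exact: measurableT_comp.
pose good (f : R -> R -> R -> R -> R) :=
  (forall d (T : measurableType d) (f1 f2 f3 f4 : T -> R),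
  measurable_fun setT f1 -> measurable_fun setT f2 ->
  measurable_fun setT f3 -> measurable_fun setT f4 ->
  bfun (fun z => f (f1 z) (f2 z) (f3 z) (f4 z))).
have bpair f g : good f -> good g ->
    bfun (fun z : (R * R) * (R * R) => pairingsR f g z1 z2 z.1 z.2).
  by move=> bf bg; apply: bfunD; [apply: bfunD|]; apply: bfunM; (apply: bf || apply: bg).
have mcU (c : R) : measurable_fun [set: R * R] (fun=> c) by exact: measurable_cst.
have Ipair f g : good f -> good g -> I2 (pairingsR f g z1 z2) =
    J2 (f z1.1 z2.1) * J2 (g z1.2 z2.2) +
    J2 (fun a b => f z1.1 a z2.1 b) * J2 (fun a b => g z1.2 a z2.2 b) +
    J2 (fun a b => f z1.1 b z2.1 a) * J2 (fun a b => g z1.2 b z2.2 a).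
  move=> bf bg; rewrite -!I2_prod; try by (apply: bf || apply: bg).
  pose l := [:: (1, fun z3 z4 : R * R => f z1.1 z2.1 z3.1 z4.1 * g z1.2 z2.2 z3.2 z4.2);
    (1, fun z3 z4 : R * R => f z1.1 z3.1 z2.1 z4.1 * g z1.2 z3.2 z2.2 z4.2);
    (1, fun z3 z4 : R * R => f z1.1 z4.1 z2.1 z3.1 * g z1.2 z4.2 z2.2 z3.2)]
    : seq (R * (R * R -> R * R -> R)).
  transitivity (I2 (fun z3 z4 => \sum_(p <- l) p.1 * p.2 z3 z4)).
    by apply: eq_Rintegral => z3 _; apply: eq_Rintegral => z4 _;
      rewrite /l !big_cons big_nil /pairingsR /= !mul1r addr0 addrA.
  rewrite I2_lin; first by rewrite /l !big_cons big_nil /= !mul1r addr0 addrA.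
  rewrite /l /=; split; first by apply: bfunM; (apply: bf || apply: bg).
  split; first by apply: bfunM; (apply: bf || apply: bg).
  by split => //; apply: bfunM; (apply: bf || apply: bg).
have gl : good lowR by exact: bfun_lowR.
have ga : good altR by exact: bfun_altR.
(* Coefficients of low-low, alt-alt, low-alt, alt-low, of the product of signs and of the
   constant. *)
pose cs : R * R * R * R * R * R := match A with
  | statB => (1, 0, 0, 0, 0, - 3^-1) | statC => (0, 1, 0, 0, 0, - 3^-1)
  | statD => (0, 0, - 1, 0, 0, 3^-1) | statE => (0, 0, 0, - 1, 0, 3^-1)
  | statF => (3^-1, 3^-1, - 3^-1, - 3^-1, - 6^-1, 0) | statDE => (0, 0, - 1, - 1, 0, 2 / 3) end.
pose l := [:: (cs.1.1.1.1.1, pairingsR lowR lowR z1 z2); (cs.1.1.1.1.2, pairingsR altR altR z1 z2);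
  (cs.1.1.1.2, pairingsR lowR altR z1 z2); (cs.1.1.2, pairingsR altR lowR z1 z2);
  (cs.1.2, fun z3 z4 => sgnR z1.1 z2.1 z3.1 z4.1 * sgnR z1.2 z2.2 z3.2 z4.2);
  (cs.2, fun _ _ => 1)] : seq (R * (R * R -> R * R -> R)).
transitivity (I2 (fun z3 z4 => \sum_(p <- l) p.1 * p.2 z3 z4)).
  apply: eq_Rintegral => z3 _; apply: eq_Rintegral => z4 _.
  rewrite /l !big_cons big_nil /=; rewrite /kernelR /cs.
  by case: A {cs l}; rewrite /=; field.
rewrite I2_lin; last first.
  rewrite /l /=; split; first exact: bpair.
  split; first exact: bpair.
  split; first exact: bpair.
  split; first exact: bpair.
  split; first by apply: bfunM; exact: bfun_sgnR.
  by split => //; exact: bfun_cst.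
rewrite /l !big_cons big_nil /= !Ipair// I2_prod; try by exact: bfun_sgnR.
rewrite !J2_sgn.
have -> : I2 (fun _ _ => 1) = 1 by rewrite /I2 !Rintegral_cst1.
have [-> ->] := J2_low23 x1 x2 n1; have [-> ->] := J2_low23 y1 y2 n2.
have [-> ->] := J2_alt23 x1 x2 n1; have [-> ->] := J2_alt23 y1 y2 n2.
rewrite !J2_low1// !J2_alt1// /Kform !big_bool /cs /coef /=.
move: (gker 0 z1.1 z2.1) (gker 1 z1.1 z2.1) (gker 0 z1.2 z2.2) (gker 1 z1.2 z2.2) => g0 g1 g0' g1'.
by case: A {cs l}; rewrite /=; field.
Qed.

Lemma bfun_kernelR A d (T : measurableType d) (f1 f2 f3 f4 : T -> R * R) :
  measurable_fun setT f1 -> measurable_fun setT f2 ->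
  measurable_fun setT f3 -> measurable_fun setT f4 ->
  bfun (fun z => kernelR A (f1 z) (f2 z) (f3 z) (f4 z)).
Proof.
move=> m1 m2 m3 m4.
have c1 (f : T -> R * R) : measurable_fun setT f -> measurable_fun setT (fun z => (f z).1).
  by move=> mf; exact: measurableT_comp.
have c2 (f : T -> R * R) : measurable_fun setT f -> measurable_fun setT (fun z => (f z).2).
  by move=> mf; exact: measurableT_comp.
have bl g g' : (forall (f1 f2 f3 f4 : T -> R),
    measurable_fun setT f1 -> measurable_fun setT f2 ->
    measurable_fun setT f3 -> measurable_fun setT f4 ->
    bfun (fun z => g (f1 z) (f2 z) (f3 z) (f4 z))) -> (forall (f1 f2 f3 f4 : T -> R),
    measurable_fun setT f1 -> measurable_fun setT f2 ->
    measurable_fun setT f3 -> measurable_fun setT f4 ->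
    bfun (fun z => g' (f1 z) (f2 z) (f3 z) (f4 z))) ->
    bfun (fun z => pairingsR g g' (f1 z) (f2 z) (f3 z) (f4 z) : R).
  by move=> bg bg'; apply: bfunD; [apply: bfunD|]; apply: bfunM; (apply: bg || apply: bg'); (apply: c1 || apply: c2).
have k3 : bfun (fun _ : T => 1 / 3 : R) by exact: bfun_cst.
have bB : bfun (fun z => pairingsR lowR lowR (f1 z) (f2 z) (f3 z) (f4 z) - 1 / 3 : R).
  by apply: bfunB => //; apply: bl; exact: bfun_lowR.
have bC : bfun (fun z => pairingsR altR altR (f1 z) (f2 z) (f3 z) (f4 z) - 1 / 3 : R).
  by apply: bfunB => //; apply: bl; exact: bfun_altR.
have bD : bfun (fun z => 1 / 3 - pairingsR lowR altR (f1 z) (f2 z) (f3 z) (f4 z) : R).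
  by apply: bfunB => //; apply: bl; [exact: bfun_lowR|exact: bfun_altR].
have bE : bfun (fun z => 1 / 3 - pairingsR altR lowR (f1 z) (f2 z) (f3 z) (f4 z) : R).
  by apply: bfunB => //; apply: bl; [exact: bfun_altR|exact: bfun_lowR].
case: A => //=; last exact: bfunD.
apply: bfunB.
  by apply: bfunM; [apply: bfunD => //; apply: bfunD => //; exact: bfunD|exact: bfun_cst].
apply: bfunM; last exact: bfun_cst.
by apply: bfunM; apply: bfun_sgnR; (apply: c1 || apply: c2).
Qed.

Lemma bfun_kernel4 A d (T : measurableType d) (f1 f2 f3 f4 : T -> R * R) :
  measurable_fun setT f1 -> measurable_fun setT f2 ->
  measurable_fun setT f3 -> measurable_fun setT f4 ->
  bfun (fun z => kernel4 A (tnth [tuple f1 z; f2 z; f3 z; f4 z])).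
Proof.
move=> m1 m2 m3 m4.
have mk : measurable_fun setT (fun z => ((f1 z, f2 z), (f3 z, f4 z))).
  by apply/measurable_fun_pairP; split; apply/measurable_fun_pairP; split.
exact: (bfun_comp mk (bfun_kernelT A)).
Qed.

Lemma kernel2_form A (z1 z2 : R * R) : unit_square z1 -> unit_square z2 ->
  z1.1 != z2.1 -> z1.2 != z2.2 -> kernel2 mu A z1 z2 = Kform A z1 z2.
Proof.
move=> s1 s2 n1 n2; rewrite -(Kform_kernelR A s1 s2 n1 n2).
apply: (@ae2_eq_Rintegral _ _ _ _ _ mu mu
  (fun z => kernel4 A (tnth [tuple z1; z2; z.1; z.2])) (fun z => kernelR A z1 z2 z.1 z.2)).
- by apply: bfun_kernel4 => //; exact: measurable_cst.
- by apply: bfun_kernelR => //; exact: measurable_cst.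
have ae c := @U_ae_neq R c (fun s => s != c) (fun s h => h).
have ae3 : {ae mu, forall z3, (z3.1 != z1.1 /\ z3.1 != z2.1) /\ (z3.2 != z1.2 /\ z3.2 != z2.2)}.
  apply: (mu_ae (p1 := fun x => x != z1.1 /\ x != z2.1) (p2 := fun y => y != z1.2 /\ y != z2.2)).
    exact: filterS2 (ae z1.1) (ae z2.1).
  exact: filterS2 (ae z1.2) (ae z2.2).
apply: filterS ae3 => z3 [[a1 a2] [b1 b2]].
have ae4 : {ae mu, forall z4, [/\ z4.1 != z1.1, z4.1 != z2.1 & z4.1 != z3.1] /\
    [/\ z4.2 != z1.2, z4.2 != z2.2 & z4.2 != z3.2]}.
  apply: (mu_ae (p1 := fun x => [/\ x != z1.1, x != z2.1 & x != z3.1])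
    (p2 := fun y => [/\ y != z1.2, y != z2.2 & y != z3.2])).
    exact: filterS3 (ae z1.1) (ae z2.1) (ae z3.1).
  exact: filterS3 (ae z1.2) (ae z2.2) (ae z3.2).
apply: filterS ae4 => z4 [[c1 c2 c3] [d1 d2 d3]] /=.
by apply: kernel4_tuple; exact: uniq4.
Qed.

End kernel2_formula.

(** * A positive eigenvalue *)

Lemma Lfun2_bounded d (T : measurableType d) {R : realType} (mu : probability T R) (f : T -> R) :
  bfun f -> f \in Lfun mu 2%:E.
Proof.
move=> [mf [M fM]].
have M0 : 0 <= `|M| by [].
have fM' x : `|f x| <= `|M| by rewrite (le_trans (fM x))// ler_norm.
rewrite inE; apply/andP; split; rewrite inE//=.
rewrite /finite_norm unlock /=.
apply: poweR_lty; apply: (@le_lt_trans _ _ (\int[mu]_x ((`|M| `^ 2)%:E))%E).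
  apply: ge0_le_integral => //.
  - apply/measurable_EFinP.
    apply: (measurableT_comp (measurable_powR _)) => //.
    exact: measurableT_comp.
  - by move=> x _; rewrite lee_fin ge0_ler_powR// nnegrE.
rewrite integral_cst// -ge0_fin_numE; last by rewrite mule_ge0// lee_fin powR_ge0.
by rewrite fin_numM// fin_num_measure.
Qed.

Section spectrum.
Context {R : realType}.
Variable mu : probability (R * R)%type R.
Hypothesis muE : forall A, measurable A -> mu A = prodP U U A.

Let iU : U.-integrable setT (EFin \o (cst 1 : R -> R)).
Proof. exact/integrable_bfun/bfun_cst. Qed.

Lemma mu_ae_square : {ae mu, forall z, unit_square z}.
Proof.
have := mu_ae muE (@U_ae01 R) (@U_ae01 R).
by apply: filterS => z [h1 h2]; split; rewrite /= in_itv.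
Qed.

Lemma mu_ae_neq (z : R * R) : {ae mu, forall z', z.1 != z'.1 /\ z.2 != z'.2}.
Proof.
have ae c := @U_ae_neq R c (fun s => s != c) (fun s h => h).
have := mu_ae muE (ae z.1) (ae z.2).
by apply: filterS => z' [h1 h2]; rewrite ![z.1 == _]eq_sym ![z.2 == _]eq_sym.
Qed.

Lemma U_itv (a b : R) : 0 <= a -> a < b -> b <= 1 -> U (`]a, b[%classic : set R) = (b - a)%:E.
Proof.
move=> a0 ab b1; etransitivity; first by apply: U_measure; exact: measurable_itv.
rewrite setIidl.
  by rewrite lebesgue_measure_itv/= lte_fin ab -EFinB.
move=> x /=; rewrite !in_itv/= => /andP[ax xb].
by rewrite (le_trans a0 (ltW ax)) (le_trans (ltW xb) b1).
Qed.

(** A box of positive area is not contained in a null set. This turns almost sure statements into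
    statements at points as close as desired to a given one. *)
Lemma mu_box_point (Q : R * R -> Prop) (a b c e : R) : {ae mu, forall z, Q z} ->
  0 <= a -> a < b -> b <= 1 -> 0 <= c -> c < e -> e <= 1 ->
  exists z, [/\ Q z, a < z.1 < b & c < z.2 < e].
Proof.
move=> [N [mN N0 hN]] a0 ab b1 c0 ce e1; apply: contrapT => H.
pose B := (`]a, b[%classic : set R) `*` (`]c, e[%classic : set R).
have mB : measurable B by apply: measurableX; exact: measurable_itv.
have : (mu B <= mu N)%E.
  apply: le_measure; rewrite ?inE//.
  move=> z []; rewrite /= !in_itv/= => z1 z2; apply: hN => /= Qz.
  by apply: H; exists z.
rewrite N0; apply/negP; rewrite -ltNge.
rewrite (_ : mu B = prodP U U B); last exact: muE.
rewrite prodPE; try exact: measurable_itv.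
rewrite (U_itv a0 ab b1) (U_itv c0 ce e1).
by rewrite -EFinM lte_fin mulr_gt0 ?subr_gt0.
Qed.

Lemma kernel2_ae A : {ae mu, forall z, {ae mu, forall z', kernel2 mu A z z' = Kform A z z'}}.
Proof.
apply: filterS mu_ae_square => z sz.
apply: filterS2 mu_ae_square (mu_ae_neq z) => z' sz' [n1 n2].
exact: kernel2_form.
Qed.

Lemma bfun_kernel2 A : bfun (fun z : (R * R) * (R * R) => kernel2 mu A z.1 z.2).
Proof.
apply: (@bfun_inner R mu _ _ (prodP mu mu) (fun zz : ((R * R) * (R * R)) * (R * R) =>
  \int[mu]_z4 kernel4 A (tnth [tuple zz.1.1; zz.1.2; zz.2; z4]))).
apply: (@bfun_inner R mu _ _ (prodP (prodP mu mu) mu) (fun zzz : (((R * R) * (R * R)) * (R * R)) * (R * R) =>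
  kernel4 A (tnth [tuple zzz.1.1.1; zzz.1.1.2; zzz.1.2; zzz.2]))).
by apply: bfun_kernel4; repeat apply: measurableT_comp => //.
Qed.

Lemma bfun_gker k d (T : measurableType d) (m : probability T R) (f g : T -> R) :
  measurable_fun setT f -> measurable_fun setT g -> bfun (fun z => gker k (f z) (g z)).
Proof.
move=> mf mg.
have b : bfun (fun zs : T * R => psi k zs.2 (f zs.1) * psi k zs.2 (g zs.1)).
  by apply: bfunM; apply: bfun_psi => //; exact: measurableT_comp.
have := bfun_partial_integral m iU b.
by under eq_fun do under eq_Rintegral do rewrite mul1r.
Qed.

Lemma bfun_Kform A d (T : measurableType d) (m : probability T R) (f g : T -> R * R) :
  measurable_fun setT f -> measurable_fun setT g -> bfun (fun z => Kform A (f z) (g z)).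
Proof.
move=> mf mg; apply: bfun_sum => k; apply: bfun_sum => k'.
apply: bfunM; first exact: bfun_cst.
by apply: bfunM; apply: (bfun_gker _ m); exact: measurableT_comp.
Qed.

Lemma gker_weighted (k x : R) (v : R -> R) : bfun v ->
  \int[U]_y (gker k x y * v y) = \int[U]_s (psi k s x * \int[U]_y (psi k s y * v y)).
Proof.
move=> bv.
have b : bfun (fun z : R * R => psi k z.2 x * (psi k z.2 z.1 * v z.1)).
  apply: bfunM; first by apply: bfun_psi => //; exact: measurable_cst.
  by apply: bfunM; [exact: bfun_psi|exact: bfun_comp].
transitivity (\int[U]_y \int[U]_s (psi k s x * (psi k s y * v y))).
  apply: eq_Rintegral => y _; rewrite /gker -RintegralZr//; last first.
    apply: integrable_bfun; apply: bfunM; apply: bfun_psi => //; exact: measurable_cst.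
  by apply: eq_Rintegral => s _; rewrite mulrA.
rewrite -[LHS]/(J2 (fun y s => psi k s x * (psi k s y * v y))) J2_swap//.
apply: eq_Rintegral => s _; rewrite RintegralZl//; apply: integrable_bfun.
by apply: bfunM => //; apply: bfun_psi => //; exact: measurable_cst.
Qed.

Lemma psi_margin (k s : R) : 0 <= s <= 1 -> \int[U]_y psi k s y = 0.
Proof.
move=> s01.
pose l := [:: (1, fun y => le01 y s); (- clamp s - k / 2, fun y => 1);
  (k, fun y => clamp y)] : seq (R * (R -> R)).
transitivity (\int[U]_y (\sum_(p <- l) p.1 * p.2 y)).
  apply: eq_Rintegral => y _; rewrite /l !big_cons big_nil/= /psi; by field.
rewrite Rintegral_lin; last first.
  rewrite /l /=; split; first exact: (bfun_le01 (@measurable_id _ _ _) (measurable_cst s)).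
  by split; [exact: bfun_cst|split => //; exact: bfun_clamp].
rewrite /l !big_cons big_nil/= int_le_r// Rintegral_cst1 int_clamp clampE//; by field.
Qed.

Lemma gker_margin (k x : R) : \int[U]_y gker k x y = 0.
Proof.
transitivity (\int[U]_y (gker k x y * 1)); first by apply: eq_Rintegral => y _; rewrite mulr1.
rewrite (gker_weighted _ _ (@bfun_cst _ _ R 1)) -[RHS](Rintegral_cst1 U).
have bi : bfun (fun s : R => \int[U]_y (psi k s y * 1)).
  have b : bfun (fun z : R * R => psi k z.1 z.2 * 1) by apply: bfunM; [exact: bfun_psi|exact: bfun_cst].
  have := bfun_partial_integral U iU b.
  by under eq_fun do under eq_Rintegral do rewrite mul1r.
apply: ae_eq_Rintegral; [|exact: measurable_cst|].
  have [] // : bfun (fun s => psi k s x * \int[U]_y (psi k s y * 1)).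
  by apply: bfunM => //; apply: bfun_psi => //; exact: measurable_cst.
apply: filterS (@U_ae01 R) => s s01 _.
have -> : \int[U]_y (psi k s y * 1) = \int[U]_y psi k s y by apply: eq_Rintegral => y _; rewrite mulr1.
by rewrite psi_margin// mulr0.
Qed.

Let w : R := 2 * pi.
Let w0 : w != 0. Proof. by rewrite /w mulf_neq0 ?gt_eqF ?pi_gt0. Qed.
Let z01 : 0 <= (0 : R) <= 1. Proof. by rewrite lexx ler01. Qed.

Lemma int_sin : \int[U]_s sin (w * s) = 0.
Proof.
have := @int_le_sin R 0 z01; rewrite -/w mulr0 cos0 subrr mul0r => <-.
apply: ae_eq_Rintegral.
- by have [] := @bfun_sinw R.
- have [] // := bfunM (bfun_le01 (measurable_cst (0 : R)) (@measurable_id _ _ _)) (@bfun_sinw R).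
by apply: filterS (@U_ae01 R) => s /andP[s0 _] _; rewrite /le01 s0 mul1r.
Qed.

Lemma psi_cos (k s : R) : 0 <= s <= 1 -> \int[U]_y (psi k s y * cos (w * y)) = sin (w * s) / w.
Proof.
move=> s01.
have bc := @bfun_cosw R.
have bl : bfun (fun y : R => le01 y s) by exact: (bfun_le01 (@measurable_id _ _ _) (measurable_cst s)).
pose l := [:: (1, fun y => le01 y s * cos (w * y)); (- clamp s - k / 2, fun y => cos (w * y));
  (k, fun y => clamp y * cos (w * y))] : seq (R * (R -> R)).
transitivity (\int[U]_y (\sum_(p <- l) p.1 * p.2 y)).
  apply: eq_Rintegral => y _; rewrite /l !big_cons big_nil/= /psi; by field.
rewrite Rintegral_lin; last first.
  rewrite /l /=; split; first exact: bfunM.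
  by split; [exact: bc|split => //; exact: (bfunM (@bfun_clamp R) bc)].
rewrite /l !big_cons big_nil/= (int_le_cos s01) (@int_cos R) (@int_clamp_cos R).
by rewrite !mulr0 !addr0 mul1r.
Qed.

(** The term that distinguishes k = 1 from k = 0 integrates to 0 against a full period, so both
    kernels share this eigenfunction and the eigenvalue w^-2. *)
Lemma gker_cos (k x : R) : 0 <= x <= 1 -> \int[U]_y (gker k x y * cos (w * y)) = cos (w * x) / w ^+ 2.
Proof.
move=> x01.
have bc := @bfun_cosw R; have bs := @bfun_sinw R.
rewrite gker_weighted//.
have bl : bfun (fun y : R => le01 x y) by exact: (bfun_le01 (measurable_cst x) (@measurable_id _ _ _)).
have bpx : bfun (fun s : R => psi k s x) by apply: bfun_psi => //; exact: measurable_cst.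
transitivity (\int[U]_s (psi k s x * (sin (w * s) / w))).
  apply: ae_eq_Rintegral.
  - have [] // : bfun (fun s => psi k s x * \int[U]_y (psi k s y * cos (w * y))).
    apply: bfunM => //.
    have b : bfun (fun z : R * R => psi k z.1 z.2 * cos (w * z.2)).
      by apply: bfunM; [exact: bfun_psi|exact: (bfun_comp _ bc)].
    have := bfun_partial_integral U iU b.
    by under eq_fun do under eq_Rintegral do rewrite mul1r.
  - have [] // : bfun (fun s => psi k s x * (sin (w * s) / w)).
    by apply: bfunM => //; apply: bfunM => //; exact: bfun_cst.
  - by apply: filterS (@U_ae01 R) => s s01 _; rewrite psi_cos.
pose m := 2^-1 - x.
pose l := [:: (w^-1, fun s => le01 x s * sin (w * s)); (- w^-1, fun s => clamp s * sin (w * s));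
  (- (k * m / w), fun s => sin (w * s))] : seq (R * (R -> R)).
transitivity (\int[U]_s (\sum_(p <- l) p.1 * p.2 s)).
  by apply: eq_Rintegral => s _; rewrite /l !big_cons big_nil/= /psi (clampE x01) /m; ring.
rewrite Rintegral_lin; last first.
  rewrite /l /=; split; first exact: bfunM.
  by split; [exact: (bfunM (@bfun_clamp R) bs)|split].
rewrite /l !big_cons big_nil/= (int_le_sin x01) (@int_clamp_sin R) int_sin -/w.
by field.
Qed.

Definition coscos (z : R * R) : R := cos (w * z.1) * cos (w * z.2).

Lemma bfun_coscos : bfun coscos.
Proof.
have bc := @bfun_cosw R.
by apply: bfunM; [exact: (bfun_comp measurable_fst bc)|exact: (bfun_comp measurable_snd bc)].
Qed.

Definition eig (A : stat) : R := (\sum_(k : bool) \sum_(k' : bool) coef A k k') / w ^+ 4.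

Lemma eig_gt0 A : 0 < eig A.
Proof.
rewrite /eig !big_bool divr_gt0//; last by rewrite exprn_even_gt0.
by case: A => /=; lra.
Qed.

Lemma Kform_coscos A (z : R * R) : unit_square z ->
  \int[mu]_z' (Kform A z z' * coscos z') = eig A * coscos z.
Proof.
move=> [/=]; rewrite !in_itv/= => x01 y01.
have bc := @bfun_cosw R.
have bk k x : bfun (fun y => gker k x y * cos (w * y) : R).
  by apply: bfunM => //; apply: (bfun_gker _ U) => //; exact: measurable_cst.
have b1 (k k' : bool) : bfun (fun z' : R * R => (gker k%:R z.1 z'.1 * cos (w * z'.1)) *
    (gker k'%:R z.2 z'.2 * cos (w * z'.2))).
  by apply: bfunM; [exact: (bfun_comp measurable_fst (bk _ _))|exact: (bfun_comp measurable_snd (bk _ _))].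
pose l := [seq (coef A kk.1 kk.2, fun z' : R * R => (gker kk.1%:R z.1 z'.1 * cos (w * z'.1)) *
    (gker kk.2%:R z.2 z'.2 * cos (w * z'.2))) |
    kk <- [:: (true, true); (true, false); (false, true); (false, false)]] : seq (R * (R * R -> R)).
transitivity (\int[mu]_z' (\sum_(p <- l) p.1 * p.2 z')).
  apply: eq_Rintegral => z' _; rewrite /l !big_cons big_nil/= /Kform !big_bool/= /coscos; ring.
rewrite Rintegral_lin; last first.
  rewrite /l; split; first exact: (b1 true true).
  split; first exact: (b1 true false).
  split; first exact: (b1 false true).
  split; last by [].
  exact: (b1 false false).
have I (k k' : bool) : \int[mu]_z' ((gker k%:R z.1 z'.1 * cos (w * z'.1)) *
    (gker k'%:R z.2 z'.2 * cos (w * z'.2))) = coscos z / w ^+ 4.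
  by rewrite (mu_prod muE (bk _ _) (bk _ _)) !gker_cos// mulrACA -invfM -exprD.
rewrite /l big_map.
under eq_bigr do rewrite /= I.
by rewrite !big_cons big_nil addr0 /eig !big_bool/= -!mulrDl !addrA [RHS]mulrAC -[RHS]mulrA.
Qed.

Lemma eig_eigenvalue A : eigenvalue_of mu (kernel2 mu A) (eig A).
Proof.
have bcc := bfun_coscos.
exists coscos; split.
- exact: Lfun2_bounded.
(* On this box the angles stay below pi/4, so both cosines are positive and the function is not
   almost everywhere 0. *)
- move=> h; have [||||||z [] ] := @mu_box_point _ 0 8^-1 0 8^-1 h; try lra.
  move=> c0 x01 y01; have cw (x : R) : 0 < x < 8^-1 -> 0 < cos (w * x).
    move=> /andP[x0 x1]; apply: cos_gt0_pihalf; have := @pi_gt0 R; rewrite /w => p0.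
    have p1 : pi * x <= pi * 8^-1 by rewrite ler_wpM2l// ltW.
    have p2 : 0 <= pi * x by rewrite mulr_ge0// ltW.
    by apply/andP; split; lra.
  by move: (c0 I) => /eqP; rewrite /cst/= gt_eqF// mulr_gt0// cw.
- apply: filterS2 mu_ae_square (kernel2_ae A) => z sz Kz _.
  rewrite -Kform_coscos//; apply: ae_eq_Rintegral.
  + have [] // : bfun (fun z' => kernel2 mu A z z' * coscos z').
    by apply: bfunM => //; exact: (bfun_section1 (bfun_kernel2 A) z).
  + have [] // : bfun (fun z' => Kform A z z' * coscos z').
    by apply: bfunM => //; apply: (bfun_Kform _ mu) => //; exact: measurable_cst.
  + by apply: filterS Kz => z' -> _.
Qed.

Lemma largest_eigenvalue_gt0 A l : is_largest (eigenvalue_of mu (kernel2 mu A)) l -> 0 < l.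
Proof. by move=> [_ /(_ _ (eig_eigenvalue A))]; apply: lt_le_trans; exact: eig_gt0. Qed.

End spectrum.

(** * Gram representations and measures with densities *)

Section gram.
Context d1 d2 (T : measurableType d1) (S : measurableType d2) {R : realType}.
Variables (m : probability T R) (n : probability S R) (Phi : S * T -> R) (v : T -> R).
Hypotheses (bPhi : bfun Phi) (iv : m.-integrable setT (EFin \o v)).

Let i1 : n.-integrable setT (EFin \o cst 1).
Proof. exact/integrable_bfun/bfun_cst. Qed.

Definition gram_vec (s : S) : R := \int[m]_x (v x * Phi (s, x)).

Lemma bfun_gram_vec : bfun gram_vec.
Proof. exact: bfun_partial_integral. Qed.

Lemma gram_form :
  \int[m]_x (v x * \int[m]_z (v z * \int[n]_s (Phi (s, x) * Phi (s, z)))) =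
  \int[n]_s (gram_vec s ^+ 2).
Proof.
have swap : measurable_fun setT (fun p : T * S => (p.2, p.1)) by exact: measurable_swap.
have bx x : bfun (fun s => Phi (s, x)) := bfun_section2 bPhi x.
have bs s : bfun (fun x => Phi (s, x)) := bfun_section1 bPhi s.
transitivity (\int[m]_x (v x * \int[n]_s (1 * (gram_vec s * Phi (s, x))))).
  apply: eq_Rintegral => x _; congr (_ * _).
  transitivity (\int[m]_z (v z * \int[n]_s (1 * (Phi (s, x) * Phi (s, z))))).
    apply: eq_Rintegral => z _; congr (_ * _).
    by apply: eq_Rintegral => s _; rewrite mul1r.
  rewrite (Rintegral_swap iv i1 (f := fun p => Phi (p.2, x) * Phi (p.2, p.1))).
    apply: eq_Rintegral => s _; congr (_ * _); rewrite mulrC -RintegralZl//.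
      by apply: eq_Rintegral => z _; rewrite /= mulrCA.
    exact: integrableM_bfun.
  by apply: bfunM; [exact: (bfun_comp measurable_snd (bx x))|exact: (bfun_comp swap bPhi)].
rewrite (Rintegral_swap iv i1 (f := fun p => gram_vec p.2 * Phi (p.2, p.1))).
  apply: eq_Rintegral => s _; rewrite mul1r expr2 -[in RHS]RintegralZl//.
    by apply: eq_Rintegral => z _; rewrite /= mulrCA.
  exact: integrableM_bfun.
by apply: bfunM; [exact: (bfun_comp measurable_snd bfun_gram_vec)|exact: (bfun_comp swap bPhi)].
Qed.

Lemma weighted_sum I (l : seq I) (c : I -> R) (f : I -> T -> R) : (forall i, bfun (f i)) ->
  \int[m]_x (v x * \sum_(i <- l) c i * f i x) = \sum_(i <- l) c i * \int[m]_x (v x * f i x).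
Proof.
move=> bf; have ifn i : m.-integrable setT (EFin \o (fun x => v x * f i x)).
  exact: integrableM_bfun.
under eq_bigr do rewrite -RintegralZl//.
rewrite -Rintegral_sum.
  by apply: eq_Rintegral => x _; rewrite mulr_sumr; apply: eq_bigr => i _; rewrite mulrCA.
move=> i; have := integrableZl measurableT (c i) (ifn i).
by apply: eq_integrable => // x _ /=.
Qed.

Lemma weighted2_sum I (l : seq I) (c : I -> R) (F : I -> T * T -> R) :
  (forall i, bfun (F i)) ->
  \int[m]_x (v x * \int[m]_z (v z * \sum_(i <- l) c i * F i (x, z))) =
  \sum_(i <- l) c i * \int[m]_x (v x * \int[m]_z (v z * F i (x, z))).
Proof.
move=> bF; rewrite -(weighted_sum l c (f := fun i x => \int[m]_z (v z * F i (x, z)))).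
  apply: eq_Rintegral => x _; congr (_ * _); apply: weighted_sum => i.
  exact: (bfun_section1 (bF i) x).
by move=> i; exact: bfun_partial_integral.
Qed.

End gram.

Section density_measure.
Context d (T : measurableType d) {R : realType} (m : probability T R) (g : T -> \bar R).
Hypotheses (mg : measurable_fun setT g) (g0 : forall x, (0 <= g x)%E).

(** The two proofs are arguments so that the measure structure, which depends on them, can be
    attached to the term. *)
Definition density_measure of measurable_fun setT g & (forall x, (0 <= g x)%E) :=
  fun A => (\int[m]_(x in A) g x)%E.

Local Notation dm := (density_measure mg g0).

Let dm0 : dm set0 = 0%E. Proof. exact: integral_set0. Qed.

Let dm_ge0 A : (0 <= dm A)%E. Proof. exact: integral_ge0. Qed.

Let dm_sigma_additive : semi_sigma_additive dm.
Proof.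
move=> /= F mF tF mUF; rewrite /density_measure; apply: cvg_toP.
  apply: ereal_nondecreasing_is_cvgn => i j ij.
  by apply: lee_sum_nneg_natr => // k _ _; exact: integral_ge0.
by rewrite ge0_integral_bigcup//=; exact: measurable_funTS.
Qed.

HB.instance Definition _ := isMeasure.Build _ _ _ dm dm0 dm_ge0 dm_sigma_additive.

Definition density_meas : {measure set T -> \bar R} := dm.

End density_measure.

(** The positive and negative parts of v are densities of two finite measures that agree on
    quadrants, hence on all measurable sets. *)
Lemma quadrant_integral_unique {R : realType} (m : probability (R * R)%type R) (v : R * R -> R) :
  m.-integrable setT (EFin \o v) ->
  (forall s t, \int[m]_z (v z * (le01 z.1 s * le01 z.2 t)) = 0) -> ae_eq m setT v (cst 0).
Proof.
move=> iv H.
have mv := measurable_int _ iv.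
pose vp := density_meas m (measurable_funepos mv) (funepos_ge0 (EFin \o v)).
pose vm := density_meas m (measurable_funeneg mv) (funeneg_ge0 (EFin \o v)).
have fin (A : set (R * R)) : measurable A -> vp A \is a fin_num /\ vm A \is a fin_num.
  move=> mA; have ivA := integrableS measurableT mA (@subsetT _ A) iv.
  split; apply: integrable_fin_num => //.
    exact: integrable_funepos.
  exact: integrable_funeneg.
have E : forall A, measurable A -> vp A = vm A.
  apply: quadrant_measure_unique.
    by rewrite ltey_eq; have [-> _] := fin setT measurableT.
  move=> x y; set A := _ `*` _.
  have mA : measurable A by apply: measurableX.
  have [fp fm] := fin A mA.
  suff h : (vp A - vm A = 0)%E.
    move: fp fm h; case: (vp A) => // a _; case: (vm A) => // b _ [] /eqP.
    by rewrite subr_eq0 => /eqP ->.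
  have -> : (vp A - vm A = \int[m]_(z in A) (v z)%:E)%E by rewrite [RHS]integralE.
  rewrite -[LHS]fineK; last first.
    by apply: integrable_fin_num => //; exact: (integrableS measurableT mA (@subsetT _ A) iv).
  congr (_%:E); rewrite -[RHS](H x y) -/(Rintegral m A v) Rintegral_mkcond.
  apply: eq_Rintegral => z _; rewrite patchE /le01 -natrM mulnb.
  case: ifPn => [/set_mem[]|/negP zA]; rewrite /= ?in_itv/=.
    by move=> -> ->; rewrite mulr1.
  case: andP => [[h1 h2]|_]; last by rewrite mulr0.
  by exfalso; apply: zA; apply/mem_set; split; rewrite /= in_itv.
have : ae_eq m setT (EFin \o v) (cst 0%E).
  apply: integral_ae_eq => // A _ mA.
  have [fp fm] := fin A mA.
  rewrite integral0 integralE; apply/eqP; rewrite sube_eq ?add0e//.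
  exact/eqP/E.
by apply: filterS => z /= h /h [].
Qed.

(** * Positivity of the quadratic form *)

Section quadratic_form.
Context {R : realType}.
Variable mu : probability (R * R)%type R.
Hypothesis muE : forall A, measurable A -> mu A = prodP U U A.

Definition psi2 (k k' : R) (p : (R * R) * (R * R)) : R :=
  psi k p.1.1 p.2.1 * psi k' p.1.2 p.2.2.

Lemma bfun_psi2 k k' : bfun (psi2 k k').
Proof. by apply: bfunM; apply: bfun_psi; repeat apply: measurableT_comp => //. Qed.

(** A product of Gram kernels is the Gram kernel of the products [psi2], which makes the quadratic
    form a combination of integrated squares. *)
Lemma gkerM (k k' : R) (x z : R * R) : gker k x.1 z.1 * gker k' x.2 z.2 =
  \int[mu]_s (psi2 k k' (s, x) * psi2 k k' (s, z)).
Proof.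
have b (c a b : R) : bfun (fun s => psi c s a * psi c s b).
  by apply: bfunM; apply: bfun_psi => //; exact: measurable_cst.
rewrite /gker -(mu_prod muE (b _ _ _) (b _ _ _)).
by apply: eq_Rintegral => s _; rewrite /psi2 /= mulrACA.
Qed.

Section weight.
Variables (v : R * R -> R) (iv : mu.-integrable setT (EFin \o v)).

Definition weighted_form (K : R * R -> R * R -> R) : R :=
  \int[mu]_x (v x * \int[mu]_z (v z * K x z)).

Lemma weighted_form_kernel2 A : weighted_form (kernel2 mu A) = weighted_form (Kform A).
Proof.
have bK : bfun (fun p : (R * R) * (R * R) => Kform A p.1 p.2).
  exact: (bfun_Kform _ (prodP mu mu)).
have mi (f : (R * R) * (R * R) -> R) : bfun f ->
    measurable_fun setT (fun x => v x * \int[mu]_z (v z * f (x, z))).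
  move=> bf; apply: measurable_funM; first by apply/measurable_EFinP; exact: measurable_int iv.
  by have [] := bfun_partial_integral mu iv bf.
have mv : measurable_fun setT v by apply/measurable_EFinP; exact: measurable_int iv.
apply: ae_eq_Rintegral; [exact: mi (bfun_kernel2 mu A)|exact: mi bK|].
apply: filterS (kernel2_ae muE A) => x Kx _; congr (_ * _).
apply: ae_eq_Rintegral.
- by apply: measurable_funM => //; have [] := bfun_section1 (bfun_kernel2 mu A) x.
- by apply: measurable_funM => //; have [] := bfun_section1 bK x.
- by apply: filterS Kx => z -> _.
Qed.

Lemma weighted_form_gram A : weighted_form (kernel2 mu A) =
  \sum_(k : bool) \sum_(k' : bool)
    coef A k k' * \int[mu]_s (gram_vec mu (psi2 k%:R k'%:R) v s ^+ 2).
Proof.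
rewrite weighted_form_kernel2 pair_bigA /=.
have b (p : bool * bool) : bfun (fun xz : (R * R) * (R * R) =>
    gker p.1%:R xz.1.1 xz.2.1 * gker p.2%:R xz.1.2 xz.2.2).
  by apply: bfunM; apply: (bfun_gker _ (prodP mu mu)); repeat apply: measurableT_comp => //.
transitivity (\int[mu]_x (v x * \int[mu]_z (v z * \sum_(p : bool * bool)
    (coef A p.1 p.2 * (gker p.1%:R x.1 z.1 * gker p.2%:R x.2 z.2))))).
  apply: eq_Rintegral => x _; congr (_ * _); apply: eq_Rintegral => z _; congr (_ * _).
  by rewrite /Kform pair_bigA.
rewrite (weighted2_sum iv _ (fun p => coef A p.1 p.2) b).
apply: eq_bigr => p _; congr (_ * _); rewrite -(gram_form mu (bfun_psi2 _ _) iv).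
apply: eq_Rintegral => x _; congr (_ * _); apply: eq_Rintegral => z _; congr (_ * _).
exact: gkerM.
Qed.

Hypothesis margin1 : forall s : R, 0 <= s <= 1 -> \int[mu]_z (v z * le01 z.1 s) = 0.
Hypothesis margin2 : forall s : R, 0 <= s <= 1 -> \int[mu]_z (v z * le01 z.2 s) = 0.

Let mv : measurable_fun setT v.
Proof. by apply/measurable_EFinP; exact: measurable_int iv. Qed.

Let mvM (f : R * R -> R) : bfun f -> measurable_fun setT (fun z => v z * f z).
Proof. by move=> [mf _]; exact: measurable_funM. Qed.

Lemma ae_weighted (f g : R * R -> R) : bfun f -> bfun g ->
  (forall z, unit_square z -> f z = g z) -> \int[mu]_z (v z * f z) = \int[mu]_z (v z * g z).
Proof.
move=> bf bg fg; apply: ae_eq_Rintegral; [exact: mvM|exact: mvM|].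
by apply: filterS (mu_ae_square muE) => z /fg -> _.
Qed.

Let bl1 (s : R) : bfun (fun z : R * R => le01 z.1 s).
Proof. exact: (bfun_le01 measurable_fst (measurable_cst s)). Qed.
Let bl2 (s : R) : bfun (fun z : R * R => le01 z.2 s).
Proof. exact: (bfun_le01 measurable_snd (measurable_cst s)). Qed.
Let bc1 : bfun (fun z : R * R => clamp z.1).
Proof. exact: (bfun_comp measurable_fst (@bfun_clamp R)). Qed.
Let bc2 : bfun (fun z : R * R => clamp z.2).
Proof. exact: (bfun_comp measurable_snd (@bfun_clamp R)). Qed.

Lemma margin0 : \int[mu]_z (v z * 1) = 0.
Proof.
rewrite -(@margin1 1) ?ler01 ?lexx//; apply: ae_weighted => //; first exact: bfun_cst.
by move=> z [/=]; rewrite !in_itv/= /le01 => /andP[_ ->].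
Qed.

(** On the unit interval x is 1 minus the integral over s of the indicator of x <= s, so this moment
    is an average of vanishing margins. *)
Lemma margin_clamp (f : R * R -> R) : measurable_fun setT f ->
  (forall z, unit_square z -> 0 <= f z <= 1) ->
  (forall s : R, 0 <= s <= 1 -> \int[mu]_z (v z * le01 (f z) s) = 0) ->
  \int[mu]_z (v z * clamp (f z)) = 0.
Proof.
move=> mf f01 fm.
have iU : U.-integrable setT (EFin \o (cst 1 : R -> R)) by exact/integrable_bfun/bfun_cst.
have b : bfun (fun p : (R * R) * R => le01 (f p.1) p.2).
  by apply: bfun_le01 => //; exact: measurableT_comp.
have bi := bfun_partial_integral mu iU b.
(* The two booleans index the terms of this difference. *)
transitivity (\int[mu]_z (v z * \sum_(i <- [:: true; false]) ((if i then 1 else -1) *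
    (if i then 1 else \int[U]_s (1 * le01 (f z) s))))).
  apply: ae_weighted.
  - exact: (bfun_comp mf (@bfun_clamp R)).
  - apply: bfun_sum => i; apply: bfunM; first exact: bfun_cst.
    by case: i; [exact: bfun_cst|exact: bi].
  - move=> z /f01 z01; rewrite !big_cons big_nil clampE//.
    under eq_Rintegral do rewrite mul1r.
    by rewrite int_le_l//; ring.
rewrite (weighted_sum iv _ (fun i : bool => if i then 1 else -1)
    (f := fun (i : bool) z => if i then 1 else \int[U]_s (1 * le01 (f z) s))); last first.
  by case; [exact: bfun_cst|exact: bi].
rewrite !big_cons big_nil margin0 (Rintegral_swap iv iU b).
rewrite [X in -1 * X](_ : _ = 0) ?mulr0 ?addr0//.
rewrite -[RHS](Rintegral_cst1 U); apply: ae_eq_Rintegral.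
- suff [] : bfun (fun s => 1 * \int[mu]_z (v z * le01 (f z) s)) by [].
  apply: bfunM; first exact: bfun_cst.
  apply: (bfun_partial_integral U iv (f := fun p => le01 (f p.2) p.1)).
  by apply: bfun_le01 => //; exact: measurableT_comp.
- exact: measurable_cst.
- by apply: filterS (@U_ae01 R) => s s01 _; rewrite fm// mulr0.
Qed.

Let f01_1 (z : R * R) : unit_square z -> 0 <= z.1 <= 1.
Proof. by move=> [/=]; rewrite in_itv. Qed.
Let f01_2 (z : R * R) : unit_square z -> 0 <= z.2 <= 1.
Proof. by move=> [/=]; rewrite !in_itv. Qed.

(** The product of the two factors has nine terms; the five that depend on at most one coordinate
    vanish by the margin conditions. *)
Lemma gram_vec_psi2 (k k' s t : R) : 0 <= s <= 1 -> 0 <= t <= 1 ->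
  gram_vec mu (psi2 k k') v (s, t) =
  \int[mu]_z (v z * (le01 z.1 s * le01 z.2 t)) +
  k' * \int[mu]_z (v z * (le01 z.1 s * clamp z.2)) +
  k * \int[mu]_z (v z * (clamp z.1 * le01 z.2 t)) +
  k * k' * \int[mu]_z (v z * (clamp z.1 * clamp z.2)).
Proof.
move=> s01 t01.
pose a := - clamp s - k / 2; pose b := - clamp t - k' / 2.
pose l := [:: (1, fun z : R * R => le01 z.1 s * le01 z.2 t);
  (k', fun z => le01 z.1 s * clamp z.2); (k, fun z => clamp z.1 * le01 z.2 t);
  (k * k', fun z => clamp z.1 * clamp z.2); (a, fun z => le01 z.2 t);
  (a * k', fun z => clamp z.2); (a * b, fun=> 1); (b, fun z => le01 z.1 s);
  (b * k, fun z => clamp z.1)].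
pose g (i : 'I_9) := nth (0, fun=> 0) l i.
transitivity (\int[mu]_z (v z * \sum_(i < 9) (g i).1 * (g i).2 z)).
  apply: eq_Rintegral => z _; congr (_ * _).
  rewrite /g !big_ord_recl big_ord0 /psi2 /psi /= /a /b; ring.
rewrite (weighted_sum iv _ (fun i => (g i).1) (f := fun i z => (g i).2 z)); last first.
  move=> i; rewrite /g; case: i => [] [|[|[|[|[|[|[|[|[|//]]]]]]]]] _ /=;
    by [exact: bfunM|exact: bl1|exact: bl2|exact: bc1|exact: bc2|exact: bfun_cst].
rewrite /g !big_ord_recl big_ord0 /=.
rewrite (margin1 s01) (margin2 t01) margin0 (margin_clamp measurable_fst f01_1 margin1).
rewrite (margin_clamp measurable_snd f01_2 margin2); ring.
Qed.

Lemma bounded_cvg (u : R^nat) (s : R) : (forall n, s < u n < s + n.+1%:R^-1) -> u @ \oo --> s.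
Proof.
move=> H; apply: (@squeeze_cvgr _ _ _ _ (cst s) (fun n => s + n.+1%:R^-1)).
- by apply: nearW => n /=; have /andP[/ltW -> /ltW ->] := H n.
- exact: cvg_cst.
- by rewrite -[X in _ --> X]addr0; apply: cvgD; [exact: cvg_cst|exact: cvg_harmonic].
Qed.

(** The indicator of x <= s is continuous in s only from the right, which is why the approximating
    points lie strictly above s. *)
Lemma psi_right_cvg (k x s : R) (u : R^nat) : 0 <= s -> (forall n, s < u n) ->
  (forall n, u n <= 1) -> u @ \oo --> s -> psi k (u n) x @[n --> \oo] --> psi k s x.
Proof.
move=> s0 su u1 us.
apply: cvgB; last exact: cvg_cst.
apply: cvgB.
  have [xs|sx] := leP x s.
    apply: cvg_near_cst; apply: nearW => n.
    by rewrite /le01 xs (le_trans xs (ltW (su n))).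
  apply: cvg_near_cst.
  have near_s : \forall n \near \oo, u n < x by apply: (cvgr_lt s us).
  apply: filterS near_s => n unx.
  by rewrite /le01 !leNgt unx sx.
rewrite clampE; last by rewrite s0 (ltW (lt_le_trans (su 0%N) (u1 0%N))).
rewrite (_ : (fun n => clamp (u n)) = u)//; apply: funext => n.
by rewrite clampE// u1 (le_trans s0 (ltW (su n))).
Qed.

Lemma gram_vec_right_cvg (k k' s t : R) (u : nat -> R * R) : 0 <= s -> 0 <= t ->
  (forall n, s < (u n).1) -> (forall n, t < (u n).2) ->
  (forall n, (u n).1 <= 1) -> (forall n, (u n).2 <= 1) ->
  (fun n => (u n).1) @ \oo --> s -> (fun n => (u n).2) @ \oo --> t ->
  gram_vec mu (psi2 k k') v (u n) @[n --> \oo] --> gram_vec mu (psi2 k k') v (s, t).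
Proof.
move=> s0 t0 su tu u1 u2 us ut.
have [_ [M pM]] := bfun_psi2 k k'.
have M0 : 0 <= M by rewrite (le_trans _ (pM ((0, 0), (0, 0)))).
have bs p : bfun (fun z => psi2 k k' (p, z)) := bfun_section1 (bfun_psi2 k k') p.
have igr p : mu.-integrable setT (EFin \o (fun z => v z * psi2 k k' (p, z))).
  exact: integrableM_bfun.
have iM : mu.-integrable setT (fun z => (M * `|v z|)%:E).
  have := integrableZl measurableT M (integrable_abse iv).
  by apply: eq_integrable => // z _ /=.
have cvg : {ae mu, forall z, setT z ->
    (v z * psi2 k k' (u n, z))%:E @[n --> \oo] --> (v z * psi2 k k' ((s, t), z))%:E}.
  apply: aeW => z _; apply: cvg_EFin; first exact: nearW.
  apply: cvgM; first exact: cvg_cst.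
  by apply: cvgM; exact: psi_right_cvg.
have dom : {ae mu, forall z n, setT z -> (`|(v z * psi2 k k' (u n, z))%:E| <= (M * `|v z|)%:E)%E}.
  by apply: aeW => z n _; rewrite lee_fin normrM mulrC ler_wpM2r.
have [_ _ H] := dominated_convergence measurableT
  (fun n => measurable_int _ (igr (u n))) (measurable_int _ (igr (s, t))) cvg iM dom.
apply: fine_cvg; rewrite /gram_vec /Rintegral fineK; first exact: H.
exact: (integrable_fin_num measurableT (igr (s, t))).
Qed.

(** Points where the function vanishes are found in boxes shrinking to (s, t) from the upper right,
    where it is continuous; so it vanishes everywhere and not only almost everywhere. *)
Lemma gram_vec_eq0 (k k' s t : R) :
  {ae mu, forall p, gram_vec mu (psi2 k k') v p = 0} ->
  0 <= s < 1 -> 0 <= t < 1 -> gram_vec mu (psi2 k k') v (s, t) = 0.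
Proof.
move=> D0 /andP[s0 s1] /andP[t0 t1].
have h n : exists p : R * R, [/\ gram_vec mu (psi2 k k') v p = 0,
    s < p.1 < Num.min (s + n.+1%:R^-1) 1 & t < p.2 < Num.min (t + n.+1%:R^-1) 1].
  have n0 : (0 : R) < n.+1%:R^-1 by rewrite invr_gt0 ltr0n.
  apply: (mu_box_point muE D0) => //; rewrite ?ge_min ?lexx ?orbT//.
    by rewrite lt_min s1 ltrDl n0.
  by rewrite lt_min t1 ltrDl n0.
have [u uP] := choice h.
have b1 n : s < (u n).1 < s + n.+1%:R^-1.
  by have [_ /andP[-> ]] := uP n; rewrite lt_min => /andP[].
have b2 n : t < (u n).2 < t + n.+1%:R^-1.
  by have [_ _ /andP[-> ]] := uP n; rewrite lt_min => /andP[].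
have c1 n : (u n).1 <= 1 by have [_ /andP[_ ]] := uP n; rewrite lt_min => /andP[_ /ltW].
have c2 n : (u n).2 <= 1 by have [_ _ /andP[_ ]] := uP n; rewrite lt_min => /andP[_ /ltW].
have := @gram_vec_right_cvg k k' s t u s0 t0 (fun n => proj1 (andP (b1 n)))
  (fun n => proj1 (andP (b2 n))) c1 c2 (bounded_cvg b1) (bounded_cvg b2).
have -> : (fun n => gram_vec mu (psi2 k k') v (u n)) = cst 0.
  by apply: funext => n; have [] := uP n.
by move=> /cvg_lim <-//; rewrite lim_cst.
Qed.

Lemma weighted_le0 (f g : R * R -> R) : bfun g -> measurable_fun setT f ->
  {ae mu, forall z, 0 < f z} -> \int[mu]_z (v z * (le01 (f z) 0 * g z)) = 0.
Proof.
move=> bg mf f0; have bl := bfun_le01 mf (measurable_cst (0 : R)).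
rewrite -[RHS](Rintegral_cst1 mu); apply: ae_eq_Rintegral.
- by apply: mvM; exact: bfunM.
- exact: measurable_cst.
- by apply: filterS f0 => z z0 _; rewrite /le01 leNgt z0 mul0r mulr0.
Qed.

Lemma mu_ae_gt0 : {ae mu, forall z, 0 < z.1 /\ 0 < z.2}.
Proof.
apply: filterS2 (mu_ae_neq muE (0, 0)) (mu_ae_square muE) => z /= [n1 n2] [/=].
by rewrite !in_itv/= => /andP[z1 _] /andP[z2 _]; rewrite !lt_def ![_ == 0]eq_sym n1 n2.
Qed.

Lemma gram_vec_weight_eq0 (k k' : R) :
  {ae mu, forall p, gram_vec mu (psi2 k k') v p = 0} -> ae_eq mu setT v (cst 0).
Proof.
move=> D0.
have ae1 : {ae mu, forall z : R * R, 0 < z.1} by apply: filterS mu_ae_gt0 => z [].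
have ae2 : {ae mu, forall z : R * R, 0 < z.2} by apply: filterS mu_ae_gt0 => z [].
have z1 g bg := @weighted_le0 fst g bg measurable_fst ae1.
have z2 g (bg : bfun g) : \int[mu]_z (v z * (g z * le01 z.2 0)) = 0.
  etransitivity; last exact: (@weighted_le0 snd g bg measurable_snd ae2).
  by apply: eq_Rintegral => z _; rewrite [g z * _]mulrC.
have h0 : (0 <= 0 :> R) && (0 < 1 :> R) by rewrite lexx ltr01.
have w (x : R) : 0 <= x < 1 -> 0 <= x <= 1 by move=> /andP[-> /ltW].
have Q0 s t : 0 <= s < 1 -> 0 <= t < 1 -> \int[mu]_z (v z * (le01 z.1 s * le01 z.2 t)) = 0.
  move=> s01 t01.
  (* At argument 0 the indicator is almost surely 0. Hence (0,0) leaves only the last of the four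
     terms, (s,0) and (0,t) add one mixed term each, and with all three known to vanish (s,t)
     isolates the quadrant integral. *)
  have := gram_vec_eq0 D0 h0 h0; rewrite gram_vec_psi2 ?w// !z1// !z2// => B0.
  have := gram_vec_eq0 D0 s01 h0; rewrite gram_vec_psi2 ?w// !z2// => A0.
  have := gram_vec_eq0 D0 h0 t01; rewrite gram_vec_psi2 ?w// !z1// => A0'.
  have := gram_vec_eq0 D0 s01 t01; rewrite gram_vec_psi2 ?w// => E.
  by lra.
(* For s = 1 or t = 1 the quadrant is a strip, and the integral is a margin. *)
have Q1 s t : 0 <= s <= 1 -> 0 <= t <= 1 -> \int[mu]_z (v z * (le01 z.1 s * le01 z.2 t)) = 0.
  move=> /andP[s0 s1] /andP[t0 t1].
  have [s1'|s1'] := ltP s 1; last first.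
    rewrite -(@margin2 t) ?t0//; apply: ae_weighted => //; first exact: bfunM.
    by move=> z /f01_1 /andP[_ z11]; rewrite /le01 (le_trans z11 s1') mul1r.
  have [t1'|t1'] := ltP t 1; last first.
    rewrite -(@margin1 s) ?s0//; apply: ae_weighted => //; first exact: bfunM.
    by move=> z /f01_2 /andP[_ z11]; rewrite /le01 (le_trans z11 t1') mulr1.
  by apply: Q0; rewrite ?s0 ?t0.
have le01_clamp (x s : R) : 0 <= x <= 1 -> le01 x s = (0 <= s)%R%:R * le01 x (clamp s).
  move=> /andP[x0 x1]; rewrite /le01 -natrM mulnb /clamp; congr (_%:R); congr nat_of_bool.
  have [s0|s0] := leP 0 s; last by rewrite leNgt (lt_le_trans s0 x0).
  rewrite /= le_max le_min x1 andbT; apply/idP/orP => [->|[x0'|//]]; first by right.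
  exact: le_trans x0' s0.
apply: (quadrant_integral_unique iv) => s t.
transitivity (\int[mu]_z (v z * ((0 <= s)%R%:R * (0 <= t)%R%:R * (le01 z.1 (clamp s) * le01 z.2 (clamp t))))).
  apply: ae_weighted.
  - exact: bfunM.
  - by apply: bfunM; [exact: bfun_cst|exact: bfunM].
  - by move=> z sz; rewrite (le01_clamp z.1 s (f01_1 sz)) (le01_clamp z.2 t (f01_2 sz)) mulrACA.
transitivity (((0 <= s)%R%:R * (0 <= t)%R%:R) *
    \int[mu]_z (v z * (le01 z.1 (clamp s) * le01 z.2 (clamp t)))).
  rewrite -RintegralZl//; last by apply: integrableM_bfun => //; exact: bfunM.
  by apply: eq_Rintegral => z _; rewrite mulrCA.
by rewrite Q1 ?mulr0// clamp01.
Qed.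

Lemma weighted_form_gt0 A : ~ ae_eq mu setT v (cst 0) -> 0 < weighted_form (kernel2 mu A).
Proof.
move=> v0; rewrite weighted_form_gram.
have h (k k' : bool) : 0 < \int[mu]_s (gram_vec mu (psi2 k%:R k'%:R) v s ^+ 2).
  rewrite lt_neqAle Rintegral_ge0 ?andbT; last by move=> x _; exact: sqr_ge0.
  apply/eqP => /esym H; apply: v0; apply: (@gram_vec_weight_eq0 k%:R k'%:R).
  have bD := bfun_gram_vec mu (bfun_psi2 k%:R k'%:R) iv.
  have bD2 : bfun (fun s => gram_vec mu (psi2 k%:R k'%:R) v s ^+ 2) by exact: bfunM.
  have /(ae_eq_integral_abs mu measurableT) : measurable_fun setT
      (EFin \o (fun s => gram_vec mu (psi2 k%:R k'%:R) v s ^+ 2)).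
    by apply/measurable_EFinP; case: bD2.
  case=> + _ => /(_ _)/wrap[].
    have fi := integrable_fin_num measurableT (integrable_bfun mu bD2).
    under eq_integral do rewrite /= ger0_norm ?sqr_ge0//.
    by rewrite -[LHS]fineK// -/(Rintegral mu setT _) H.
  by apply: filterS => x /(_ I) [] /eqP; rewrite sqrf_eq0 => /eqP.
(* The integrals are abstracted to positive numbers: all coefficients are nonnegative, and each
   statistic has a positive one. *)
have [I [I0 ->]] : exists I : bool -> bool -> R, (forall k k', 0 < I k k') /\
    \sum_(k : bool) \sum_(k' : bool)
      coef A k k' * \int[mu]_s (gram_vec mu (psi2 k%:R k'%:R) v s ^+ 2) =
    \sum_(k : bool) \sum_(k' : bool) coef A k k' * I k k'.
  by exists (fun k k' : bool => \int[mu]_s (gram_vec mu (psi2 k%:R k'%:R) v s ^+ 2)).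
have := (I0 true true, I0 true false, I0 false true, I0 false false).
by rewrite !big_bool => -[[[]]]; case: A => /=; lra.
Qed.

End weight.
End quadratic_form.

(** * Four-fold weighted integrals *)

Lemma weighted_norm_le d (T : measurableType d) {R : realType} (m : probability T R)
    (u F : T -> R) (M : R) : m.-integrable setT (EFin \o u) -> bfun F ->
  (forall x, `|F x| <= M) -> `|\int[m]_x (u x * F x)| <= (\int[m]_x `|u x|) * M.
Proof.
move=> iu bF FM.
have iuF := integrableM_bfun iu bF.
have iau : m.-integrable setT (EFin \o (fun x => `|u x|)) by exact: (integrable_abse iu).
rewrite (le_trans (le_normr_Rintegral measurableT iuF))// -RintegralZr//.
apply: le_Rintegral => //.
- exact: (integrable_abse iuF).
- have := integrableZr measurableT M iau.
  by apply: eq_integrable => // x _ /=.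
- by move=> x _; rewrite normrM ler_wpM2l.
Qed.

Lemma weighted_swap d (T : measurableType d) {R : realType} (m : probability T R)
    (u v : T -> R) (F : T -> T -> R) : m.-integrable setT (EFin \o u) ->
  m.-integrable setT (EFin \o v) -> bfun (fun p : T * T => F p.1 p.2) ->
  (forall x y, F x y = F y x) ->
  \int[m]_x (u x * \int[m]_y (v y * F x y)) = \int[m]_x (v x * \int[m]_y (u y * F x y)).
Proof.
move=> iu iv bF Fsym; rewrite [LHS](Rintegral_swap iu iv bF) /=.
by congr Rintegral; apply: funext => y; congr (_ * Rintegral _ _ _); apply: funext => x;
  rewrite Fsym.
Qed.

Section four_fold.
Context d (T : measurableType d) {R : realType} (m : probability T R).
Variable H : T -> T -> T -> T -> R.
Hypothesis bH : forall d' (S : measurableType d') (f1 f2 f3 f4 : S -> T),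
  measurable_fun setT f1 -> measurable_fun setT f2 -> measurable_fun setT f3 ->
  measurable_fun setT f4 -> bfun (fun s => H (f1 s) (f2 s) (f3 s) (f4 s)).

Definition weight u := m.-integrable setT (EFin \o (u : T -> R)).

(** The integral is built up one variable at a time, so that neighbouring weights can be exchanged
    by Fubini and the symmetry of H. *)
Definition H3 u4 x y z := \int[m]_w (u4 w * H x y z w).
Definition H2 u3 u4 x y := \int[m]_z (u3 z * H3 u4 x y z).
Definition H1 u2 u3 u4 x := \int[m]_y (u2 y * H2 u3 u4 x y).
Definition I4 u1 u2 u3 u4 := \int[m]_x (u1 x * H1 u2 u3 u4 x).

Lemma bfun_H3 u4 d' (S : measurableType d') (f1 f2 f3 : S -> T) (n : probability S R) :
  weight u4 -> measurable_fun setT f1 -> measurable_fun setT f2 -> measurable_fun setT f3 ->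
  bfun (fun s => H3 u4 (f1 s) (f2 s) (f3 s)).
Proof.
move=> w4 m1 m2 m3.
apply: (bfun_partial_integral n w4 (f := fun p => H (f1 p.1) (f2 p.1) (f3 p.1) p.2)).
by apply: bH => //; exact: measurableT_comp.
Qed.

Lemma bfun_H2 u3 u4 d' (S : measurableType d') (f1 f2 : S -> T) (n : probability S R) :
  weight u3 -> weight u4 -> measurable_fun setT f1 -> measurable_fun setT f2 ->
  bfun (fun s => H2 u3 u4 (f1 s) (f2 s)).
Proof.
move=> w3 w4 m1 m2.
apply: (bfun_partial_integral n w3 (f := fun p => H3 u4 (f1 p.1) (f2 p.1) p.2)).
by apply: (bfun_H3 (prodP n m)) => //; exact: measurableT_comp.
Qed.

Lemma bfun_H1 u2 u3 u4 : weight u2 -> weight u3 -> weight u4 -> bfun (H1 u2 u3 u4).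
Proof.
move=> w2 w3 w4.
apply: (bfun_partial_integral m w2 (f := fun p => H2 u3 u4 p.1 p.2)).
exact: (bfun_H2 (prodP m m)).
Qed.

Hypothesis sym12 : forall x y z w, H x y z w = H y x z w.
Hypothesis sym23 : forall x y z w, H x y z w = H x z y w.
Hypothesis sym34 : forall x y z w, H x y z w = H x y w z.

Lemma H3_sym u4 x y z : H3 u4 x y z = H3 u4 y x z /\ H3 u4 x y z = H3 u4 x z y.
Proof.
by split; congr Rintegral; apply: funext => w; [rewrite sym12|rewrite sym23].
Qed.

Lemma H2_sym u3 u4 x y : H2 u3 u4 x y = H2 u3 u4 y x.
Proof. by congr Rintegral; apply: funext => z; rewrite (proj1 (H3_sym _ _ _ _)). Qed.

Lemma I4_swap12 u1 u2 u3 u4 : weight u1 -> weight u2 -> weight u3 -> weight u4 ->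
  I4 u1 u2 u3 u4 = I4 u2 u1 u3 u4.
Proof.
move=> w1 w2 w3 w4; apply: (weighted_swap w1 w2 _ (H2_sym u3 u4)).
exact: (bfun_H2 (prodP m m)).
Qed.

Lemma I4_swap23 u1 u2 u3 u4 : weight u1 -> weight u2 -> weight u3 -> weight u4 ->
  I4 u1 u2 u3 u4 = I4 u1 u3 u2 u4.
Proof.
move=> w1 w2 w3 w4; suff E : H1 u2 u3 u4 = H1 u3 u2 u4 by rewrite /I4 E.
apply: funext => x.
apply: (weighted_swap w2 w3 _ (fun y z => proj2 (H3_sym u4 x y z))).
by apply: (bfun_H3 (prodP m m)) => //; exact: measurable_cst.
Qed.

Lemma I4_swap34 u1 u2 u3 u4 : weight u1 -> weight u2 -> weight u3 -> weight u4 ->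
  I4 u1 u2 u3 u4 = I4 u1 u2 u4 u3.
Proof.
move=> w1 w2 w3 w4; suff E : H2 u3 u4 = H2 u4 u3 by rewrite /I4 /H1 E.
apply: funext => x; apply: funext => y; apply: (weighted_swap w3 w4 _ (sym34 x y)).
by apply: bH => //; exact: measurable_cst.
Qed.

Lemma weight_cst c : weight (fun=> c).
Proof. exact/integrable_bfun/bfun_cst. Qed.

Lemma weightZ c u : weight u -> weight (fun x => c * u x).
Proof. by move=> wu; have := integrableZl measurableT c wu; apply: eq_integrable => // x _ /=. Qed.

Lemma weightD u v : weight u -> weight v -> weight (fun x => u x + v x).
Proof. by move=> wu wv; have := integrableD measurableT wu wv; apply: eq_integrable => // x _ /=. Qed.

Lemma I4D u v u2 u3 u4 : weight u -> weight v -> weight u2 -> weight u3 -> weight u4 ->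
  I4 (fun x => u x + v x) u2 u3 u4 = I4 u u2 u3 u4 + I4 v u2 u3 u4.
Proof.
move=> wu wv w2 w3 w4; have b1 := bfun_H1 w2 w3 w4.
rewrite /I4 -RintegralD//; [|exact: integrableM_bfun|exact: integrableM_bfun].
by apply: eq_Rintegral => x _; rewrite mulrDl.
Qed.

Lemma I4Z c u u2 u3 u4 : weight u -> weight u2 -> weight u3 -> weight u4 ->
  I4 (fun x => c * u x) u2 u3 u4 = c * I4 u u2 u3 u4.
Proof.
move=> wu w2 w3 w4; have b1 := bfun_H1 w2 w3 w4.
rewrite /I4 -RintegralZl//; last exact: integrableM_bfun.
by apply: eq_Rintegral => x _; rewrite mulrA.
Qed.

Lemma I4_le (M : R) u1 u2 u3 u4 : weight u1 -> weight u2 -> weight u3 -> weight u4 ->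
  (forall x y z w, `|H x y z w| <= M) ->
  `|I4 u1 u2 u3 u4| <= (\int[m]_x `|u1 x|) * ((\int[m]_x `|u2 x|) *
     ((\int[m]_x `|u3 x|) * ((\int[m]_x `|u4 x|) * M))).
Proof.
move=> w1 w2 w3 w4 HM.
apply: weighted_norm_le => // [|x]; first exact: bfun_H1.
apply: weighted_norm_le => // [|y].
  by apply: (bfun_H2 m) => //; exact: measurable_cst.
apply: weighted_norm_le => // [|z].
  by apply: (bfun_H3 m) => //; exact: measurable_cst.
by apply: weighted_norm_le => // ; apply: bH => //; exact: measurable_cst.
Qed.

Let e : T -> R := fun=> 1.
Let we : weight e := weight_cst 1.

Lemma I4_expansion v : weight v ->
  let dv := (fun x => 1 + v x) in
  I4 dv dv dv dv = I4 e e e e + 4 * I4 v e e e + 6 * I4 v v e e + 4 * I4 v v v e + I4 v v v v.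
Proof.
move=> wv dv; have wd : weight dv by exact: weightD.
have X1 u2 u3 u4 (w2 : weight u2) (w3 : weight u3) (w4 : weight u4) :
    I4 dv u2 u3 u4 = I4 e u2 u3 u4 + I4 v u2 u3 u4 by exact: I4D.
have X2 u1 u3 u4 (w1 : weight u1) (w3 : weight u3) (w4 : weight u4) :
    I4 u1 dv u3 u4 = I4 u1 e u3 u4 + I4 u1 v u3 u4.
  by rewrite (I4_swap12 w1 wd w3 w4) (I4_swap12 w1 we w3 w4) (I4_swap12 w1 wv w3 w4) X1.
have X3 u1 u2 u4 (w1 : weight u1) (w2 : weight u2) (w4 : weight u4) :
    I4 u1 u2 dv u4 = I4 u1 u2 e u4 + I4 u1 u2 v u4.
  by rewrite (I4_swap23 w1 w2 wd w4) (I4_swap23 w1 w2 we w4) (I4_swap23 w1 w2 wv w4) X2.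
have X4 u1 u2 u3 (w1 : weight u1) (w2 : weight u2) (w3 : weight u3) :
    I4 u1 u2 u3 dv = I4 u1 u2 u3 e + I4 u1 u2 u3 v.
  by rewrite (I4_swap34 w1 w2 w3 wd) (I4_swap34 w1 w2 w3 we) (I4_swap34 w1 w2 w3 wv) X3.
have S1 a b (wa : weight a) (wb : weight b) : I4 e v a b = I4 v e a b by exact: I4_swap12.
have S2 a b (wa : weight a) (wb : weight b) : I4 a e v b = I4 a v e b by exact: I4_swap23.
have S3 a b (wa : weight a) (wb : weight b) : I4 a b e v = I4 a b v e by exact: I4_swap34.
(* From here on only additivity and the exchange rules matter; making [I4] opaque keeps rewriting on
   the sixteen terms simple. *)
move: (I4) X1 X2 X3 X4 S1 S2 S3 => J X1 X2 X3 X4 S1 S2 S3.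
rewrite (X1 _ _ _ wd wd wd) (X2 _ _ _ we wd wd) (X2 _ _ _ wv wd wd).
rewrite (X3 _ _ _ we we wd) (X3 _ _ _ we wv wd) (X3 _ _ _ wv we wd) (X3 _ _ _ wv wv wd).
rewrite (X4 _ _ _ we we we) (X4 _ _ _ we we wv) (X4 _ _ _ we wv we) (X4 _ _ _ we wv wv).
rewrite (X4 _ _ _ wv we we) (X4 _ _ _ wv we wv) (X4 _ _ _ wv wv we) (X4 _ _ _ wv wv wv).
(* Each rewrite moves a v to the left past a constant weight; afterwards a term depends only on the
   number of its v's, whence the binomial coefficients. *)
do 4!rewrite ?(S1 _ _ we we) ?(S1 _ _ we wv) ?(S1 _ _ wv we) ?(S1 _ _ wv wv)
  ?(S2 _ _ we we) ?(S2 _ _ we wv) ?(S2 _ _ wv we) ?(S2 _ _ wv wv)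
  ?(S3 _ _ we we) ?(S3 _ _ we wv) ?(S3 _ _ wv we) ?(S3 _ _ wv wv).
ring.
Qed.

(** With g = u - v, symmetry turns the difference of the two quadratic terms into I(g,u) + I(g,v);
    the factor 2 is the bound of the kernel. *)
Lemma I4_near u v : weight u -> weight v ->
  (forall x y z w, `|H x y z w| <= 2) ->
  `|I4 u u e e - I4 v v e e| <=
    2 * (\int[m]_x `|u x - v x|) * ((\int[m]_x `|u x|) + \int[m]_x `|v x|).
Proof.
move=> wu wv H2'.
pose g x := u x - v x.
have wg : weight g.
  by have := integrableB measurableT wu wv; apply: eq_integrable => // x _ /=.
have ug : u = (fun x => v x + g x) by apply: funext => x; rewrite /g addrC subrK.
have D a (wa : weight a) : I4 u a e e = I4 v a e e + I4 g a e e.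
  by rewrite -(I4D wv wg wa we we) -ug.
have -> : I4 u u e e - I4 v v e e = I4 g u e e + I4 g v e e.
  by rewrite (D _ wu) (I4_swap12 wv wu we we) (D _ wv) addrAC [I4 v v e e + _]addrC addrK addrC.
have ne : \int[m]_x `|e x| = 1 by rewrite /e normr1; exact: Rintegral_cst1.
rewrite (le_trans (ler_normD _ _))//.
have := I4_le wg wu we we H2'; have := I4_le wg wv we we H2'.
by rewrite !ne -/g; set N := \int[m]_x `|g x|; set a := \int[m]_x `|u x|;
  set b := \int[m]_x `|v x|; nra.
Qed.

End four_fold.

Section kernel4_symmetry.
Context {R : realType}.
Implicit Types x y z w : R * R.

Lemma kernel4_perm A (z : 'I_4 -> R * R) (t : 'S_4) : kernel4 A (fun i => z (t i)) = kernel4 A z.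
Proof. by apply: T_stat_eq; exact: sample_perm_permute. Qed.

Lemma kernel4_tperm A (u v : 4.-tuple (R * R)) (i j : 'I_4) :
  (forall k, tnth v k = tnth u (tperm i j k)) -> kernel4 A (tnth u) = kernel4 A (tnth v).
Proof. by move=> /funext ->; rewrite kernel4_perm. Qed.

Lemma kernel4_swap12 A x y z w : kernel4 A (tnth [tuple x; y; z; w]) = kernel4 A (tnth [tuple y; x; z; w]).
Proof.
apply: (@kernel4_tperm _ _ _ (inord 0) (inord 1)) => k.
by case: (ord4P k) => ->; rewrite ?tpermL ?tpermR ?tpermD -?val_eqE /= ?inordK// !(tnth_nth 0)/= !inordK.
Qed.

Lemma kernel4_swap23 A x y z w : kernel4 A (tnth [tuple x; y; z; w]) = kernel4 A (tnth [tuple x; z; y; w]).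
Proof.
apply: (@kernel4_tperm _ _ _ (inord 1) (inord 2)) => k.
by case: (ord4P k) => ->; rewrite ?tpermL ?tpermR ?tpermD -?val_eqE /= ?inordK// !(tnth_nth 0)/= !inordK.
Qed.

Lemma kernel4_swap34 A x y z w : kernel4 A (tnth [tuple x; y; z; w]) = kernel4 A (tnth [tuple x; y; w; z]).
Proof.
apply: (@kernel4_tperm _ _ _ (inord 2) (inord 3)) => k.
by case: (ord4P k) => ->; rewrite ?tpermL ?tpermR ?tpermD -?val_eqE /= ?inordK// !(tnth_nth 0)/= !inordK.
Qed.

End kernel4_symmetry.

(** * Expansion of the mean *)

Section expansion.
Context {R : realType} (Theta : set R) (P : R -> probability (R * R)%type R)
  (qq : R -> R * R -> R) (q : R * R -> R) (family : copula_family Theta P qq q).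

Lemma P0_prod B : measurable B -> P 0 B = prodP U U B.
Proof.
move=> mB; apply: (@rectangle_measure_unique _ _ _ _ _ (P 0) (prodP U U)) => //.
  by rewrite (le_lt_trans (probability_le1 _ _))// ltry.
move=> X Y mX mY; transitivity (U X * U Y)%E; last exact/esym/prodPE.
have -> : U X = lebesgue_measure (X `&` `[0, 1]%classic) := U_measure mX.
have -> : U Y = lebesgue_measure (Y `&` `[0, 1]%classic) := U_measure mY.
etransitivity; first by apply: (P0_uniform family); exact: measurableX.
by rewrite /unit_square -setXI product_measure1E//; exact: measurableI.
Qed.

(** The family specifies the density through probabilities of sets; it is identified with the
    Radon-Nikodym derivative, whose change of variables formula then applies. *)
Lemma expectation_density t (f : R * R -> R) : Theta t -> bfun f ->
  \int[P t]_z f z = \int[P 0]_z ((1 + t * qq t z) * f z).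
Proof.
move=> Tt bf; congr fine.
have dom : P t `<< P 0 by apply/null_content_dominatesP => B mB; exact: (dominated family Tt mB).
rewrite -(Radon_Nikodym_change_of_variables dom measurableT (integrable_bfun (P t) bf)).
have ide := integrable_density family Tt.
have E : ae_eq (P 0) setT (Radon_Nikodym (charge_of_finite_measure (P t)) (P 0))
    (EFin \o (fun z => 1 + t * qq t z)).
  apply: integral_ae_eq => //.
  - exact: Radon_Nikodym_integrable.
  - exact: measurable_int ide.
  - by move=> B _ mB; rewrite -Radon_Nikodym_integral//= (P_density family Tt mB).
have mf : measurable_fun setT (EFin \o f) by apply/measurable_EFinP; case: bf.
apply: ae_eq_integral => //.
- apply: emeasurable_funM => //; apply: measurable_int; exact: Radon_Nikodym_integrable.
- apply/measurable_EFinP; apply: measurable_funM; last by case: bf.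
  by apply/measurable_EFinP; exact: measurable_int ide.
- by apply: filterS E => z Ez _; rewrite /= Ez// muleC.
Qed.

(** The L^1 distance suffices because the kernels are bounded; it is at most the L^2 distance since
    [P 0] is a probability. *)
Definition dist t : R := \int[P 0]_z `|qq t z - q z|.

Lemma near_Theta : \forall t \near (0 : R)^', Theta t.
Proof.
apply: nbhs_dnbhs; apply: open_nbhs_nbhs; split.
  exact: Theta_open family.
exact: Theta_0 family.
Qed.

Lemma weight_diff t : Theta t -> weight (P 0) (fun z => qq t z - q z).
Proof.
move=> Tt; have := integrableB measurableT (integrable_qq family Tt) (integrable_q family).
by apply: eq_integrable => // z _ /=.
Qed.

Lemma dist_le t : Theta t ->
  ((dist t)%:E <= 'N[P 0%R]_2%:E[EFin \o (fun z => qq t z - q z)%R])%E.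
Proof.
move=> Tt; have wd := weight_diff Tt.
have md : measurable_fun setT (fun z => qq t z - q z).
  by apply/measurable_EFinP; exact: measurable_int wd.
have := @hoelder _ _ _ (P 0) (fun z => qq t z - q z) (cst 1) 2 2 md (measurable_cst _).
rewrite Lnorm_cst1 [X in poweR X]probability_setT poweR1r mule1.
have -> : ((fun z => qq t z - q z) \* cst 1)%R = (fun z => qq t z - q z).
  by apply: funext => z /=; rewrite mulr1.
rewrite Lnorm1 /dist /Rintegral fineK; last first.
  exact: (integrable_fin_num measurableT (integrable_abse wd)).
by apply; rewrite ?ltr0n//; lra.
Qed.

Lemma dist_ge0 t : 0 <= dist t.
Proof. by apply: Rintegral_ge0. Qed.

Lemma dist_cvg0 : dist t @[t --> (0 : R)^'] --> (0 : R).
Proof.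
have H : (dist t)%:E @[t --> (0 : R)^'] --> (0 : R)%:E.
  apply: (@squeeze_cvge _ _ _ _ (cst 0%E) _ _ _ _ (cvg_cst _) (qq_cvg family)).
  by apply: filterS near_Theta => t Tt; rewrite lee_fin dist_ge0 dist_le.
exact: (fine_cvg H).
Qed.

(** If the expectation of f does not depend on t, then qq t integrates to 0 against f for t != 0,
    and q inherits this as t tends to 0. *)
Lemma margin_limit (f : R * R -> R) : bfun f -> (forall z, `|f z| <= 1) ->
  (forall t, Theta t -> \int[P t]_z f z = \int[P 0]_z f z) ->
  \int[P 0]_z (q z * f z) = 0.
Proof.
move=> bf f1 H.
have h t : Theta t -> t != 0 -> `|\int[P 0]_z (q z * f z)| <= dist t.
  move=> Tt t0; have := H _ Tt; rewrite (expectation_density Tt bf).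
  have i1 := integrable_bfun (P 0) bf.
  have iqf := integrableM_bfun (integrable_q family) bf.
  have iqqf := integrableM_bfun (integrable_qq family Tt) bf.
  have -> : \int[P 0]_z ((1 + t * qq t z) * f z) =
      \int[P 0]_z f z + t * \int[P 0]_z (qq t z * f z).
    rewrite -RintegralZl// -RintegralD//.
      by apply: eq_Rintegral => z _; rewrite mulrDl mul1r mulrA.
    by have := integrableZl measurableT t iqqf; apply: eq_integrable => // z _ /=.
  move=> /eqP; rewrite -subr_eq0 addrAC subrr add0r mulf_eq0 (negbTE t0) /= => /eqP I0.
  have -> : \int[P 0]_z (q z * f z) = - \int[P 0]_z ((qq t z - q z) * f z).
    transitivity (- (\int[P 0]_z (qq t z * f z) - \int[P 0]_z (q z * f z))).
      by rewrite I0 sub0r opprK.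
    by rewrite -RintegralB//; congr (- _); apply: eq_Rintegral => z _; rewrite mulrBl.
  rewrite normrN -[leRHS]mulr1; exact: (weighted_norm_le (weight_diff Tt) bf f1).
apply/eqP; rewrite -normr_le0 leNgt; apply/negP => I0.
have lt0 : \forall t \near (0 : R)^', dist t < `|\int[P 0]_z (q z * f z)|.
  exact: (cvgr_lt _ dist_cvg0).
have n0 : \forall t \near (0 : R)^', t != 0 by exact: nbhs_dnbhs_neq.
have /(@filter_ex _ _ (Proper_dnbhs_numFieldType _))[t [[Tt t0] tlt]] : \forall t \near (0 : R)^',
    (Theta t /\ t != 0) /\ dist t < `|\int[P 0]_z (q z * f z)|.
  by apply: filterI => //; apply: filterI => //; exact: near_Theta.
by have := h t Tt t0; rewrite leNgt tlt.
Qed.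

Lemma P_square_ae t : Theta t -> {ae P t, forall z, unit_square z}.
Proof.
move=> Tt; apply: (negligibleS _ (A := ~` (@unit_square R))) => //.
apply/negligibleP; first exact: measurableC (@measurable_unit_square R).
etransitivity; first exact: probability_setC (@measurable_unit_square R).
transitivity (1 - 1 : \bar R)%E; last exact: subee.
by congr (1 - _)%E; exact: (P_square family Tt).
Qed.

Lemma copula_margin1 t (s : R) : Theta t -> 0 <= s <= 1 -> \int[P t]_z le01 z.1 s = s.
Proof.
move=> Tt s01; have [_ /(_ _ s01)[E _] _] := P_copula family Tt; rewrite -[RHS]E.
pose B : set (R * R) := `]-oo, s] `*` `]-oo, 1].
have mB : measurable B by apply: measurableX.
rewrite /cdf2 -/B -[P t B]fineK ?fin_num_measure// /=.
transitivity (\int[P t]_z \1_B z); last first.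
  by rewrite /Rintegral integral_indic// setIT.
apply: ae_eq_Rintegral.
- exact: (proj1 (bfun_le01 measurable_fst (measurable_cst s))).
- exact: measurable_indic.
- apply: filterS (P_square_ae Tt) => z [_ /=]; rewrite in_itv/= => /andP[_ z2] _.
  rewrite indicE /le01; congr (_%:R); congr nat_of_bool.
  by apply/idP/idP => [zs|/set_mem[]]; [apply/mem_set; split; rewrite /= in_itv|rewrite /= in_itv].
Qed.

Lemma copula_margin2 t (s : R) : Theta t -> 0 <= s <= 1 -> \int[P t]_z le01 z.2 s = s.
Proof.
move=> Tt s01; have [_ /(_ _ s01)[_ E] _] := P_copula family Tt; rewrite -[RHS]E.
pose B : set (R * R) := `]-oo, 1] `*` `]-oo, s].
have mB : measurable B by apply: measurableX.
rewrite /cdf2 -/B -[P t B]fineK ?fin_num_measure// /=.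
transitivity (\int[P t]_z \1_B z); last first.
  by rewrite /Rintegral integral_indic// setIT.
apply: ae_eq_Rintegral.
- exact: (proj1 (bfun_le01 measurable_snd (measurable_cst s))).
- exact: measurable_indic.
- apply: filterS (P_square_ae Tt) => z [/= + _]; rewrite in_itv/= => /andP[_ z2] _.
  rewrite indicE /le01; congr (_%:R); congr nat_of_bool.
  by apply/idP/idP => [zs|/set_mem[_]]; [apply/mem_set; split; rewrite /= in_itv|rewrite /= in_itv].
Qed.

Lemma le01_norm (x y : R) : `|le01 x y| <= 1.
Proof. by rewrite /le01; case: (x <= y); rewrite ?normr1 ?normr0 ?ler01. Qed.

Lemma q_margin1 (s : R) : 0 <= s <= 1 -> \int[P 0]_z (q z * le01 z.1 s) = 0.
Proof.
move=> s01; apply: margin_limit => [|z|t Tt].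
- exact: (bfun_le01 measurable_fst (measurable_cst s)).
- exact: le01_norm.
- by rewrite !copula_margin1//; exact: Theta_0 family.
Qed.

Lemma q_margin2 (s : R) : 0 <= s <= 1 -> \int[P 0]_z (q z * le01 z.2 s) = 0.
Proof.
move=> s01; apply: margin_limit => [|z|t Tt].
- exact: (bfun_le01 measurable_snd (measurable_cst s)).
- exact: le01_norm.
- by rewrite !copula_margin2//; exact: Theta_0 family.
Qed.

Lemma dotp_K_op A (v : R * R -> R) :
  dotp (P 0) (K_op (P 0) A v) v = weighted_form (P 0) v (kernel2 (P 0) A).
Proof.
apply: eq_Rintegral => x _; rewrite mulrC; congr (_ * _).
by apply: eq_Rintegral => z _; rewrite mulrC.
Qed.

Lemma dotp_K_op_gt0 A : 0 < dotp (P 0) (K_op (P 0) A q) q.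
Proof.
rewrite dotp_K_op; apply: (weighted_form_gt0 P0_prod (integrable_q family)).
- exact: q_margin1.
- exact: q_margin2.
- exact: q_neq0 family.
Qed.

Variables (d : measure_display) (Omega : measurableType d) (Pr : R -> probability Omega R)
  (Z : nat -> Omega -> R * R) (obs : iid_observations Theta P Pr Z).

Definition kernel_curried A (x y z w : R * R) : R := kernel4 A (tnth [tuple x; y; z; w]).

Lemma kernel_curried_bfun A d' (S : measurableType d') (f1 f2 f3 f4 : S -> R * R) :
  measurable_fun setT f1 -> measurable_fun setT f2 -> measurable_fun setT f3 ->
  measurable_fun setT f4 -> bfun (fun s => kernel_curried A (f1 s) (f2 s) (f3 s) (f4 s)).
Proof. exact: bfun_kernel4. Qed.

Let bK A := @kernel_curried_bfun A.

Definition four_integral A := I4 (P 0) (kernel_curried A).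

Lemma b_fun_four_integral A t : Theta t -> let u := fun z => 1 + t * qq t z in
  b_fun Pr Z A t = four_integral A u u u u.
Proof.
move=> Tt u.
have wu : weight (P 0) u := integrable_density family Tt.
have -> : b_fun Pr Z A t = mean4 (P t) A.
  exact: (b_fun_mean4 (Z_measurable obs) (Z_independent obs Tt) (Z_law obs Tt)).
have bT : bfun (kernelT A : _ -> R) by exact: bfun_kernelT.
have i1 : (prodP (P t) (P t)).-integrable setT (EFin \o cst 1) by exact/integrable_bfun/bfun_cst.
have bI : bfun (fun x => \int[prodP (P t) (P t)]_y kernelT A (x, y)).
  have := bfun_partial_integral (prodP (P t) (P t)) i1 bT.
  by under eq_fun do under eq_Rintegral do rewrite mul1r.
rewrite /mean4 /law4.
transitivity (\int[prodP (P t) (P t)]_x \int[prodP (P t) (P t)]_y kernelT A (x, y)).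
  apply/esym/Rintegral_prod12; first exact: (integrable_bfun (law4 (P t)) bT).
  by move=> x; apply: integrable_bfun; exact: (bfun_section1 bT x).
transitivity (\int[P t]_x \int[P t]_y \int[P t]_z \int[P t]_w kernel_curried A x y z w).
  transitivity (\int[P t]_x \int[P t]_y \int[prodP (P t) (P t)]_zw kernelT A ((x, y), zw)).
    apply/esym.
    apply: (@Rintegral_prod12 _ _ _ _ _ (P t) (P t)
      (fun xy => \int[prodP (P t) (P t)]_zw kernelT A (xy, zw))).
      exact: (integrable_bfun (prodP (P t) (P t)) bI).
    by move=> x; apply: integrable_bfun; exact: (bfun_section1 bI x).
  apply: eq_Rintegral => x _; apply: eq_Rintegral => y _.
  have bxy := bfun_section1 bT (x, y).
  apply/esym; apply: (@Rintegral_prod12 _ _ _ _ _ (P t) (P t) (fun zw => kernelT A ((x, y), zw))).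
    exact: (integrable_bfun (prodP (P t) (P t)) bxy).
  by move=> z; apply: integrable_bfun; exact: (bfun_section1 bxy z).
have E3 x y z : \int[P t]_w kernel_curried A x y z w = H3 (P 0) (kernel_curried A) u x y z.
  by apply: (expectation_density Tt); apply: bK => //; exact: measurable_cst.
have E2 x y : \int[P t]_z \int[P t]_w kernel_curried A x y z w =
    H2 (P 0) (kernel_curried A) u u x y.
  etransitivity; first by apply: eq_Rintegral => z _; exact: E3.
  apply: (expectation_density Tt); apply: (bfun_H3 (bK A) (P 0)) => //; exact: measurable_cst.
have E1 x : \int[P t]_y \int[P t]_z \int[P t]_w kernel_curried A x y z w =
    H1 (P 0) (kernel_curried A) u u u x.
  etransitivity; first by apply: eq_Rintegral => y _; exact: E2.
  apply: (expectation_density Tt); apply: (bfun_H2 (bK A) (P 0)) => //; exact: measurable_cst.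
etransitivity; first by apply: eq_Rintegral => x _; exact: E1.
apply: (expectation_density Tt); exact: (bfun_H1 (bK A)).
Qed.

Let e : R * R -> R := fun=> 1.

Lemma H2_kernel2 A x y : H2 (P 0) (kernel_curried A) e e x y = kernel2 (P 0) A x y.
Proof.
apply: eq_Rintegral => z _; rewrite /e mul1r.
by apply: eq_Rintegral => w _; rewrite mul1r.
Qed.

Lemma four_integral_form A (v : R * R -> R) :
  four_integral A v v e e = weighted_form (P 0) v (kernel2 (P 0) A).
Proof.
suff E : H2 (P 0) (kernel_curried A) e e = kernel2 (P 0) A by rewrite /four_integral /I4 /H1 E.
by apply: funext => x; apply: funext => y; exact: H2_kernel2.
Qed.

Lemma Kform_integral A x : \int[P 0]_y Kform A x y = 0.
Proof.
have b (p : bool * bool) : bfun (fun y : R * R => gker p.1%:R x.1 y.1 * gker p.2%:R x.2 y.2 : R).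
  by apply: bfunM; apply: (bfun_gker _ (P 0)) => //; exact: measurable_cst.
transitivity (\int[P 0]_y (1 * \sum_(p : bool * bool)
    coef A p.1 p.2 * (gker p.1%:R x.1 y.1 * gker p.2%:R x.2 y.2))).
  by apply: eq_Rintegral => y _; rewrite mul1r /Kform pair_bigA.
rewrite (weighted_sum (weight_cst (P 0) 1) _ (fun p => coef A p.1 p.2) b).
apply: big1 => p _; rewrite -[RHS](mulr0 (coef A p.1 p.2)); congr (_ * _).
have bg (k a : R) : bfun (fun y : R => gker k a y).
  by apply: (bfun_gker _ U) => //; exact: measurable_cst.
under eq_Rintegral do rewrite mul1r.
by rewrite (mu_prod P0_prod (bg _ _) (bg _ _)) gker_margin mul0r.
Qed.

(** Integrating [Kform] over one argument gives 0. This removes the terms of order 0 and 1 in t from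
    the expansion of the mean. *)
Lemma four_integral_degenerate A (v : R * R -> R) : weight (P 0) v ->
  four_integral A v e e e = 0.
Proof.
move=> wv; have we := weight_cst (P 0) 1.
have b1 : bfun (H1 (P 0) (kernel_curried A) e e e) := bfun_H1 (bK A) we we we.
have mv : measurable_fun setT v by apply/measurable_EFinP; exact: measurable_int wv.
rewrite -[RHS](Rintegral_cst1 (P 0)); apply: ae_eq_Rintegral.
- by apply: measurable_funM => //; case: b1.
- exact: measurable_cst.
apply: filterS (kernel2_ae P0_prod A) => x Kx _.
rewrite -[RHS](mulr0 (v x)); congr (_ * _); rewrite -[RHS](Kform_integral A x).
apply: ae_eq_Rintegral.
- suff [] : bfun (fun y => e y * H2 (P 0) (kernel_curried A) e e x y) by [].
  apply: bfunM; first exact: bfun_cst.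
  by apply: (bfun_H2 (bK A) (P 0)) => //; exact: measurable_cst.
- suff [] : bfun (fun y => Kform A x y : R) by [].
  by apply: (bfun_Kform _ (P 0)) => //; exact: measurable_cst.
- by apply: filterS Kx => y Ky _; rewrite H2_kernel2 Ky /e mul1r.
Qed.

Lemma weighted_formZ c (v : R * R -> R) A : weight (P 0) v ->
  weighted_form (P 0) (fun z => c * v z) (kernel2 (P 0) A) =
  c ^+ 2 * weighted_form (P 0) v (kernel2 (P 0) A).
Proof.
move=> wv; have we := weight_cst (P 0) 1; have wc := weightZ c wv.
rewrite -!four_integral_form /four_integral (I4Z (bK A) _ wv wc we we).
rewrite (I4_swap12 (bK A) (kernel4_swap12 A) (kernel4_swap23 A) wv wc we we).
by rewrite (I4Z (bK A) _ wv wv we we) mulrA.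
Qed.

(** N bounds the L^1 norms of q and of [qq t]. The quadratic term contributes 6 * 4N times the
    distance, the cubic one 4 * 2N^3 |t|, and the quartic one 2N^4 t^2, which is at most 2N^4
    |t|. *)
Lemma b_fun_remainder A t : Theta t -> t != 0 -> `|t| <= 1 -> dist t <= 1 ->
  forall N, N = \int[P 0]_z `|q z| + 1 ->
  `|b_fun Pr Z A t / t ^+ 2 - 6 * dotp (P 0) (K_op (P 0) A q) q| <=
  24 * N * dist t + (8 * N ^+ 3 + 2 * N ^+ 4) * `|t|.
Proof.
move=> Tt t0 t1 d1 N NE.
have we := weight_cst (P 0) 1.
have wq : weight (P 0) q := integrable_q family.
have wqt : weight (P 0) (qq t) := integrable_qq family Tt.
pose v z := t * qq t z; have wv : weight (P 0) v := weightZ t wqt.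
have iN (u : R * R -> R) (wu : weight (P 0) u) :
    (P 0).-integrable setT (EFin \o (fun z => `|u z|)) := integrable_abse wu.
have qN : \int[P 0]_z `|q z| <= N by rewrite NE lerDl ler01.
have qtN : \int[P 0]_z `|qq t z| <= N.
  apply: (@le_trans _ _ (\int[P 0]_z (`|q z| + `|qq t z - q z|))).
    apply: le_Rintegral => //.
    - exact: iN.
    - have := integrableD measurableT (iN _ wq) (iN _ (weight_diff Tt)).
      by apply: eq_integrable => // z _ /=.
    - by move=> z _; rewrite -{1}(subrK (q z) (qq t z)) addrC ler_normD.
  rewrite RintegralD//; [by rewrite NE lerD2l|exact: iN|exact: (iN _ (weight_diff Tt))].
have vN : \int[P 0]_z `|v z| = `|t| * \int[P 0]_z `|qq t z|.
  rewrite -RintegralZl//; last exact: iN.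
  by apply: eq_Rintegral => z _; rewrite normrM.
have e1 : \int[P 0]_z `|e z| = 1 by rewrite /e normr1; exact: Rintegral_cst1.
have K2 x y z w : `|kernel_curried A x y z w| <= 2 by exact: kernel4_bound.
rewrite (b_fun_four_integral A Tt) /=.
have EX : four_integral A (fun z => 1 + t * qq t z) (fun z => 1 + t * qq t z)
    (fun z => 1 + t * qq t z) (fun z => 1 + t * qq t z) = four_integral A e e e e +
    4 * four_integral A v e e e + 6 * four_integral A v v e e + 4 * four_integral A v v v e +
    four_integral A v v v v.
  exact: (I4_expansion (bK A) (kernel4_swap12 A) (kernel4_swap23 A) (kernel4_swap34 A) wv).
rewrite EX (four_integral_degenerate A we) (four_integral_degenerate A wv).
rewrite four_integral_form (weighted_formZ t A wqt) dotp_K_op.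
have h3 : `|four_integral A v v v e| <= _ := I4_le (bK A) wv wv wv we K2.
have h4 : `|four_integral A v v v v| <= _ := I4_le (bK A) wv wv wv wv K2.
have hn : `|four_integral A (qq t) (qq t) e e - four_integral A q q e e| <= _ :=
  I4_near (bK A) (kernel4_swap12 A) (kernel4_swap23 A) wqt wq K2.
move: h3 h4 hn; rewrite e1 vN !four_integral_form.
rewrite -/(dist t); have := dist_ge0 t.
have a0 : 0 <= \int[P 0]_z `|q z| by apply: Rintegral_ge0.
have b0 : 0 <= \int[P 0]_z `|qq t z| by apply: Rintegral_ge0.
have N0 : 0 <= N by rewrite (le_trans a0).
move: (weighted_form _ _ _) (weighted_form _ _ _) (four_integral _ _ _ _ _)
  (four_integral _ _ _ _ _) (dist t) d1 (\int[P 0]_z `|q z|) (\int[P 0]_z `|qq t z|) a0 b0 qN qtN.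
move=> W0 W X4 X3 D D1 a b a0 b0 aN bN D0 h3 h4 hn.
have t2 : 0 < `|t| by rewrite normr_gt0.
have {}h3 : `|X3 / t ^+ 2| <= 2 * N ^+ 3 * `|t|.
  rewrite normrM normfV normrX ler_pdivrMr ?exprn_gt0// (le_trans h3)//.
  rewrite (_ : `|t| * b * _ = 2 * b ^+ 3 * `|t| ^+ 3); last by ring.
  rewrite (_ : 2 * N ^+ 3 * _ * _ = 2 * N ^+ 3 * `|t| ^+ 3); last by ring.
  by rewrite ler_wpM2r ?exprn_ge0// ler_wpM2l// lerXn2r// ?nnegrE.
have {}h4 : `|X4 / t ^+ 2| <= 2 * N ^+ 4 * `|t|.
  rewrite normrM normfV normrX ler_pdivrMr ?exprn_gt0// (le_trans h4)//.
  rewrite (_ : `|t| * b * _ = 2 * b ^+ 4 * `|t| ^+ 4); last by ring.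
  rewrite (_ : 2 * N ^+ 4 * _ * _ = 2 * N ^+ 4 * `|t| ^+ 3); last by ring.
  rewrite ler_pM ?mulr_ge0 ?exprn_ge0//.
    by rewrite ler_wpM2l// lerXn2r// ?nnegrE.
  by rewrite exprS ler_piMl ?exprn_ge0.
have {}hn : `|W - W0| <= 4 * N * D.
  rewrite (le_trans hn)// (_ : 4 * N * D = 2 * D * (N + N)); last by ring.
  by rewrite ler_wpM2l ?mulr_ge0// lerD.
rewrite (_ : _ / _ - _ = 6 * (W - W0) + 4 * (X3 / t ^+ 2) + X4 / t ^+ 2); last by field.
rewrite (_ : 24 * N * D + _ = 6 * (4 * N * D) + 4 * (2 * N ^+ 3 * `|t|) + 2 * N ^+ 4 * `|t|); last by ring.
rewrite (le_trans (ler_normD _ _))// lerD// (le_trans (ler_normD _ _))//.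
by rewrite lerD// normrM ger0_norm// ler_wpM2l.
Qed.

Lemma b_fun_cvg A : b_fun Pr Z A t / t ^+ 2 @[t --> (0 : R)^'] -->
  6 * dotp (P 0) (K_op (P 0) A q) q.
Proof.
set c := 6 * _; pose N := \int[P 0]_z `|q z| + 1.
pose g t := 24 * N * dist t + (8 * N ^+ 3 + 2 * N ^+ 4) * `|t|.
have g0 : g t @[t --> (0 : R)^'] --> (0 : R).
  rewrite -[X in _ --> X](_ : 24 * N * 0 + (8 * N ^+ 3 + 2 * N ^+ 4) * `|0 : R| = 0); last first.
    by rewrite normr0 !mulr0 addr0.
  apply: cvgD; first by apply: cvgM; [exact: cvg_cst|exact: dist_cvg0].
  apply: cvgM; first exact: cvg_cst.
  by apply: cvg_norm; exact: cvg_within.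
apply/subr_cvg0; apply/norm_cvg0P.
apply: (@squeeze_cvgr _ _ _ _ (cst 0) g); [|exact: cvg_cst|exact: g0].
have n0 : \forall t \near (0 : R)^', t != 0 by exact: nbhs_dnbhs_neq.
have n1 : \forall t \near (0 : R)^', `|t| <= 1 by exact: dnbhs0_le.
have nd : \forall t \near (0 : R)^', dist t <= 1.
  have H : \forall t \near (0 : R)^', `|dist t| <= 1.
    by apply: cvgr0_norm_le => //; exact: dist_cvg0.
  apply: filterS H => t.
  by rewrite ger0_norm// dist_ge0.
apply: filterS2 near_Theta (filterI n0 (filterI n1 nd)) => t Tt [t0 [t1 d1]].
by rewrite normr_ge0 /=; exact: b_fun_remainder.
Qed.

End expansion.

(** * Rate functions near zero *)

Section rate_series_theory.
Context {R : realType}.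

Lemma geometric_le2 (x : R) n : 0 <= x <= 2^-1 -> \sum_(k < n) x ^+ k <= 2.
Proof.
move=> /andP[x0 x2]; elim: n => [|n ih]; first by rewrite big_ord0.
rewrite big_ord_recl expr0 (_ : \sum_(i < n) x ^+ lift ord0 i = x * \sum_(i < n) x ^+ i).
  have := ler_wpM2l x0 ih; lra.
by rewrite mulr_sumr; apply: eq_bigr => i _; rewrite -exprS.
Qed.

(** Convergence at delta/2 bounds the terms there, and for |s| at most half of that radius the tail
    from s^3 on is dominated by a geometric series of ratio at most 1/2. *)
Lemma rate_series_cubic (l delta : R) (dd : R -> R) : 0 < delta -> rate_series l delta dd ->
  exists r C : R, [/\ 0 < r, 0 <= C &
    forall s, `|s| <= r -> `|dd s - s ^+ 2 / (6 * l)| <= C * `|s| ^+ 3].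
Proof.
move=> d0 [a [a0 a1 a2 H]].
pose r := delta / 2; have r0 : 0 < r by rewrite divr_gt0.
have rd : `|r| < delta by rewrite gtr0_norm// /r; lra.
have cr : cvgn (series (fun j => a j * r ^+ j)) by apply/cvg_ex; exists (dd r); exact: H.
have [M [Mr HM]] := cvg_seq_bounded (cvgP _ (cvg_series_cvg_0 cr)).
pose M1 : R := `|M| + 1.
have aM j : `|a j| * r ^+ j <= M1.
  have /HM /(_ j I) : M < M1 by rewrite /M1 (le_lt_trans (ler_norm M))// ltrDl.
  by rewrite /= normrM normrX (gtr0_norm r0).
have M10 : 0 <= M1 by rewrite addr_ge0.
exists (r / 2), (2 * M1 / r ^+ 3); split.
- by rewrite divr_gt0.
- by apply: divr_ge0; [exact: mulr_ge0|exact: exprn_ge0 (ltW r0)].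
move=> s sr; have sd : `|s| < delta by move: sr; rewrite /r; lra.
have [x0 x2] : 0 <= `|s| / r /\ `|s| / r <= 2^-1.
  by rewrite divr_ge0 ?(ltW r0)// ler_pdivrMr// mulrC.
have tail n : `|series (fun j => a j * s ^+ j) (3 + n)%N - s ^+ 2 / (6 * l)|
    <= 2 * M1 / r ^+ 3 * `|s| ^+ 3.
  rewrite /series /= big_mkord big_split_ord /= !big_ord_recl big_ord0 /= a0 a1 /bump /= a2.
  set S := \sum_(i < n) _.
  rewrite [X in `|X|](_ : _ = S); last first.
    by rewrite !mul0r !add0r addr0 mulrC addrAC subrr add0r.
  rewrite /S {S}.
  rewrite (le_trans (ler_norm_sum _ _ _))//.
  apply: (@le_trans _ _ (\sum_(k < n) M1 * (`|s| / r) ^+ 3 * (`|s| / r) ^+ k)).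
    apply: ler_sum => k _; rewrite normrM normrX -mulrA -exprD expr_div_n.
    by rewrite [leRHS]mulrCA [leLHS]mulrC ler_wpM2l ?exprn_ge0// ler_pdivlMr ?exprn_gt0.
  rewrite -mulr_sumr expr_div_n.
  rewrite (_ : 2 * M1 / r ^+ 3 * `|s| ^+ 3 = M1 * (`|s| ^+ 3 / r ^+ 3) * 2); last by ring.
  by rewrite ler_wpM2l ?mulr_ge0 ?invr_ge0 ?exprn_ge0 ?(ltW r0)// geometric_le2// x0.
have cs : (fun n => `|series (fun j => a j * s ^+ j) (3 + n)%N - s ^+ 2 / (6 * l)|) @ \oo -->
    `|dd s - s ^+ 2 / (6 * l)|.
  apply: cvg_norm; apply: cvgB; last exact: cvg_cst.
  have := H s sd; rewrite -(cvg_shiftn 3); apply: cvg_trans.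
  by apply: near_eq_cvg; apply: nearW => n /=; rewrite addnC.
rewrite -(cvg_lim _ cs)//; apply: limr_le; first by apply/cvg_ex; eexists; exact: cs.
exact: nearW.
Qed.

Lemma rate_series_sqrt_cvg (l delta G : R) (dd g : R -> R) : 0 < delta -> rate_series l delta dd ->
  (\forall t \near (0 : R)^', 0 <= g t) -> g t / t ^+ 2 @[t --> (0 : R)^'] --> G ->
  dd (Num.sqrt (g t)) / t ^+ 2 @[t --> (0 : R)^'] --> G / (6 * l).
Proof.
move=> d0 /(rate_series_cubic d0)[r [C [r0 C0 H]]] g0 gG.
have n0 : \forall t \near (0 : R)^', t != 0 by exact: nbhs_dnbhs_neq.
have t0 : (t : R) @[t --> (0 : R)^'] --> (0 : R) by exact: cvg_within.
have gc : g t @[t --> (0 : R)^'] --> (0 : R).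
  have h : (g t / t ^+ 2) * (t * t) @[t --> (0 : R)^'] --> (0 : R).
    rewrite -[X in _ --> X](_ : G * (0 * 0) = 0); last by rewrite !mulr0.
    by apply: cvgM => //; exact: cvgM.
  apply: cvg_trans h; apply: near_eq_cvg; apply: filterS n0 => t tn0.
  by rewrite -expr2 divfK// expf_neq0.
have sc : Num.sqrt (g t) @[t --> (0 : R)^'] --> (0 : R).
  rewrite -[X in _ --> X](sqrtr0 R); apply: continuous_cvg => //; exact: sqrt_continuous.
have gl : g t / t ^+ 2 / (6 * l) @[t --> (0 : R)^'] --> G / (6 * l).
  by apply: cvgM => //; exact: cvg_cst.
have err : dd (Num.sqrt (g t)) / t ^+ 2 - g t / t ^+ 2 / (6 * l) @[t --> (0 : R)^'] --> (0 : R).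
  apply/norm_cvg0P.
  apply: (@squeeze_cvgr _ _ _ _ (cst 0) (fun t => C * (g t / t ^+ 2 * Num.sqrt (g t)))).
  - have sr : \forall t \near (0 : R)^', `|Num.sqrt (g t)| <= r.
      by apply: cvgr0_norm_le => //; exact: sc.
    apply: filterS2 g0 (filterI n0 sr) => t gt0 [tn0 /H].
    rewrite normr_ge0 /= sqr_sqrtr// (ger0_norm (sqrtr_ge0 _)) => h.
    have t2 : 0 < t ^+ 2 by rewrite exprn_even_gt0.
    rewrite (_ : _ - _ = (dd (Num.sqrt (g t)) - g t / (6 * l)) / t ^+ 2); last by ring.
    rewrite normrM normfV (gtr0_norm t2) ler_pdivrMr// (le_trans h)//.
    rewrite exprSr sqr_sqrtr// (_ : C * (g t / _ * _) * _ = C * (g t * Num.sqrt (g t)))//.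
    by field.
  - exact: cvg_cst.
  - rewrite -[X in _ --> X](_ : C * (G * 0) = 0); last by rewrite !mulr0.
    by apply: cvgM; [exact: cvg_cst|exact: cvgM].
rewrite -[X in _ --> X]addr0.
rewrite (_ : (fun t => dd _ / _) = (fun t => g t / t ^+ 2 / (6 * l) +
  (dd (Num.sqrt (g t)) / t ^+ 2 - g t / t ^+ 2 / (6 * l)))); first exact: cvgD.
by apply: funext => t; rewrite addrC subrK.
Qed.

(** The leading term makes the rate positive at some level y = t^2 as small as desired; monotonicity
    then spreads positivity to all larger levels. *)
Lemma rate_series_pos_near (l delta : R) (dd : R -> R) (x : R) : 0 < delta -> 0 < l ->
  rate_series l delta dd -> 0 < x -> exists2 y, 0 < y <= x & 0 < dd (Num.sqrt y).
Proof.
move=> d0 l0 rs x0.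
have h : (fun t : R => t ^+ 2 / t ^+ 2) @ (0 : R)^' --> (1 : R).
  apply: cvg_near_cst; have n0 : \forall t \near (0 : R)^', t != 0 by exact: nbhs_dnbhs_neq.
  by apply: filterS n0 => t tn0; rewrite divff// expf_neq0.
have h0 : \forall t \near (0 : R)^', 0 <= t ^+ 2 by apply: nearW => t; exact: sqr_ge0.
have lim := rate_series_sqrt_cvg d0 rs h0 h.
have pos : \forall t \near (0 : R)^', 0 < dd (Num.sqrt (t ^+ 2)) / t ^+ 2.
  by apply: (cvgr_gt _ lim); rewrite divr_gt0// mulr_gt0.
have small : \forall t \near (0 : R)^', `|t| <= Num.min 1 x.
  by apply: dnbhs0_le; rewrite lt_min ltr01.
have n0 : \forall t \near (0 : R)^', t != 0 by exact: nbhs_dnbhs_neq.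
have /(@filter_ex _ _ (Proper_dnbhs_numFieldType _))[t [[tpos tn0]]] : \forall t \near (0 : R)^',
    (0 < dd (Num.sqrt (t ^+ 2)) / t ^+ 2 /\ t != 0) /\ `|t| <= Num.min 1 x.
  by apply: filterI => //; exact: filterI.
rewrite le_min => /andP[t1 tx]; have t2 : 0 < t ^+ 2 by rewrite exprn_even_gt0.
exists (t ^+ 2).
  rewrite t2 -real_normK ?num_real// expr2 (le_trans _ tx)// ler_piMl//.
by move: tpos; rewrite pmulr_lgt0// invr_gt0.
Qed.

End rate_series_theory.

Section ereal_limits.
Context {R : realType}.

(** Restricted to positive c because the bounds on ratios are established for such c. *)
Lemma lee_of_lt (x : \bar R) (a : R) : 0 < a ->
  (forall c, 0 < c -> c < a -> (c%:E <= x)%E) -> (a%:E <= x)%E.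
Proof.
move=> a0 H; apply/lee_subgt0Pr => e e0.
pose c := Num.max (a - e) (a / 2).
apply: (@le_trans _ _ c%:E); first by rewrite -EFinB lee_fin /c le_max lexx.
apply: H; first by rewrite /c lt_max (_ : 0 < a / 2) ?orbT// divr_gt0.
by rewrite /c gt_max; apply/andP; split; lra.
Qed.

Lemma gee_of_gt (x : \bar R) (a : R) : (forall c, a < c -> (x <= c%:E)%E) -> (x <= a%:E)%E.
Proof. by move=> H; apply/lee_addgt0Pr => e e0; rewrite -EFinD; apply: H; rewrite ltrDl. Qed.

Lemma ereal_cvg_bounds (f : R -> \bar R) (F : set_system R) (FF : Filter F) (a : R) :
  (forall e, 0 < e -> \forall t \near F, ((a - e)%:E <= f t)%E /\ (f t <= (a + e)%:E)%E) ->
  f @ F --> a%:E.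
Proof.
move=> H; have fin e t : ((a - e)%:E <= f t)%E -> (f t <= (a + e)%:E)%E -> f t \is a fin_num.
  by case: (f t).
apply/fine_cvgP; split.
  by apply: filterS (H 1 ltr01) => t [h1 h2]; exact: fin h1 h2.
apply/cvgrPdist_le => e e0; apply: filterS (H e e0) => t [h1 h2] /=.
have ft := fin _ _ h1 h2.
by move: h1 h2; case: (f t) ft => // r _; rewrite !lee_fin /= ler_norml => h1 h2; apply/andP; split; lra.
Qed.

End ereal_limits.

(** * Rates of the tests *)

Section rates.
Context {R : realType} (Theta : set R) (P : R -> probability (R * R)%type R)
  (qq : R -> R * R -> R) (q : R * R -> R) (family : copula_family Theta P qq q)
  d (Omega : measurableType d) (Pr : R -> probability Omega R) (Z : nat -> Omega -> R * R)
  (obs : iid_observations Theta P Pr Z).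
Implicit Types (S : nat -> Omega -> R) (A : stat).

Let T0 : Theta 0 := Theta_0 family.

(** The levels b - [deviation n] here and b + [deviation n] below enclose T_n with probability
    tending to 1 under the alternative t. *)
Definition upper_rate A t r := forall e : R, 0 < e -> \forall n \near \oo,
  (Pr 0%R [set w | (b_fun Pr Z A t - deviation n <= T_n Z A n w)%R]
     <= (expR (- (n%:R * (r - e))))%:E)%E.

Definition lower_rate A t r := forall e : R, 0 < e -> \forall n \near \oo,
  ((expR (- (n%:R * (r + e))))%:E <=
     Pr 0%R [set w | (b_fun Pr Z A t + deviation n <= T_n Z A n w)%R])%E.

Definition measurable_stat S := forall n, measurable_fun setT (S n).

Lemma measurable_tail S n x : measurable_stat S -> measurable [set w | x <= S n w].
Proof. by move=> mS; rewrite -[X in measurable X]setTI; apply: measurable_fun_le => //; exact: measurable_cst. Qed.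

Lemma tail01 S n x : measurable_stat S -> (0 <= Pr 0%R [set w | (x <= S n w)%R] <= 1)%E.
Proof. by move=> mS; rewrite measure_ge0 probability_le1//; exact: measurable_tail. Qed.

(** T_n and V_n are comparable only in the absence of ties, which has probability 1 under the null
    hypothesis. *)
Lemma tail_le_no_ties S S' n x y : measurable_stat S -> measurable_stat S' ->
  (forall w, no_ties (@sample R _ _ Z n w) -> x <= S n w -> y <= S' n w) ->
  (Pr 0%R [set w | (x <= S n w)%R] <= Pr 0%R [set w | (y <= S' n w)%R])%E.
Proof.
move=> mS mS' H.
have mt := measurable_ties obs n.
apply: (@le_trans _ _ (Pr 0 ([set w | y <= S' n w] `|` ties Z n))).
  apply: le_measure; rewrite ?inE.
  - exact: measurable_tail.
  - by apply: measurableU => //; exact: measurable_tail.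
  - by move=> w /= xS; have [nt|nt] := pselect (no_ties (@sample R _ _ Z n w)); [left; exact: H|right].
apply: (le_trans (measureU2 _ (measurable_tail n y mS') mt)).
by rewrite [X in (_ + X)%E](ties_null family obs T0) adde0.
Qed.

Lemma inv_cvg0 (c : R) : c / n%:R @[n --> \oo] --> (0 : R).
Proof.
have h : (n%:R^-1 : R) @[n --> \oo] --> (0 : R).
  by have := @cvg_harmonic R; rewrite /harmonic -(@cvg_shiftS R (fun n => n%:R^-1)).
by rewrite -(mulr0 c); apply: cvgM => //; exact: cvg_cst.
Qed.

(** The inequality for r, instead of an equality, leaves room for the rate at a lower level such as
    b(1 - b). *)
Lemma ld_upper_rate A S (delta : R) dd t (r : R) : measurable_stat S ->
  large_deviation Pr S delta dd -> 0 < b_fun Pr Z A t < delta ^+ 2 ->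
  r <= dd (Num.sqrt (b_fun Pr Z A t)) / 2 ->
  (forall n w, (4 <= n)%N -> no_ties (@sample R _ _ Z n w) -> T_n Z A n w <= S n w + 24 / n%:R) ->
  upper_rate A t r.
Proof.
move=> mS ld bd rd TS e e0.
(* This null sequence absorbs both the width of concentration and the gap between T_n and V_n. *)
pose u n : R := - deviation n - 24 / n%:R.
have u0 : u @ \oo --> (0 : R).
  rewrite -[X in _ --> X](_ : - 0 - 0 = 0); last by rewrite subr0 oppr0.
  by apply: cvgB; [apply: cvgN; exact: deviation_cvg0|exact: inv_cvg0].
have p01 n : (0 <= Pr 0%R [set w | (b_fun Pr Z A t + u n <= S n w)%R] <= 1)%E by exact: tail01.
have n4 : \forall n \near \oo, (4 <= n)%N by exact: nbhs_infty_ge.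
apply: filterS2 (ld_bounds p01 e0 (ld _ bd u u0)) n4 => n [_ h] n4.
apply: (@le_trans _ _ (Pr 0%R [set w | (b_fun Pr Z A t + u n <= S n w)%R])).
  apply: tail_le_no_ties => // [k|w nt]; first exact: (measurable_T_n obs A k).
  have := TS n w n4 nt; rewrite /u; lra.
by apply: (le_trans h); rewrite lee_fin ler_expR lerN2 ler_wpM2l// lerD2r.
Qed.

Lemma ld_lower_rate A S (delta : R) dd t (r : R) : measurable_stat S ->
  large_deviation Pr S delta dd -> 0 < b_fun Pr Z A t < delta ^+ 2 ->
  dd (Num.sqrt (b_fun Pr Z A t)) / 2 <= r ->
  (forall n w, (4 <= n)%N -> no_ties (@sample R _ _ Z n w) -> S n w - 24 / n%:R <= T_n Z A n w) ->
  lower_rate A t r.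
Proof.
move=> mS ld bd rd TS e e0.
pose u n : R := deviation n + 24 / n%:R.
have u0 : u @ \oo --> (0 : R).
  rewrite -[X in _ --> X](addr0 (0 : R)).
  by apply: cvgD; [exact: deviation_cvg0|exact: inv_cvg0].
have p01 n : (0 <= Pr 0%R [set w | (b_fun Pr Z A t + u n <= S n w)%R] <= 1)%E by exact: tail01.
have n4 : \forall n \near \oo, (4 <= n)%N by exact: nbhs_infty_ge.
apply: filterS2 (ld_bounds p01 e0 (ld _ bd u u0)) n4 => n [h _] n4.
apply: (@le_trans _ _ (Pr 0%R [set w | (b_fun Pr Z A t + u n <= S n w)%R])).
  by apply: (le_trans _ h); rewrite lee_fin ler_expR lerN2 ler_wpM2l// lerD2r.
apply: tail_le_no_ties => // [k|w nt]; first exact: (measurable_T_n obs A k).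
have := TS n w n4 nt; rewrite /u; lra.
Qed.

Lemma ld_compare S S' (delta delta' x x' : R) dd dd' : measurable_stat S -> measurable_stat S' ->
  large_deviation Pr S delta dd -> large_deviation Pr S' delta' dd' ->
  0 < x < delta ^+ 2 -> 0 < x' < delta' ^+ 2 -> x' <= x ->
  (forall n w, S n w <= S' n w) -> dd' (Num.sqrt x') <= dd (Num.sqrt x).
Proof.
move=> mS mS' ld ld' xd xd' xx SS.
have c0 : (cst 0 : R^nat) @ \oo --> (0 : R) by exact: cvg_cst.
have h := ld x xd _ c0; have h' := ld' x' xd' _ c0.
rewrite -(ler_pM2r (_ : 0 < 2^-1)) ?invr_gt0//.
apply: (ld_monotone _ _ _ h h').
- by move=> n; exact: tail01.
- by move=> n; exact: tail01.
- apply: nearW => n; apply: tail_le_no_ties => // w _; rewrite !addr0 => xS.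
  exact: le_trans xx (le_trans xS (SS n w)).
Qed.

Lemma ld_positive S (delta l : R) dd (x : R) : measurable_stat S -> 0 < delta -> 0 < l ->
  large_deviation Pr S delta dd -> rate_series l delta dd -> 0 < x < delta ^+ 2 ->
  0 < dd (Num.sqrt x).
Proof.
move=> mS d0 l0 ld rs /andP[x0 xd].
have [y /andP[y0 yx] dy] := rate_series_pos_near d0 l0 rs x0.
apply: (lt_le_trans dy); apply: (ld_compare mS mS ld ld) => //.
- by rewrite x0.
- by rewrite y0 (le_lt_trans yx).
Qed.

Section size_ratio.
Variables (beta : R) (beta01 : 0 < beta < 1).

Lemma sample_size_bounds A t (p r eta : R) : Theta t -> 0 < p -> 0 < r ->
  upper_rate A t p -> lower_rate A t r -> 0 < eta -> eta < p ->
  exists K : R, \forall alpha \near (0 : R)^'+, exists x : R,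
    [/\ sample_size Pr Z A alpha beta t = x%:E, 4 <= x,
        ln (alpha^-1) / (r + eta) <= x & x <= ln (alpha^-1) / (p - eta) + K].
Proof.
move=> Tt p0 r0 up low eta0 etap.
apply: (@sample_size_near _ _ _ Pr Z A beta t (b_fun Pr Z A t) p r deviation) => //.
- by move=> n; exact: (measurable_T_n obs A n).
- by move=> e e0; exact: (T_n_lln family obs Tt A e0).
Qed.

Lemma size_ratio_liminf_ge A A' t (p r p' r' : R) : Theta t ->
  0 < p -> 0 < r -> 0 < p' -> 0 < r' -> upper_rate A t p -> lower_rate A t r ->
  upper_rate A' t p' -> lower_rate A' t r' ->
  ((p' / r)%:E <= size_ratio_liminf Pr Z A A' beta t)%E.
Proof.
move=> Tt p0 r0 p0' r0' up low up' low'.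
apply: lee_of_lt; first exact: divr_gt0.
move=> c c0; rewrite ltr_pdivlMr// => cr.
(* The requirement is c(r + eta) < p' - eta, that is eta(1 + c) < p' - c r; the factor 2 makes it
   strict, and p / 2 keeps eta below p. *)
pose eta := Num.min (p / 2) ((p' - c * r) / (2 * (1 + c))).
have c1 : 0 < 1 + c by rewrite addr_gt0.
have h0 : 0 < (p' - c * r) / (2 * (1 + c)) by rewrite divr_gt0 ?subr_gt0 ?mulr_gt0.
have eta0 : 0 < eta by rewrite lt_min h0 divr_gt0.
have etap : eta < p by rewrite /eta gt_min (_ : p / 2 < p)//; lra.
have key : eta * (1 + c) < p' - c * r.
  have : eta * (2 * (1 + c)) <= p' - c * r.
    by rewrite -ler_pdivlMr ?mulr_gt0// /eta ge_min lexx orbT.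
  have : 0 < eta * (1 + c) by rewrite mulr_gt0.
  lra.
have ce : 0 < c * eta by rewrite mulr_gt0.
have crp : 0 < c * r by rewrite mulr_gt0.
have etap' : eta < p' by lra.
have [K H] := sample_size_bounds Tt p0 r0 up low eta0 etap.
have [K' H'] := sample_size_bounds Tt p0' r0' up' low' eta0 etap'.
apply: (@limf_einf_ratio _ _ _ c (r + eta) (p' - eta)) => //.
- by rewrite addr_gt0.
- by rewrite subr_gt0.
- by rewrite ltr_pdivlMr ?addr_gt0//; lra.
exists K'; apply: filterS2 H H' => alpha [x [Nx _ xl _]] [y [Ny y4 _ yu]].
by exists x, y; split => //; rewrite (lt_le_trans _ y4).
Qed.

Lemma size_ratio_limsup_le A A' t (p r p' r' : R) : Theta t ->
  0 < p -> 0 < r -> 0 < p' -> 0 < r' -> upper_rate A t p -> lower_rate A t r ->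
  upper_rate A' t p' -> lower_rate A' t r' ->
  (size_ratio_limsup Pr Z A A' beta t <= (r' / p)%:E)%E.
Proof.
move=> Tt p0 r0 p0' r0' up low up' low'.
apply: gee_of_gt => c rc; have c0 : 0 < c by rewrite (lt_trans _ rc)// divr_gt0.
move: rc; rewrite ltr_pdivrMr// => cr.
have c1 : 0 < 1 + c by rewrite addr_gt0.
(* Here the requirement is r' + eta < c(p - eta). *)
pose eta := Num.min (p' / 2) ((c * p - r') / (2 * (1 + c))).
have h0 : 0 < (c * p - r') / (2 * (1 + c)) by rewrite divr_gt0 ?subr_gt0 ?mulr_gt0.
have eta0 : 0 < eta by rewrite lt_min h0 divr_gt0.
have etap' : eta < p' by rewrite /eta gt_min (_ : p' / 2 < p')//; lra.
have key : eta * (1 + c) < c * p - r'.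
  have : eta * (2 * (1 + c)) <= c * p - r'.
    by rewrite -ler_pdivlMr ?mulr_gt0// /eta ge_min lexx orbT.
  have : 0 < eta * (1 + c) by rewrite mulr_gt0.
  lra.
have etap : eta < p by rewrite -(ltr_pM2l c0); lra.
have [K H] := sample_size_bounds Tt p0 r0 up low eta0 etap.
have [K' H'] := sample_size_bounds Tt p0' r0' up' low' eta0 etap'.
apply: (@limf_esup_ratio _ _ _ c (p - eta) (r' + eta)) => //.
- by rewrite subr_gt0.
- by rewrite addr_gt0.
- by rewrite ltr_pdivrMr ?subr_gt0//; lra.
exists K; apply: filterS2 H H' => alpha [x [Nx _ _ xu]] [y [Ny y4 yl _]].
by exists x, y; split => //; rewrite (lt_le_trans _ y4).
Qed.

End size_ratio.

Section quadratic_perturbation.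
Variables (phi : nat -> R * R -> R) (A : stat).

Definition sample_mean (f : R * R -> R) n (w : Omega) : R :=
  n%:R^-1 * \sum_(j < n) f (@sample R _ _ Z n w j).

Lemma measurable_sample_mean f n : measurable_fun setT f -> measurable_fun setT (sample_mean f n).
Proof.
move=> mf; apply: measurable_funM; first exact: measurable_cst.
by apply: measurable_sum => j; apply: measurableT_comp => //; exact: (Z_measurable obs).
Qed.

Lemma measurable_Vplus e : measurable_fun setT (phi 1%N) -> measurable_stat (Vplus_n Z phi A e).
Proof.
move=> mphi n; apply: measurable_funD; first exact: (measurable_V_n obs A n).
apply: measurable_funM; first exact: measurable_cst.
by apply: measurable_funX; exact: measurable_sample_mean.
Qed.

Lemma measurable_Vminus m e : (forall i, (1 <= i <= m)%N -> measurable_fun setT (phi i)) ->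
  measurable_stat (Vminus_n Z m phi A e).
Proof.
move=> mphi n; apply: measurable_funB; first exact: (measurable_V_n obs A n).
apply: measurable_funM; first exact: measurable_cst.
(* Nothing is known about [phi l] outside the range 1..m, so the summand is replaced by 0 there; the
   sum does not reach these indices. *)
have h (l : nat) : measurable_fun setT (fun w => if (1 <= l <= m)%N then sample_mean (phi l) n w ^+ 2 else 0).
  case: (1 <= l <= m)%N (@mphi l) => [/(_ isT) mphil|_]; last exact: measurable_cst.
  by apply: measurable_funX; exact: measurable_sample_mean.
rewrite (_ : (fun w => _) = (fun w => \sum_(2 <= l < m.+1)
    (if (1 <= l <= m)%N then sample_mean (phi l) n w ^+ 2 else 0))).
  exact: measurable_sum.
apply: funext => w; rewrite !big_nat; apply: eq_bigr => l /andP[l2 lm].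
by rewrite (ltnW l2) -ltnS lm.
Qed.

Lemma Vplus_ge e n w : 0 < e -> V_n Z A n w <= Vplus_n Z phi A e n w.
Proof. by move=> e0; rewrite lerDl mulr_ge0 ?sqr_ge0// mulr_ge0// ltW. Qed.

Lemma Vminus_le m e n w : 0 < e -> Vminus_n Z m phi A e n w <= V_n Z A n w.
Proof.
move=> e0; rewrite gerBl mulr_ge0//; first by rewrite mulr_ge0// ltW.
by apply: sumr_ge0 => l _; exact: sqr_ge0.
Qed.

Lemma T_n_V_n n w : (4 <= n)%N -> no_ties (@sample R _ _ Z n w) ->
  `|V_n Z A n w - T_n Z A n w| <= 24 / n%:R.
Proof. by move=> n4 nt; exact: vstat_T_stat. Qed.

End quadratic_perturbation.

Lemma L2_measurable (mu : probability (R * R)%type R) f : L2 mu f -> measurable_fun setT f.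
Proof.
move=> f2; apply/measurable_EFinP; apply: measurable_int.
apply/Lfun1_integrable; apply: Lfun_subset12 f2; exact: fin_num_measure.
Qed.

Lemma eigenbasis_measurable (mu : probability (R * R)%type R) k l m phi i :
  bounded_eigenbasis mu k l m phi -> (1 <= i <= m)%N -> measurable_fun setT (phi i).
Proof. by move=> [h _ _ _] /h[f2 _ _]; exact: L2_measurable f2. Qed.

(** With m = 0 the expansion of an eigenfunction would be an empty sum, hence null. Positivity makes
    [phi 1] a member of the basis, and so measurable. *)
Lemma eigenbasis_gt0 (mu : probability (R * R)%type R) k l m phi :
  eigenvalue_of mu k l -> bounded_eigenbasis mu k l m phi -> (0 < m)%N.
Proof.
move=> [f ef] [_ _ _ h]; case: m h => // /(_ f ef) f0; case: ef => _ + _; case.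
by apply: filterS f0 => z /[apply] ->; rewrite big_geq.
Qed.

End rates.

(** Completing the square, b < -1/2 + sqrt(delta^2 + 1/4) means b(1 + b) < delta^2; so all three
    levels b and b(1 -+ b) lie in the range of the large deviation limits. *)
Lemma tau_bounds {R : realType} A (delta b : R) : 0 < b < tau A delta ->
  [/\ b < 1, b < delta ^+ 2 & b * (1 + b) < delta ^+ 2].
Proof.
move=> /andP[b0]; rewrite /tau /tau_minus /tau_plus !lt_min => /andP[/andP[/andP[b1 bd] _] /andP[_ h]].
split => //; have h1 : b + 2^-1 < Num.sqrt (delta ^+ 2 + 4^-1) by lra.
have dp : 0 <= delta ^+ 2 + 4^-1 by rewrite addr_ge0 ?sqr_ge0.
have : (b + 2^-1) ^+ 2 < delta ^+ 2 + 4^-1.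
  by rewrite -[ltRHS]sqr_sqrtr// ltr_pXn2r// nnegrE ?sqrtr_ge0// addr_ge0 ?ltW.
by rewrite expr2; lra.
Qed.

Theorem theorem16 (R : realType)
  (* the family of distributions and the observations *)
  (Theta : set R) (P : R -> probability (R * R)%type R)
  (qq : R -> R * R -> R) (q : R * R -> R)
  (family : copula_family Theta P qq q)
  (d : measure_display) (Omega : measurableType d)
  (Pr : R -> probability Omega R) (Z : nat -> Omega -> R * R)
  (observations : iid_observations Theta P Pr Z)
  (* spectral data of the operators *)
  (lambda : stat -> R)
  (lambda_max : forall A, is_largest (eigenvalue_of (P 0) (kernel2 (P 0) A)) (lambda A))
  (s : stat -> R)
  (s_max : forall A, ~~ simple_stat A ->
     is_largest (eigenvalue_of (P 0) (kernel2 (P 0) A) `\ lambda A) (s A))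
  (eps_star : R)
  (eps_starE : eps_star = Num.min (lambda statC - s statC)
     (Num.min (lambda statD - s statD) (lambda statE - s statE)))
  (m : stat -> nat) (phi : stat -> nat -> R * R -> R)
  (phi_basis : forall A, ~~ simple_stat A ->
     bounded_eigenbasis (P 0) (kernel2 (P 0) A) (lambda A) (m A) (phi A))
  (* large deviations for B, F, DE *)
  (delta : stat -> R) (dd : stat -> R -> R) (theta_ : stat -> R)
  (delta_gt0 : forall A, simple_stat A -> 0 < delta A)
  (dd_series : forall A, simple_stat A -> rate_series (lambda A) (delta A) (dd A))
  (dd_ld : forall A, simple_stat A -> large_deviation Pr (T_n Z A) (delta A) (dd A))
  (dd_gt0 : forall A, simple_stat A ->
     forall t : R, 0 < t < delta A ^+ 2 -> 0 < dd A (Num.sqrt t) / 2)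
  (theta_gt0 : forall A, simple_stat A -> 0 < theta_ A)
  (theta_b : forall A, simple_stat A -> forall t, Theta t -> 0 < `|t| < theta_ A ->
     0 < b_fun Pr Z A t < delta A ^+ 2)
  (* large deviations for C, D, E *)
  (delta_e : stat -> R -> R) (dplus dminus : stat -> R -> R -> R)
  (theta_e : stat -> R -> R)
  (delta_e_gt0 : forall (A : stat) (e : R), ~~ simple_stat A -> 0 < e < eps_star -> 0 < delta_e A e)
  (dplus_series : forall (A : stat) (e : R), ~~ simple_stat A -> 0 < e < eps_star ->
     rate_series (lambda A + e) (delta_e A e) (dplus A e))
  (dplus_ld : forall (A : stat) (e : R), ~~ simple_stat A -> 0 < e < eps_star ->
     large_deviation Pr (Vplus_n Z (phi A) A e) (delta_e A e) (dplus A e))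
  (dminus_series : forall (A : stat) (e : R), ~~ simple_stat A -> 0 < e < eps_star ->
     rate_series (lambda A) (delta_e A e) (dminus A e))
  (dminus_ld : forall (A : stat) (e : R), ~~ simple_stat A -> 0 < e < eps_star ->
     large_deviation Pr (Vminus_n Z (m A) (phi A) A e) (delta_e A e) (dminus A e))
  (theta_e_gt0 : forall (A : stat) (e : R), ~~ simple_stat A -> 0 < e < eps_star -> 0 < theta_e A e)
  (theta_e_b : forall (A : stat) (e : R), ~~ simple_stat A -> 0 < e < eps_star ->
     forall t, Theta t -> 0 < `|t| < theta_e A e ->
     0 < b_fun Pr Z A t < tau A (delta_e A e))
  (theta_star : R -> R)
  (theta_starE : forall e, theta_star e =
     Num.min (theta_e statC e) (Num.min (theta_e statD e) (theta_e statE e)))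
  (beta : R) (beta01 : 0 < beta < 1) (A A' : stat) :
  (forall e t : R, 0 < e < eps_star -> Theta t -> t != 0 ->
     `|t| < Num.min (theta_star e)
              (Num.min (theta_ statB) (Num.min (theta_ statF) (theta_ statDE))) ->
     [/\ ((c_plus (b_fun Pr Z) dd dplus A' e t / c_minus (b_fun Pr Z) dd dminus A e t)%:E
            <= size_ratio_liminf Pr Z A A' beta t)%E,
         (size_ratio_liminf Pr Z A A' beta t <= size_ratio_limsup Pr Z A A' beta t)%E
       & (size_ratio_limsup Pr Z A A' beta t <=
          (c_minus (b_fun Pr Z) dd dminus A' e t / c_plus (b_fun Pr Z) dd dplus A e t)%:E)%E])
  /\ local_bahadur_efficiency Pr Z A' A beta
       (kappa (P 0) A' (lambda A') q / kappa (P 0) A (lambda A) q).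
Proof.
have lam0 B : 0 < lambda B := largest_eigenvalue_gt0 (P0_prod family) (lambda_max B).
have eps0 : 0 < eps_star.
  (* The second eigenvalue is bounded by the largest one and differs from it, so the range of
     epsilon is not empty. *)
  have sl B : ~~ simple_stat B -> s B < lambda B.
    move=> sB; have [[Ss ns] _] := s_max B sB; have [_ ub] := lambda_max B.
    rewrite lt_neqAle (ub _ Ss) andbT; apply/eqP => E; exact: ns.
  by rewrite eps_starE !lt_min !subr_gt0 !sl.
pose tmax e := Num.min (theta_star e)
  (Num.min (theta_ statB) (Num.min (theta_ statF) (theta_ statDE))).
have tmax0 e : 0 < e < eps_star -> 0 < tmax e.
  by move=> e01; rewrite /tmax theta_starE !lt_min !theta_e_gt0// !theta_gt0.
have mT B : measurable_stat (T_n Z B) := measurable_T_n observations B.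
(* Uniform treatment of both kinds of statistics: from here on only the rates c/2 and their
   positivity are used for the bounds on the ratios. *)
have rates B e t : 0 < e < eps_star -> Theta t -> t != 0 -> `|t| < tmax e ->
    [/\ 0 < c_plus (b_fun Pr Z) dd dplus B e t, 0 < c_minus (b_fun Pr Z) dd dminus B e t,
        upper_rate Pr Z B t (c_plus (b_fun Pr Z) dd dplus B e t / 2) &
        lower_rate Pr Z B t (c_minus (b_fun Pr Z) dd dminus B e t / 2)].
  move=> e01 Tt t0 tt; have ta : 0 < `|t| by rewrite normr_gt0.
  move: tt; rewrite /tmax theta_starE !lt_min => /and3P[/and3P[tC tD tE] tB /andP[tF tDE]].
  rewrite /c_plus /c_minus; have [sB|sB] := boolP (simple_stat B).
    have tb : 0 < `|t| < theta_ B by case: B sB => // _; rewrite ta.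
    have bd := theta_b B sB t Tt tb.
    have pos : 0 < dd B (Num.sqrt (b_fun Pr Z B t)).
      by have := dd_gt0 B sB _ bd; rewrite pmulr_lgt0// invr_gt0.
    split => //.
    - apply: (ld_upper_rate family observations (mT B) (dd_ld B sB) bd (lexx _)) => n w n4 _.
      by rewrite lerDl divr_ge0.
    - apply: (ld_lower_rate family observations (mT B) (dd_ld B sB) bd (lexx _)) => n w n4 _.
      by rewrite gerBl divr_ge0.
  have tb : 0 < `|t| < theta_e B e by case: B sB => // _; rewrite ta.
  have hb := theta_e_b B e sB e01 t Tt tb.
  have [b1 bd b1b] := tau_bounds hb; have /andP[b0 _] := hb.
  have /andP[e0 _] := e01.
  have d0 := delta_e_gt0 B e sB e01.
  set b := b_fun Pr Z B t in b0 b1 bd b1b hb *.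
  have bB : 0 < b < delta_e B e ^+ 2 by rewrite b0.
  (* By monotonicity the rate of V^+ at b(1 - b) is at most its rate at b, and the rate of V^- at
     b(1 + b) is at least its rate at b. *)
  have bm1 : b * (1 - b) <= b by rewrite ler_piMr ?(ltW b0)// gerBl ltW.
  have bp1 : b <= b * (1 + b) by rewrite ler_peMr ?(ltW b0)// lerDl ltW.
  have bm : 0 < b * (1 - b) < delta_e B e ^+ 2.
    by rewrite mulr_gt0 ?subr_gt0//= (le_lt_trans bm1).
  have bp : 0 < b * (1 + b) < delta_e B e ^+ 2 by rewrite mulr_gt0 ?addr_gt0.
  have m0 := eigenbasis_gt0 (proj1 (lambda_max B)) (phi_basis B sB).
  have mVp := measurable_Vplus observations B e (eigenbasis_measurable (phi_basis B sB) (i := 1%N) m0).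
  have mVm : measurable_stat (Vminus_n Z (m B) (phi B) B e).
    apply: (measurable_Vminus observations) => i; exact: eigenbasis_measurable (phi_basis B sB).
  have ldp := dplus_ld B e sB e01; have ldm := dminus_ld B e sB e01.
  have le0 : 0 < lambda B + e by rewrite addr_gt0.
  split.
  - exact: (ld_positive family observations mVp d0 le0 ldp (dplus_series B e sB e01) bm).
  - exact: (ld_positive family observations mVm d0 (lam0 B) ldm (dminus_series B e sB e01) bp).
  - apply: (ld_upper_rate family observations mVp ldp bB) => [|n w n4 nt].
      rewrite ler_pM2r ?invr_gt0//.
      exact: (ld_compare family observations mVp mVp ldp ldp bB bm bm1).
    have := T_n_V_n B n4 nt; have := Vplus_ge Z (phi B) B n w e0.
    by rewrite ler_norml => h1 /andP[h2 h3]; lra.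
  - apply: (ld_lower_rate family observations mVm ldm bB) => [|n w n4 nt].
      rewrite ler_pM2r ?invr_gt0//.
      exact: (ld_compare family observations mVm mVm ldm ldm bp bB bp1).
    have := T_n_V_n B n4 nt; have := Vminus_le Z (phi B) B (m B) n w e0.
    by rewrite ler_norml => h1 /andP[h2 h3]; lra.
have half (x y : R) : x / 2 / (y / 2) = x / y by rewrite invf_div mulrA divfK.
have part1 e t : 0 < e < eps_star -> Theta t -> t != 0 -> `|t| < tmax e ->
    [/\ ((c_plus (b_fun Pr Z) dd dplus A' e t / c_minus (b_fun Pr Z) dd dminus A e t)%:E
            <= size_ratio_liminf Pr Z A A' beta t)%E,
         (size_ratio_liminf Pr Z A A' beta t <= size_ratio_limsup Pr Z A A' beta t)%E
       & (size_ratio_limsup Pr Z A A' beta t <=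
          (c_minus (b_fun Pr Z) dd dminus A' e t / c_plus (b_fun Pr Z) dd dplus A e t)%:E)%E].
  move=> e01 Tt t0 tt.
  have [p0 r0 up low] := rates A e t e01 Tt t0 tt.
  have [p0' r0' up' low'] := rates A' e t e01 Tt t0 tt.
  have h2 (x : R) : 0 < x -> 0 < x / 2 by move=> x0; rewrite divr_gt0.
  split; [rewrite -half|exact: limf_einf_le_esup|rewrite -half].
  - exact: (size_ratio_liminf_ge family observations beta01 Tt (h2 _ p0) (h2 _ r0) (h2 _ p0')
      (h2 _ r0') up low up' low').
  - exact: (size_ratio_limsup_le family observations beta01 Tt (h2 _ p0) (h2 _ r0) (h2 _ p0')
      (h2 _ r0') up low up' low').
split=> //.
pose Q B := dotp (P 0) (K_op (P 0) B q) q.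
have Q0 B : 0 < Q B := dotp_K_op_gt0 family B.
(* Limit of [c_plus] / t^2, which still depends on epsilon through the shifted eigenvalue; [c_minus]
   / t^2 tends to [k B] directly. *)
pose kp B e := (if simple_stat B then lambda B else lambda B + e)^-1 * Q B.
pose k B := kappa (P 0) B (lambda B) q.
have k0 B : 0 < k B by apply: mulr_gt0; [rewrite invr_gt0; exact: lam0|exact: Q0].
have kp0 B e : 0 < e -> 0 < kp B e.
  move=> e0; apply: mulr_gt0; last exact: Q0.
  by rewrite invr_gt0; case: ifP => _; [exact: lam0|exact: addr_gt0].
have bc B := b_fun_cvg family observations B.
have t0 : \forall t \near (0 : R)^', t != 0 by exact: nbhs_dnbhs_neq.
have b0 B : b_fun Pr Z B t @[t --> (0 : R)^'] --> (0 : R).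
  have tc : (t : R) @[t --> (0 : R)^'] --> (0 : R) by exact: cvg_within.
  have h : (b_fun Pr Z B t / t ^+ 2) * (t * t) @[t --> (0 : R)^'] --> (0 : R).
    rewrite -[X in _ --> X](_ : 6 * Q B * (0 * 0) = 0); last by rewrite !mulr0.
    by apply: cvgM; [exact: bc|exact: cvgM].
  apply: cvg_trans h; apply: near_eq_cvg; apply: filterS t0 => t tn0.
  by rewrite -expr2 divfK// expf_neq0.
have b01 B : \forall t \near (0 : R)^', 0 < b_fun Pr Z B t < 1.
  have pos : \forall t \near (0 : R)^', 0 < b_fun Pr Z B t / t ^+ 2.
    by apply: (cvgr_gt _ (bc B)); apply: mulr_gt0; [rewrite ltr0n|exact: Q0].
  have lt1 : \forall t \near (0 : R)^', b_fun Pr Z B t < 1 by apply: (cvgr_lt _ (b0 B)); exact: ltr01.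
  apply: filterS2 lt1 (filterI t0 pos) => t -> [tn0].
  by rewrite pmulr_lgt0 ?andbT// invr_gt0 exprn_even_gt0.
(* Covers both b(1 - b) and b(1 + b), with c = -1 and c = 1: the correction is of higher order. *)
have bpm B (c : R) : b_fun Pr Z B t * (1 + c * b_fun Pr Z B t) / t ^+ 2 @[t --> (0 : R)^']
    --> 6 * Q B.
  rewrite (_ : (fun t => _ / _) =
    (fun t => b_fun Pr Z B t / t ^+ 2 * (1 + c * b_fun Pr Z B t))); last first.
    by apply: funext => t; rewrite mulrAC.
  rewrite -[X in _ --> X](_ : 6 * Q B * (1 + c * 0) = _); last by rewrite mulr0 addr0 mulr1.
  apply: cvgM; first exact: bc.
  apply: cvgD; first exact: cvg_cst.
  by apply: cvgM; [exact: cvg_cst|exact: b0].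
have lim (l : R) B : 0 < l -> 6 * Q B / (6 * l) = l^-1 * Q B.
  by move=> l0; field; rewrite gt_eqF.
have cpc B e : 0 < e < eps_star ->
    c_plus (b_fun Pr Z) dd dplus B e t / t ^+ 2 @[t --> (0 : R)^'] --> kp B e.
  move=> e01; have /andP[e0 _] := e01.
  rewrite /c_plus /kp; have [sB|sB] := boolP (simple_stat B).
    rewrite -lim//; apply: (rate_series_sqrt_cvg (delta_gt0 B sB) (dd_series B sB)); last exact: bc.
    by apply: filterS (b01 B) => t /andP[/ltW].
  rewrite -lim ?addr_gt0//.
  apply: (rate_series_sqrt_cvg (delta_e_gt0 B e sB e01) (dplus_series B e sB e01)).
    by apply: filterS (b01 B) => t /andP[bt0 bt1]; rewrite mulr_ge0 ?subr_ge0 ?ltW.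
  by have := bpm B (-1); under eq_fun do rewrite mulN1r.
have cmc B e : 0 < e < eps_star ->
    c_minus (b_fun Pr Z) dd dminus B e t / t ^+ 2 @[t --> (0 : R)^'] --> k B.
  move=> e01; rewrite /c_minus /k /kappa -/(Q B) -lim//.
  have [sB|sB] := boolP (simple_stat B).
    apply: (rate_series_sqrt_cvg (delta_gt0 B sB) (dd_series B sB)); last exact: bc.
    by apply: filterS (b01 B) => t /andP[/ltW].
  apply: (rate_series_sqrt_cvg (delta_e_gt0 B e sB e01) (dminus_series B e sB e01)).
    by apply: filterS (b01 B) => t /andP[bt0 bt1]; rewrite mulr_ge0 ?addr_ge0 ?ltW.
  by have := bpm B 1; under eq_fun do rewrite mul1r.
have quot (f g : R -> R) (a b : R) : b != 0 -> f t / t ^+ 2 @[t --> (0 : R)^'] --> a ->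
    g t / t ^+ 2 @[t --> (0 : R)^'] --> b -> f t / g t @[t --> (0 : R)^'] --> a / b.
  move=> bn0 fa gb.
  have h : f t / t ^+ 2 / (g t / t ^+ 2) @[t --> (0 : R)^'] --> a / b.
    by apply: cvgM => //; exact: cvgV.
  apply: cvg_trans h; apply: near_eq_cvg; apply: filterS t0 => t tn0.
  by rewrite invf_div mulrA divfK// expf_neq0.
have kpc B : kp B e @[e --> (0 : R)^'+] --> k B.
  rewrite /kp /k /kappa -/(Q B); case: (simple_stat B); first exact: cvg_cst.
  apply: cvgM; last exact: cvg_cst.
  apply: cvgV; first by rewrite gt_eqF.
  rewrite -[X in _ --> X]addr0; apply: cvgD; first exact: cvg_cst.
  exact: cvg_within.
(* The bounds hold for every epsilon, so one epsilon is chosen for which both limits in t are within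
   eta of the target; then t tends to 0. *)
have key eta : 0 < eta -> \forall t \near (0 : R)^',
    [/\ ((k A' / k A - eta)%:E <= size_ratio_liminf Pr Z A A' beta t)%E,
        (size_ratio_liminf Pr Z A A' beta t <= size_ratio_limsup Pr Z A A' beta t)%E &
        (size_ratio_limsup Pr Z A A' beta t <= (k A' / k A + eta)%:E)%E].
  move=> eta0.
  have c1 : kp A' e / k A @[e --> (0 : R)^'+] --> k A' / k A.
    by apply: cvgM => //; exact: cvg_cst.
  have c2 : k A' / kp A e @[e --> (0 : R)^'+] --> k A' / k A.
    by apply: cvgM; [exact: cvg_cst|apply: cvgV => //; rewrite gt_eqF].
  have n1 : \forall e \near (0 : R)^'+, k A' / k A - eta < kp A' e / k A.
    by apply: (cvgr_gt _ c1); rewrite gtrBl.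
  have n2 : \forall e \near (0 : R)^'+, k A' / kp A e < k A' / k A + eta.
    by apply: (cvgr_lt _ c2); rewrite ltrDl.
  have n3 : \forall e \near (0 : R)^'+, 0 < e < eps_star.
    by apply: filterS2 (nbhs_right_gt 0) (nbhs_right_lt eps0) => e -> ->.
  have [e [[e1 e2] e01]] : exists e, (k A' / k A - eta < kp A' e / k A /\
      k A' / kp A e < k A' / k A + eta) /\ 0 < e < eps_star.
    by apply: (@filter_ex _ (0 : R)^'+); apply: filterI => //; exact: filterI.
  have /andP[e0 _] := e01.
  have l1 : \forall t \near (0 : R)^', k A' / k A - eta <
      c_plus (b_fun Pr Z) dd dplus A' e t / c_minus (b_fun Pr Z) dd dminus A e t.
    have q1 := quot _ _ _ _ (lt0r_neq0 (k0 A)) (cpc A' e e01) (cmc A e e01).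
    by apply: (cvgr_gt _ q1).
  have l2 : \forall t \near (0 : R)^',
      c_minus (b_fun Pr Z) dd dminus A' e t / c_plus (b_fun Pr Z) dd dplus A e t <
      k A' / k A + eta.
    have q2 := quot _ _ _ _ (lt0r_neq0 (kp0 A e e0)) (cmc A' e e01) (cpc A e e01).
    by apply: (cvgr_lt _ q2).
  have l3 : \forall t \near (0 : R)^', `|t| < tmax e by apply: dnbhs0_lt; exact: tmax0.
  apply: filterS2 (filterI (near_Theta family) t0) (filterI l3 (filterI l1 l2)) =>
    t [Tt tn0] [tt [h1 h2]].
  have [g1 g2 g3] := part1 e t e01 Tt tn0 tt; split => //.
  - by apply: le_trans g1; rewrite lee_fin ltW.
  - by apply: (le_trans g3); rewrite lee_fin ltW.
split; apply: ereal_cvg_bounds => eta /key; apply: filterS => t [h1 h2 h3].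
- by split => //; exact: le_trans h3.
- by split => //; exact: le_trans h2.
Qed.
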